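(* i) The operator $\mathcal{L}=\Delta+\frac12\,\xi\cdot\nabla+1$ is selfadjoint in the space $X=L^2(\mathbb{R}^2,G^{-1}d\xi)$, with compact resolvent and purely discrete spectrum $$\sigma(\mathcal{L})=\Bigl\{-\frac n2\ \Big|\ n=0,1,2,\dots\Bigr\}.$$ ii) The operator $\Lambda$ defined by $\Lambda w=v^G\cdot\nabla w+(K*w)\cdot\nabla G$ is skew-symmetric in the same space $X$: $$\langle\Lambda w_1,w_2\rangle+\langle w_1,\Lambda w_2\rangle=0,\qquad\text{for all }w_1,w_2\in D(\Lambda)\subset X.$$
   Context: On $\mathbb{R}^2$ (variable $\xi$): $G(\xi)=\frac1{4\pi}e^{-|\xi|^2/4}$, $v^G(\xi)=\frac1{2\pi}\frac{\xi^\perp}{|\xi|^2}(1-e^{-|\xi|^2/4})$, $K(\xi)=\frac1{2\pi}\frac{\xi^\perp}{|\xi|^2}$ (Biot-Savart kernel), with $\xi^\perp=(-\xi_2,\xi_1)$. $X$ carries the scalar product $\langle w_1,w_2\rangle=\int_{\mathbb{R}^2}G(\xi)^{-1}w_1(\xi)w_2(\xi)\,d\xi$. The domain of $\mathcal{L}$ is $D(\mathcal{L})=\{w\in X:\Delta w\in X,\ \xi\cdot\nabla w\in X\}$. The domain of $\Lambda$ is $D(\Lambda)=\{w\in X: v^G\cdot\nabla w\in X\}$ (derivatives in the sense of distributions); it contains $D(\mathcal{L})$. *)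

(* Defs.v *)
From HB Require Import structures.
From mathcomp Require Import all_boot all_order all_algebra.
From mathcomp Require Import complex.
From mathcomp Require Import all_classical all_reals all_analysis.
From mathcomp Require Import measurable_realfun.

Set Implicit Arguments.
Unset Strict Implicit.
Unset Printing Implicit Defensive.
Import Order.TTheory GRing.Theory Num.Theory.
Import numFieldNormedType.Exports.

Local Open Scope classical_set_scope.
Local Open Scope ring_scope.

(* Unbounded operators on a real Hilbert space.  [V] is a space of
   representatives: [dot] is only a semi-inner product, and the Hilbert space is
   the quotient of [V] by the null vectors of [dot] (for L^2: functions modulo
   equality a.e.).  An operator is given by its graph: [A u f] means
   "u is in the domain of A and A u = f". *)
Section unbounded_operators.
Context (R : realType) (V : lmodType R) (dot : V -> V -> R).
Implicit Types (A : V -> V -> Prop) (u v f g : V) (z : R[i]).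

Definition hnorm u : R := Num.sqrt (dot u u).

Definition heq u v : Prop := hnorm (u - v) = 0.

Definition dom A : set V := [set u | exists f, A u f].

Definition linear_operator A : Prop :=
  [/\ A 0 0,
      forall (a : R) u v f g,
        A u f -> A v g -> A (a *: u + v) (a *: f + g),
      forall u u' f f', heq u u' -> heq f f' -> A u f -> A u' f' &
      forall u f g, A u f -> A u g -> heq f g].

Definition hdense (D : set V) : Prop :=
  forall u (e : R), 0 < e -> exists2 v, D v & hnorm (u - v) < e.

Definition adjoint A : V -> V -> Prop :=
  fun v g => forall u f, A u f -> dot f v = dot u g.

Definition selfadjoint A : Prop :=
  [/\ linear_operator A, hdense (dom A) & forall u f, A u f <-> adjoint A u f].

(* The complexification of V: the pair (U.1, U.2) stands for U.1 + i U.2. *)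
Definition cnorm (U : V * V) : R := Num.sqrt (dot U.1 U.1 + dot U.2 U.2).

Definition cscale z (U : V * V) : V * V :=
  (complex.Re z *: U.1 - complex.Im z *: U.2,
   complex.Re z *: U.2 + complex.Im z *: U.1).

(* Graph of A_C - z, where A_C is the complexification of A. *)
Definition cshift A z (U F : V * V) : Prop :=
  A U.1 (F + cscale z U).1 /\ A U.2 (F + cscale z U).2.

(* A_C - z maps its domain onto the whole space and has a bounded inverse; for a
   linear A the estimate also contains injectivity. *)
Definition resolvent_set A : set R[i] :=
  [set z | (forall F, exists U, cshift A z U F) /\
           exists C : R, forall U F, cshift A z U F -> cnorm U <= C * cnorm F].

Definition spectrum A : set R[i] := ~` resolvent_set A.

(* (A_C - z)^-1 sends bounded sequences F to sequences U having a convergent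
   subsequence. *)
Definition compact_inverse A z : Prop :=
  forall (U F : nat -> V * V),
    (forall n, cshift A z (U n) (F n)) ->
    (exists M : R, forall n, cnorm (F n) <= M) ->
    exists (k : nat -> nat) (U' : V * V),
      {homo k : m n / (m < n)%N} /\
      cnorm (U (k n) - U') @[n --> \oo] --> (0 : R).

Definition compact_resolvent A : Prop :=
  resolvent_set A !=set0 /\ forall z, resolvent_set A z -> compact_inverse A z.

Definition ceigenspace A z : set (V * V) := [set U | cshift A z U 0].

Definition cfinite_dim (E : set (V * V)) : Prop :=
  exists (n : nat) (B : 'I_n -> V * V), forall U, E U ->
    exists c : 'I_n -> R[i], cnorm (U - \sum_(i < n) cscale (c i) (B i)) = 0.

(* Every point of the spectrum is an isolated point of the spectrum and an
   eigenvalue of finite multiplicity (geometric, which is the algebraic one when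
   A is self-adjoint). *)
Definition purely_discrete_spectrum A : Prop :=
  forall z, spectrum A z ->
    [/\ exists2 e : R, 0 < e &
          forall z', spectrum A z' -> `|z' - z| < e%:C%C -> z' = z,
        exists2 U, ceigenspace A z U & cnorm U != 0 &
        cfinite_dim (ceigenspace A z)].

End unbounded_operators.

(* Distributions on R^2 are handled as functionals on functions R * R -> R, of
   which only the values on test functions matter. *)
Section distributions.
Context (R : realType).
Local Notation plane := (R * R)%type.
Implicit Types (phi f a : plane -> R) (T : (plane -> R) -> R).

Definition leb2 : {measure set (measurableTypeR R * measurableTypeR R) -> \bar R} :=
  (@lebesgue_measure R \x @lebesgue_measure R)%E.

Definition e1 : plane := (1, 0).
Definition e2 : plane := (0, 1).

Fixpoint class_C (n : nat) (phi : plane -> R) : Prop :=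
  continuous phi /\
  if n is n'.+1 then
    [/\ forall x, derivable phi x e1, forall x, derivable phi x e2,
        class_C n' ('D_e1 phi) & class_C n' ('D_e2 phi)]
  else True.

Definition test_function phi : Prop :=
  (forall n, class_C n phi) /\ compact (closure [set x | phi x != 0]).

Definition distr f : (plane -> R) -> R :=
  fun phi => \int[leb2]_x (f x * phi x).

Definition distr_D (v : plane) T : (plane -> R) -> R := fun phi => - T ('D_v phi).

Definition distr_mul a T : (plane -> R) -> R := fun phi => T (a \* phi).

Definition distr_laplacian T : (plane -> R) -> R :=
  distr_D e1 (distr_D e1 T) \+ distr_D e2 (distr_D e2 T).

(* b . grad T for a smooth vector field b *)
Definition distr_transport (b : plane -> plane) T : (plane -> R) -> R :=
  distr_mul (fst \o b) (distr_D e1 T) \+ distr_mul (snd \o b) (distr_D e2 T).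

Definition represents f T : Prop :=
  forall phi, test_function phi -> distr f phi = T phi.

End distributions.

Section gaussian_weight.
Context (R : realType).
Local Notation plane := (R * R)%type.
Implicit Type xi : plane.

(* |xi|^2; the library norm on R * R is the sup norm. *)
Definition sqnorm xi : R := xi.1 ^+ 2 + xi.2 ^+ 2.

Definition gaussG xi : R := (4 * pi)^-1 * expR (- sqnorm xi / 4).

Lemma gaussG_ge0 xi : 0 <= gaussG xi.
Proof. by rewrite mulr_ge0 ?expR_ge0// invr_ge0 mulr_ge0 ?pi_ge0. Qed.

Lemma gaussGV xi : (gaussG xi)^-1 = 4 * pi * expR (sqnorm xi / 4).
Proof. by rewrite invfM invrK mulNr expRN invrK. Qed.

Lemma measurable_gaussGV :
  measurable_fun setT
    (fun xi : measurableTypeR R * measurableTypeR R =>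
       (gaussG xi)^-1 : measurableTypeR R).
Proof.
under eq_fun do rewrite gaussGV.
apply: measurable_funM => //; apply: measurableT_comp => //.
by apply: measurable_funM => //; apply: measurable_funD;
  apply: measurable_funX.
Qed.

(* The measure G^-1 d xi. *)
Definition weighted (A : set (measurableTypeR R * measurableTypeR R)) : \bar R :=
  (\int[leb2 R]_(xi in A) ((gaussG xi)^-1)%:E)%E.

Let weighted0 : weighted set0 = 0%E.
Proof. by rewrite /weighted integral_set0. Qed.

Let weighted_ge0 A : (0 <= weighted A)%E.
Proof. by apply: integral_ge0 => xi _; rewrite lee_fin invr_ge0 gaussG_ge0. Qed.

Let weighted_sigma_additive : semi_sigma_additive weighted.
Proof.
move=> F mF tF mUF; rewrite /weighted ge0_integral_bigcup//=; last 2 first.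
- by apply/measurable_EFinP/measurable_funTS; exact: measurable_gaussGV.
- by move=> xi _; rewrite lee_fin invr_ge0 gaussG_ge0.
apply: is_cvg_ereal_nneg_natsum_cond => n _ _.
by apply: integral_ge0 => xi _; rewrite lee_fin invr_ge0 gaussG_ge0.
Qed.

HB.instance Definition _ := isMeasure.Build _ _ _ weighted
  weighted0 weighted_ge0 weighted_sigma_additive.

(* The space L^2(R^2, G^-1 d xi), as a space of functions not yet identified
   when equal almost everywhere. *)
Definition X := LfunType weighted (lee1n 2).

Definition dotX (w1 w2 : X) : R :=
  \int[leb2 R]_xi ((gaussG xi)^-1 * w1 xi * w2 xi).

End gaussian_weight.

Section vortex_operators.
Context (R : realType).
Local Notation plane := (R * R)%type.
Implicit Types (xi : plane) (w f : X R).

(* xi^perp / (2 pi |xi|^2) *)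
Definition kernelK xi : plane :=
  (- xi.2 / (2 * pi * sqnorm xi), xi.1 / (2 * pi * sqnorm xi)).

(* At the origin x / 0 = 0 gives 0, the value of the smooth extension. *)
Definition vG xi : plane :=
  ((kernelK xi).1 * (1 - expR (- sqnorm xi / 4)),
   (kernelK xi).2 * (1 - expR (- sqnorm xi / 4))).

(* K * w; the integrals converge for almost every xi. *)
Definition biot_savart (w : plane -> R) xi : plane :=
  (\int[leb2 R]_eta ((kernelK (xi - eta)).1 * w eta),
   \int[leb2 R]_eta ((kernelK (xi - eta)).2 * w eta)).

Definition in_X (T : (plane -> R) -> R) : Prop := exists f : X R, represents f T.

Definition dom_L : set (X R) :=
  [set w | in_X (distr_laplacian (distr w)) /\ in_X (distr_transport id (distr w))].

Definition graph_L w f : Prop :=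
  dom_L w /\
  represents f (fun phi => distr_laplacian (distr w) phi
                 + 2^-1 * distr_transport id (distr w) phi + distr w phi).

Definition dom_Lambda : set (X R) :=
  [set w | in_X (distr_transport vG (distr w))].

Definition graph_Lambda w f : Prop :=
  exists2 g : X R, represents g (distr_transport vG (distr w)) &
    {ae leb2 R, forall xi,
       f xi = g xi + ((biot_savart w xi).1 * 'D_(e1 R) (@gaussG R) xi +
                      (biot_savart w xi).2 * 'D_(e2 R) (@gaussG R) xi)}.

End vortex_operators.

(* Main.v *)
(** The functions H_m(x) H_n(y) G, i.e. the derivatives of G up to sign, are
    orthogonal in X. They are total: multiplication by G^-1 turns orthogonality
    to them into orthogonality of w to polynomials, hence (power series of
    Gaussians, then bounded limits of powers) to indicator functions of
    half-planes and so of all measurable sets. L is diagonal in this basis, with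
    eigenvalue -(m+n)/2, so that self-adjointness, compactness of the resolvent
    and the spectrum are facts on diagonal operators; an X-valued distribution
    L w is expanded by moving the derivatives onto cut-offs of the basis.

    For Lambda, v^G = Om x^perp with Om radial. The angular derivative
    preserves the finite-dimensional levels m + n = N, where it is skew; this
    and a weak form of its commutation with radial multipliers give the
    skewness of the transport term, after cutting off Om^-1. In the nonlocal
    term, grad G = -(x/2) G removes the weight, and Fubini together with
    K(x - y) . (x - y) = 0 gives the skewness. *)
From HB Require Import structures.
Require Import Defs.
From mathcomp Require Import all_boot all_order all_algebra.
From mathcomp Require Import complex.
From mathcomp Require Import all_classical all_reals all_analysis.
From mathcomp Require Import measurable_realfun.
From mathcomp Require Import ring lra.
Import Order.TTheory GRing.Theory Num.Theory.
Import numFieldNormedType.Exports.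

Set Implicit Arguments.
Unset Strict Implicit.
Unset Printing Implicit Defensive.

Local Open Scope classical_set_scope.
Local Open Scope ring_scope.


(** Membership in the domains is a statement about test functions only, and no approximation of [w]
    in a graph norm is made. The test side is made richer instead: polynomials become admissible,
    and each operator turns into a relation between Hermite coefficients. For L the coefficient
    relation alone does not give the domain, which asks for the Laplacian and for xi . grad w
    separately; this is why second derivatives of the expansion are summed on their own. For Lambda
    the weak angular derivative available is that of Om w, not of w, and Om^-1 grows like |xi|^2.
    The second argument is therefore multiplied by Om times an approximate inverse made of
    Gaussians, since multiplication by a Gaussian of small rate is a power series in |xi|^2, which
    the angular derivative ignores. The rates 1/16, 1/32 and 1/64 form one budget: G times a
    function of growth exp(|xi|^2/16) lies in X, and exp(|xi|^2/64) times a function of growth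
    exp(|xi|^2/32) stays within this. *)

(** * Semi-inner products *)

Section semi_inner_product.
Context (R : realType) (V : lmodType R) (dot : V -> V -> R).
Context (dotC : forall u v, dot u v = dot v u)
  (dotL : forall a u v w, dot (a *: u + v) w = a * dot u w + dot v w)
  (dot_ge0 : forall u, 0 <= dot u u).
Implicit Types (u v w : V) (a b : R).

Lemma sdotDl u v w : dot (u + v) w = dot u w + dot v w.
Proof. by rewrite -[u]scale1r dotL mul1r scale1r. Qed.

Lemma sdot0l w : dot 0 w = 0.
Proof. by apply: (addIr (dot 0 w)); rewrite -sdotDl addr0 add0r. Qed.

Lemma sdotZl a u w : dot (a *: u) w = a * dot u w.
Proof. by rewrite -[a *: u]addr0 dotL sdot0l addr0. Qed.

Lemma sdotNl u w : dot (- u) w = - dot u w.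
Proof. by rewrite -scaleN1r sdotZl mulN1r. Qed.

Lemma sdotBl u v w : dot (u - v) w = dot u w - dot v w.
Proof. by rewrite sdotDl sdotNl. Qed.

Lemma sdotDr u v w : dot w (u + v) = dot w u + dot w v.
Proof. by rewrite dotC sdotDl !(dotC w). Qed.

Lemma sdot0r w : dot w 0 = 0.
Proof. by rewrite dotC sdot0l. Qed.

Lemma sdotZr a u w : dot w (a *: u) = a * dot w u.
Proof. by rewrite dotC sdotZl dotC. Qed.

Lemma sdotNr u w : dot w (- u) = - dot w u.
Proof. by rewrite dotC sdotNl dotC. Qed.

Lemma sdotBr u v w : dot w (u - v) = dot w u - dot w v.
Proof. by rewrite dotC sdotBl !(dotC w). Qed.

Lemma sdot_suml (I : Type) (r : seq I) (P : pred I) (F : I -> V) w :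
  dot (\sum_(i <- r | P i) F i) w = \sum_(i <- r | P i) dot (F i) w.
Proof.
by elim/big_ind2: _ => [|x x' y y' <- <-|//]; rewrite ?sdot0l ?sdotDl.
Qed.

Lemma sdot_sumr (I : Type) (r : seq I) (P : pred I) (F : I -> V) w :
  dot w (\sum_(i <- r | P i) F i) = \sum_(i <- r | P i) dot w (F i).
Proof. by rewrite dotC sdot_suml; apply: eq_bigr => i _; rewrite dotC. Qed.

(** The quadratic [q] is nonnegative for every [t]. Null vectors other than 0 exist here, so a null
    [v] is a genuine separate case. *)
Lemma sdot_CS u v : dot u v ^+ 2 <= dot u u * dot v v.
Proof.
have q t : 0 <= dot u u - 2 * t * dot u v + t ^+ 2 * dot v v.
  have := dot_ge0 (u - t *: v).
  rewrite sdotBl !sdotBr !sdotZl !sdotZr (dotC v u); lra.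
have [v0|v0] := eqVneq (dot v v) 0.
  rewrite v0 mulr0; have [->|uv0] := eqVneq (dot u v) 0; first by rewrite expr0n.
  (* Here [q] is affine in [t], and this [t] would give it the value -1. *)
  have := q ((dot u u + 1) / (2 * dot u v)).
  rewrite v0 mulr0 addr0.
  have -> : 2 * ((dot u u + 1) / (2 * dot u v)) * dot u v = dot u u + 1 by field.
  lra.
have vp : 0 < dot v v by rewrite lt_neqAle eq_sym v0 dot_ge0.
have := q (dot u v / dot v v).
have -> : dot u u - 2 * (dot u v / dot v v) * dot u v +
   (dot u v / dot v v) ^+ 2 * dot v v = dot u u - dot u v ^+ 2 / dot v v by field.
by rewrite subr_ge0 ler_pdivrMr.
Qed.

Lemma sdot_addsq u v : dot (u + v) (u + v) <= 2 * dot u u + 2 * dot v v.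
Proof.
have := dot_ge0 (u - v).
rewrite sdotBl !sdotBr sdotDl !sdotDr (dotC v u); lra.
Qed.

Lemma sdot_subsq u v w :
  dot (u - w) (u - w) <= 2 * dot (u - v) (u - v) + 2 * dot (v - w) (v - w).
Proof. by have := sdot_addsq (u - v) (v - w); rewrite addrA subrK. Qed.

Lemma sdot_null u v : dot u u = 0 -> dot u v = 0.
Proof.
move=> u0; have := sdot_CS u v; rewrite u0 mul0r => h.
by apply/eqP; rewrite -sqrf_eq0 eq_le h sqr_ge0.
Qed.

Definition cvgH (u : nat -> V) v := dot (u n - v) (u n - v) @[n --> \oo] --> (0 : R).

Lemma cvg_sqr0 (f : nat -> R) : f n ^+ 2 @[n --> \oo] --> (0 : R) -> f n @[n --> \oo] --> (0 : R).
Proof.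
move=> h; apply/cvgr0Pnorm_lt => e e0.
have e20 : 0 < e ^+ 2 by rewrite exprn_gt0.
near=> n.
have : `|f n ^+ 2| < e ^+ 2 by near: n; move/cvgr0Pnorm_lt: h => /(_ _ e20).
by rewrite normrX ltr_pXn2r// nnegrE// ltW.
Unshelve. all: by end_near. Qed.

Lemma sqz0 (f g : nat -> R) : (forall n, 0 <= f n <= g n) -> g n @[n --> \oo] --> (0 : R) ->
  f n @[n --> \oo] --> (0 : R).
Proof.
move=> fg g0; apply: (@squeeze_cvgr _ _ _ _ (fun=> 0) g) => //; last exact: cvg_cst.
exact: nearW.
Qed.

Lemma cvgH_dotl (u : nat -> V) v w : cvgH u v -> dot (u n) w @[n --> \oo] --> dot v w.
Proof.
move=> uv.
suff : dot (u n - v) w @[n --> \oo] --> (0 : R).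
  move=> /(cvgD (cvg_cst (dot v w))); rewrite addr0; apply: cvg_trans.
  rewrite (_ : (fun n => _) = (fun n => dot v w + dot (u n - v) w))//.
  by apply/funext => n; rewrite sdotBl addrC subrK.
apply: cvg_sqr0; apply: (@sqz0 _ (fun n => dot (u n - v) (u n - v) * dot w w)).
  by move=> n; rewrite sqr_ge0 sdot_CS.
by rewrite -[X in _ --> X](mul0r (dot w w)); apply: cvgM => //; exact: cvg_cst.
Qed.

Lemma pythagoras (I : eqType) (r : seq I) (P : pred I) (y z : I -> V) :
  uniq r -> (forall p q, p != q -> dot (y p) (z q) = 0) ->
  dot (\sum_(p <- r | P p) y p) (\sum_(p <- r | P p) z p) =
  \sum_(p <- r | P p) dot (y p) (z p).
Proof.
move=> ur yz; rewrite -[\sum_(p <- r | P p) y p]big_filter.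
rewrite -[\sum_(p <- r | P p) z p]big_filter -[RHS]big_filter; have := filter_uniq P ur.
move: (seq.filter P r) => {ur} r' ur.
rewrite sdot_suml; apply: eq_big_seq => p pr.
rewrite sdot_sumr (bigD1_seq p)//= big1 ?addr0// => q qp.
by rewrite yz// eq_sym.
Qed.

Lemma cvg_sumr (I T : Type) (r : seq I) (P : pred I) (G : set_system T) (f : T -> I -> R) (a : I -> R) :
  Filter G -> (forall i, P i -> f n i @[n --> G] --> a i) ->
  \sum_(i <- r | P i) f n i @[n --> G] --> \sum_(i <- r | P i) a i.
Proof.
move=> FG h; elim: r => [|i r ih].
  have -> : (fun n => \sum_(i <- [::] | P i) f n i) = fun=> 0.
    by apply/funext => n; rewrite big_nil.
  by rewrite big_nil; exact: cvg_cst.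
have -> : (fun n => \sum_(j <- i :: r | P j) f n j) =
    (fun n => if P i then f n i + \sum_(j <- r | P j) f n j else \sum_(j <- r | P j) f n j).
  by apply/funext => n; rewrite big_cons.
rewrite big_cons; case: ifP => // Pi; apply: cvgD => //; exact: h.
Qed.

(** * Orthonormal expansions along finite sets of indices *)

Section exhaustion.
Context (I : eqType) (s : nat -> seq I) (l : I -> nat)
  (us : forall M, uniq (s M)) (mem_s : forall M p, (p \in s M) = (l p < M)%N).

Lemma sum_exhaust (W : zmodType) (F : I -> W) m n : (m <= n)%N ->
  \sum_(p <- s n) F p = \sum_(p <- s m) F p + \sum_(p <- s n | (m <= l p)%N) F p.
Proof.
move=> mn; rewrite (bigID (fun p => (l p < m)%N))/=; congr (_ + _); last first.
  by apply: eq_bigl => p; rewrite -leqNgt.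
rewrite -big_filter; apply: perm_big; apply: uniq_perm => //.
  exact: filter_uniq.
move=> p; rewrite mem_filter !mem_s.
by case: (ltnP (l p) m) => //= h; rewrite (leq_trans h mn).
Qed.

(** The sums over [s M] increase and are bounded, hence converge; the sum over levels between [m]
    and [n] is a difference of two of them. *)
Lemma bounded_sum_cauchy (t : I -> R) (B : R) : (forall p, 0 <= t p) ->
  (forall M, \sum_(p <- s M) t p <= B) ->
  forall e, 0 < e -> exists N, forall m n, (N <= m)%N -> (m <= n)%N ->
    \sum_(p <- s n | (m <= l p)%N) t p < e.
Proof.
move=> t0 tB e e0; pose T M := \sum_(p <- s M) t p.
have ndT : nondecreasing_seq T.
  by move=> m n mn; rewrite /T (sum_exhaust _ mn) lerDl sumr_ge0.
have : cvgn T.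
  by apply: nondecreasing_is_cvgn => //; exists B => _ [n _ <-]; exact: tB.
move=> /cvg_ex[L TL].
have e20 : 0 < e / 2 by rewrite divr_gt0.
have /cvgrPdist_lt/(_ _ e20) [N _ NT] := TL.
exists N => m n Nm mn.
have h1 := NT m Nm; have h2 := NT n (leq_trans Nm mn).
have -> : \sum_(p <- s n | (m <= l p)%N) t p = T n - T m.
  by rewrite /T (sum_exhaust _ mn) addrC addKr.
by move: h1 h2 => /=; rewrite !ltr_norml => /andP[? ?] /andP[? ?]; lra.
Qed.

Definition cauchyH (u : nat -> V) := forall e : R, 0 < e ->
  exists N, forall m n, (N <= m)%N -> (m <= n)%N -> dot (u n - u m) (u n - u m) < e.

Context (completeH : forall u : nat -> V, cauchyH u -> exists v, cvgH u v).

(** By Pythagoras the squared norm of a block of the series is a block of the series of squared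
    norms. *)
Lemma orthogonal_series (y : I -> V) (B : R) :
  (forall p q, p != q -> dot (y p) (y q) = 0) ->
  (forall M, \sum_(p <- s M) dot (y p) (y p) <= B) ->
  exists v, cvgH (fun M => \sum_(p <- s M) y p) v.
Proof.
move=> yo yB; apply: completeH => e e0.
have [N hN] := @bounded_sum_cauchy (fun p => dot (y p) (y p)) B
  (fun p => dot_ge0 _) yB e e0.
exists N => m n Nm mn; rewrite (sum_exhaust _ mn) addrC addKr.
by rewrite pythagoras//; exact: hN.
Qed.

Context (e : I -> V) (e_on : forall p q, dot (e p) (e q) = (p == q)%:R)
  (e_total : forall w, (forall p, dot w (e p) = 0) -> dot w w = 0).

Let coef w p := dot w (e p).

Definition psum w M := \sum_(p <- s M) coef w p *: e p.

Lemma dot_psum w v M : dot (psum w M) v = \sum_(p <- s M) coef w p * coef v p.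
Proof. by rewrite sdot_suml; apply: eq_bigr => p _; rewrite sdotZl [dot (e p) v]dotC. Qed.

Lemma coef_sum (a : I -> R) M p : coef (\sum_(q <- s M) a q *: e q) p =
  if (l p < M)%N then a p else 0.
Proof.
rewrite /coef sdot_suml; case: ifPn => pM.
  rewrite (bigD1_seq p) ?mem_s//= sdotZl e_on eqxx mulr1 big1 ?addr0// => q qp.
  by rewrite sdotZl e_on (negbTE qp) mulr0.
rewrite big_seq big1// => q; rewrite mem_s => qM; rewrite sdotZl e_on.
by case: eqP qM pM => [-> ->|]//; rewrite mulr0.
Qed.

Lemma bessel w M : \sum_(p <- s M) coef w p ^+ 2 <= dot w w.
Proof.
have E : dot (psum w M) w = \sum_(p <- s M) coef w p ^+ 2.
  by rewrite dot_psum; apply: eq_bigr => p _; rewrite expr2.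
have E2 : dot (psum w M) (psum w M) = \sum_(p <- s M) coef w p ^+ 2.
  rewrite dot_psum; apply: eq_big_seq => p; rewrite mem_s => pM.
  by rewrite coef_sum pM expr2.
have := dot_ge0 (w - psum w M).
by rewrite sdotBl !sdotBr (dotC w) E E2; lra.
Qed.

(** Coefficients pass to the limit because the one at [p] is constant as soon as [M] exceeds the
    level of [p]. *)
Lemma riesz_fischer (a : I -> R) (B : R) :
  (forall M, \sum_(p <- s M) a p ^+ 2 <= B) ->
  exists2 v, forall p, coef v p = a p & cvgH (fun M => \sum_(p <- s M) a p *: e p) v.
Proof.
move=> aB; have [||v vP] := @orthogonal_series (fun p => a p *: e p) B.
- by move=> p q pq; rewrite sdotZl sdotZr e_on (negbTE pq) !mulr0.
- move=> M; rewrite (eq_bigr (fun p => a p ^+ 2))// => p _.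
  by rewrite sdotZl sdotZr e_on eqxx mulr1 expr2.
exists v => // p; rewrite /coef; have /(@cvg_lim _ _) <- // := @cvgH_dotl _ _ (e p) vP.
apply: lim_near_cst => //; exists (l p).+1 => // M /= pM.
by have := coef_sum a M p; rewrite /coef => ->; rewrite pM.
Qed.

(** Bessel and Riesz-Fischer give a limit [v] with the coefficients of [w], and totality makes
    [w - v] null. It need not be 0, so [w] is reached from [v] by the triangle inequality. *)
Lemma cvg_psum w : cvgH (psum w) w.
Proof.
have [v cv vP] := riesz_fischer (fun M => bessel w M).
have wv0 : dot (w - v) (w - v) = 0.
  by apply: e_total => p; rewrite sdotBl -/(coef v p) cv subrr.
apply: (@sqz0 _ (fun M => 2 * dot (psum w M - v) (psum w M - v) + 2 * dot (v - w) (v - w))).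
  by move=> M; rewrite dot_ge0 sdot_subsq.
rewrite -(opprB w v) sdotNl sdotNr wv0 opprK mulr0.
rewrite -[X in _ --> X](_ : 2 * 0 + 0 = 0 :> R); last by rewrite mulr0 addr0.
by apply: cvgD; [apply: cvgM => //; exact: cvg_cst|exact: cvg_cst].
Qed.

Lemma parseval u v : \sum_(p <- s M) coef u p * coef v p @[M --> \oo] --> dot u v.
Proof.
have := @cvgH_dotl _ _ v (@cvg_psum u); apply: cvg_trans.
by rewrite (_ : (fun M => _) = (fun M => dot (psum u M) v))//;
  apply/funext => M; rewrite dot_psum.
Qed.

(** Comparing Parseval sums term by term moves multipliers from one argument to the other, whether
    or not they are bounded. *)
Lemma dot_eq u v u' v' :
  (forall p, dot u (e p) * dot v (e p) = dot u' (e p) * dot v' (e p)) ->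
  dot u v = dot u' v'.
Proof.
move=> h; have /(@cvg_lim _ _) <- // := @parseval u v.
have /(@cvg_lim _ _) <- // := @parseval u' v'.
by congr (limn _); apply/funext => M; apply: eq_bigr => p _; exact: h.
Qed.

Lemma dot_le_sum u (B : R) :
  (forall M, \sum_(p <- s M) coef u p ^+ 2 <= B) -> dot u u <= B.
Proof.
move=> uB; have /(@cvg_lim _ _) <- // := @parseval u u.
apply: limr_le; first by apply/cvg_ex; exists (dot u u); exact: parseval.
by apply: nearW => M; under eq_bigr do rewrite -expr2; exact: uB.
Qed.

Lemma hnormE u : hnorm dot u ^+ 2 = dot u u.
Proof. by rewrite sqr_sqrtr. Qed.

Lemma heqP u v : heq dot u v <-> dot (u - v) (u - v) = 0.
Proof.
split=> [|h]; last by rewrite /heq /hnorm h sqrtr0.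
by rewrite /heq => h; rewrite -hnormE h expr0n.
Qed.

Lemma heq_dot u v w : heq dot u v -> dot u w = dot v w.
Proof. by move=> /heqP /(sdot_null w); rewrite sdotBl => /eqP; rewrite subr_eq0 => /eqP. Qed.

Lemma heq_coef u v : heq dot u v <-> forall p, coef u p = coef v p.
Proof.
split=> [uv p|h]; first exact: heq_dot.
by apply/heqP/e_total => p; rewrite sdotBl; move: (h p); rewrite /coef => ->; rewrite subrr.
Qed.

Lemma hdense_spanned (D : set V) : (forall w M, D (psum w M)) -> hdense dot D.
Proof.
move=> DS u eps eps0; have e20 : 0 < eps ^+ 2 by rewrite exprn_gt0.
have /cvgr0Pnorm_lt/(_ _ e20) [N _ NP] := @cvg_psum u.
exists (psum u N) => //; have := NP N (leqnn N) => /=.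
rewrite -opprB sdotNl sdotNr opprK -hnormE normrX ltr_pXn2r// ?nnegrE ?ltW//.
exact: le_lt_trans (ler_norm _).
Qed.

(** * Spectral theory of diagonal operators *)

Section diagonal_operator.
Context (A : V -> V -> Prop)
  (AE : forall w f, A w f <-> forall p, coef f p = - ((l p)%:R / 2) * coef w p)
  (level : nat -> I) (levelK : forall n, l (level n) = n).

Lemma coefL a u v p : coef (a *: u + v) p = a * coef u p + coef v p.
Proof. exact: dotL. Qed.

Lemma coefE p q : coef (e p) q = (p == q)%:R.
Proof. exact: e_on. Qed.

Lemma diag_eigen p : A (e p) (- ((l p)%:R / 2) *: e p).
Proof.
apply/AE => q; rewrite /coef sdotZl -/(coef (e p) q) coefE.
by case: eqP => [->//|_]; rewrite !mulr0.
Qed.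

Lemma diag_linear : linear_operator dot A.
Proof.
split.
- by apply/AE => p; rewrite /coef sdot0l mulr0.
- by move=> a u v f g /AE h1 /AE h2; apply/AE => p; rewrite !coefL h1 h2; ring.
- move=> u u' f f' /heq_coef hu /heq_coef hf /AE h; apply/AE => p.
  by rewrite -hu -hf.
- by move=> u f g /AE h1 /AE h2; apply/heq_coef => p; rewrite h1 h2.
Qed.

(** Partial sums of expansions lie in the domain, whence density. Symmetry is a termwise comparison;
    conversely the adjoint relation tested on the eigenvectors [e p] yields the coefficients of [f],
    and these characterize the graph. *)
Lemma diag_selfadjoint : selfadjoint dot A.
Proof.
split; first exact: diag_linear.
- apply: hdense_spanned => w M.
  exists (\sum_(p <- s M) (- ((l p)%:R / 2) * coef w p) *: e p); apply/AE => p.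
  by rewrite !coef_sum; case: ifP; rewrite ?mulr0.
- move=> u f; split=> [/AE h v g /AE h'|h].
    apply: dot_eq => p; move: (h p) (h' p); rewrite /coef => -> ->; ring.
  apply/AE => p; have := h _ _ (diag_eigen p).
  by rewrite /coef sdotZl (dotC (e p) u) (dotC (e p) f) => <-.
Qed.

Let Rz (z : R[i]) := complex.Re z.
Let Iz (z : R[i]) := complex.Im z.

Definition half_negative (z : R[i]) := exists n : nat, z = (- (n%:R / 2))%:C%C.

(** The squared modulus of [- n / 2 - z], the factor by which the complexified [A - z] acts at level
    [n]. *)
Let d z (n : nat) := (n%:R / 2 + Rz z) ^+ 2 + Iz z ^+ 2.

Lemma cshift_coef z U F : cshift A z U F <-> forall p,
  coef F.1 p = - ((l p)%:R / 2 + Rz z) * coef U.1 p + Iz z * coef U.2 p /\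
  coef F.2 p = - ((l p)%:R / 2 + Rz z) * coef U.2 p - Iz z * coef U.1 p.
Proof.
case: U F => u1 u2 [f1 f2]; rewrite /cshift /=.
have c1 p : coef (f1 + (Rz z *: u1 - Iz z *: u2)) p =
    coef f1 p + (Rz z * coef u1 p - Iz z * coef u2 p).
  by rewrite /coef sdotDl sdotBl !sdotZl.
have c2 p : coef (f2 + (Rz z *: u2 + Iz z *: u1)) p =
    coef f2 p + (Rz z * coef u2 p + Iz z * coef u1 p).
  by rewrite /coef !sdotDl !sdotZl.
split.
  move=> [/AE h1 /AE h2] p; move: (h1 p) (h2 p).
  by rewrite c1 c2 => a1 a2; split; lra.
by move=> h; split; apply/AE => p; have [a1 a2] := h p; rewrite (c1, c2); lra.
Qed.

Lemma d_gt0 z n : ~ half_negative z -> 0 < d z n.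
Proof.
move=> nz; rewrite lt_neqAle addr_ge0 ?sqr_ge0// andbT eq_sym.
apply/negP; rewrite paddr_eq0 ?sqr_ge0// !sqrf_eq0 => /andP[/eqP a /eqP b].
apply: nz; exists n; case: z a b => x y; rewrite /Rz /Iz /= => a ->.
by congr (_ +i* _)%C; lra.
Qed.

Lemma d_large z (B : R) : exists N, forall n, (N <= n)%N -> B <= d z n.
Proof.
have [N hN] : exists N : nat, 2 * (`|Rz z| + `|B| + 1) <= N%:R.
  by exists (Num.Def.archi_bound (2 * (`|Rz z| + `|B| + 1))); rewrite ltW// archi_boundP// mulr_ge0// !addr_ge0.
exists N => n; rewrite -(ler_nat R) => Nn.
have h : `|B| + 1 <= n%:R / 2 + Rz z.
  have := ler_norm (- Rz z); rewrite normrN; lra.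
have := ler_norm B => hB; have h0 := normr_ge0 B.
rewrite /d; have : (`|B| + 1) ^+ 2 <= (n%:R / 2 + Rz z) ^+ 2.
  by rewrite ler_pXn2r ?nnegrE//; lra.
have := sqr_ge0 (Iz z); nra.
Qed.

(** Since [d z] tends to infinity, only finitely many levels can bring it below 1, and it is
    positive at each of them. *)
Lemma d_lower z : ~ half_negative z -> exists2 del : R, 0 < del & forall n, del <= d z n.
Proof.
move=> nz; have [N hN] := d_large z 1.
have [del d0 hd] : exists2 del : R, 0 < del & forall n, (n < N)%N -> del <= d z n.
  elim: (N) => [|k [del d0 hd]]; first by exists 1.
  exists (Num.min del (d z k)); first by rewrite lt_min d0 d_gt0.
  by move=> n; rewrite ltnS leq_eqVlt => /predU1P[->|/hd h]; rewrite ge_min ?lexx ?orbT// h.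
exists (Num.min del 1); first by rewrite lt_min d0 ltr01.
move=> n; rewrite ge_min; case: (ltnP n N) => [/hd ->//|/hN ->].
by rewrite orbT.
Qed.

Lemma cshift_sq z U F p : cshift A z U F ->
  coef F.1 p ^+ 2 + coef F.2 p ^+ 2 = d z (l p) * (coef U.1 p ^+ 2 + coef U.2 p ^+ 2).
Proof. by move=> /cshift_coef/(_ p)[-> ->]; rewrite /d; ring. Qed.

Lemma cnormE U : cnorm dot U ^+ 2 = dot U.1 U.1 + dot U.2 U.2.
Proof. by rewrite sqr_sqrtr// addr_ge0. Qed.

Lemma cnorm_ge0 U : 0 <= cnorm dot U.
Proof. exact: sqrtr_ge0. Qed.

Lemma bessel2 (U : V * V) M : \sum_(p <- s M) (coef U.1 p ^+ 2 + coef U.2 p ^+ 2) <= cnorm dot U ^+ 2.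
Proof. by rewrite cnormE big_split lerD// bessel. Qed.

Lemma parseval2 (U : V * V) :
  \sum_(p <- s M) (coef U.1 p ^+ 2 + coef U.2 p ^+ 2) @[M --> \oo] --> cnorm dot U ^+ 2.
Proof.
rewrite cnormE (_ : (fun M => _) = (fun M => \sum_(p <- s M) coef U.1 p * coef U.1 p +
   \sum_(p <- s M) coef U.2 p * coef U.2 p)).
  exact: cvgD (@parseval U.1 U.1) (@parseval U.2 U.2).
by apply/funext => M; rewrite -big_split; apply: eq_bigr => p _; rewrite !expr2.
Qed.

Lemma cshift_surj z : ~ half_negative z -> forall F, exists U, cshift A z U F.
Proof.
move=> nz F; have [del d0 dP] := d_lower nz.
pose m p := - ((l p)%:R / 2 + Rz z).
(* [a1 + i a2] is the coefficient of [F] divided by [m p - i Im z], written with the conjugate in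
   the numerator. *)
pose a1 p := (m p * coef F.1 p - Iz z * coef F.2 p) / d z (l p).
pose a2 p := (m p * coef F.2 p + Iz z * coef F.1 p) / d z (l p).
have dn0 p : d z (l p) != 0 by rewrite gt_eqF// d_gt0.
have aE p : a1 p ^+ 2 + a2 p ^+ 2 = (coef F.1 p ^+ 2 + coef F.2 p ^+ 2) / d z (l p).
  apply: (mulfI (dn0 p)); rewrite mulrCA divff// mulr1.
  apply: (mulfI (dn0 p)); rewrite mulrDr /a1 /a2 !expr_div_n mulrDr.
  have X (x : R) : d z (l p) * (d z (l p) * (x / d z (l p) ^+ 2)) = x.
    by field; exact: dn0.
  rewrite !X /d /m; ring.
have sumB M : \sum_(p <- s M) (a1 p ^+ 2 + a2 p ^+ 2) <= cnorm dot F ^+ 2 / del.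
  apply: (@le_trans _ _ ((\sum_(p <- s M) (coef F.1 p ^+ 2 + coef F.2 p ^+ 2)) / del)).
    rewrite mulr_suml; apply: ler_sum => p _; rewrite aE.
    by rewrite ler_wpM2l ?addr_ge0 ?sqr_ge0// lef_pV2 ?posrE// d_gt0.
  by rewrite ler_wpM2r ?bessel2// invr_ge0 ltW.
have sum1 M : \sum_(p <- s M) a1 p ^+ 2 <= cnorm dot F ^+ 2 / del.
  by apply: le_trans (sumB M); apply: ler_sum => p _; rewrite lerDl sqr_ge0.
have sum2 M : \sum_(p <- s M) a2 p ^+ 2 <= cnorm dot F ^+ 2 / del.
  by apply: le_trans (sumB M); apply: ler_sum => p _; rewrite lerDr sqr_ge0.
have [u1 u1P _] := riesz_fischer sum1; have [u2 u2P _] := riesz_fischer sum2.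
exists (u1, u2); apply/cshift_coef => p /=; rewrite u1P u2P.
have X : (m p) ^+ 2 + Iz z ^+ 2 = d z (l p) by rewrite /m /d sqrrN.
rewrite -/(m p) /a1 /a2; split.
- rewrite !mulrA -mulrDl; apply: (mulIf (dn0 p)); rewrite divfK// -X; ring.
- rewrite !mulrA -mulrBl; apply: (mulIf (dn0 p)); rewrite divfK// -X; ring.
Qed.

Lemma cshift_bound z : ~ half_negative z ->
  exists C, forall U F, cshift A z U F -> cnorm dot U <= C * cnorm dot F.
Proof.
move=> nz; have [del d0 dP] := d_lower nz.
exists (Num.sqrt del^-1) => U F UF.
rewrite -(@ler_pXn2r _ 2%N)// ?nnegrE ?mulr_ge0 ?sqrtr_ge0 ?cnorm_ge0//.
rewrite exprMn [Num.sqrt del^-1 ^+ 2]sqr_sqrtr ?invr_ge0 ?(ltW d0)//.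
have /(@cvg_lim _ _) <- // := @parseval2 U.
apply: limr_le; first by apply/cvg_ex; eexists; exact: parseval2.
apply: nearW => M; rewrite mulrC ler_pdivlMr// mulr_suml.
apply: le_trans (bessel2 F M); apply: ler_sum => p _.
rewrite (cshift_sq p UF) mulrC ler_wpM2r// addr_ge0 ?sqr_ge0//.
Qed.

Lemma cshift_level n : cshift A ((- (n%:R / 2))%:C%C) (e (level n), 0) 0.
Proof.
apply/cshift_coef => p /=; rewrite /coef !sdot0l -/(coef (e (level n)) p) coefE /Rz /Iz /=.
by case: eqP => [<-|_]; rewrite ?levelK /=; split; ring.
Qed.

Lemma cnorm_e p : cnorm dot (e p, 0) = 1.
Proof. by rewrite /cnorm /= sdot0l addr0 e_on eqxx sqrtr1. Qed.

Lemma cnorm0 : cnorm dot (0 : V * V) = 0.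
Proof. by rewrite /cnorm /= sdot0l addr0 sqrtr0. Qed.

Lemma diag_resolvent : resolvent_set dot A = ~` half_negative.
Proof.
apply/seteqP; split => z /=.
  move=> [_ [C CP]] [n zE]; have := @CP (e (level n), 0) 0.
  rewrite zE cnorm_e cnorm0 mulr0 => /(_ (cshift_level n)).
  by rewrite ler10.
by move=> nz; split; [exact: cshift_surj|exact: cshift_bound].
Qed.

Lemma diag_spectrum : spectrum dot A = half_negative.
Proof. by rewrite /spectrum diag_resolvent setCK. Qed.

(** Compactness of a segment gives a cluster point, and a cluster point of an ultrafilter is a
    limit. *)
Lemma ultra_bounded_cvg (G : set_system nat) (x : nat -> R) (B : R) :
  UltraFilter G -> (forall n, `|x n| <= B) -> exists c : R, x n @[n --> G] --> c.
Proof.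
move=> UG xB.
have GI : G (x @^-1` `[- B, B]%classic).
  apply: (filterS _ (@filterT _ G _)) => n _ /=.
  by rewrite in_itv/= -ler_norml; exact: xB.
have [c [_ cc]] := @segment_compact R (- B) B (x n @[n --> G]) _ GI.
exists c => S Sc; have [//|Sn] := in_ultra_setVsetC (x @^-1` S) UG.
have [y [Sy nSy]] := cc (~` S) S Sn Sc.
by [].
Qed.

(* An ultrafilter yields coordinatewise limits of all coefficients at once,
   which replaces the diagonal extraction. *)
Lemma ultra_tail_cvg (G : set_system nat) (u : nat -> V) (t : nat -> R) :
  UltraFilter G ->
  (forall n m M, \sum_(p <- s M | (m <= l p)%N) coef (u n) p ^+ 2 <= t m) ->
  t m @[m --> \oo] --> (0 : R) ->
  exists v, forall eps, 0 < eps -> \forall n \near G, dot (u n - v) (u n - v) < eps.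
Proof.
move=> UG ut t0.
have t_ge0 : 0 <= t 0.
  by apply: le_trans (ut 0 0 0); rewrite sumr_ge0// => p _; rewrite sqr_ge0.
have ub n M : \sum_(p <- s M) coef (u n) p ^+ 2 <= t 0 by apply: le_trans (ut n 0%N M); rewrite le_eqVlt; apply/orP; left; apply/eqP; exact: eq_bigl.
have coefB n p : `|coef (u n) p| <= Num.sqrt (t 0).
  rewrite -sqrtr_sqr ler_sqrt//; apply: le_trans (ub n (l p).+1).
  by rewrite (bigD1_seq p) ?mem_s//= lerDl sumr_ge0// => q _; rewrite sqr_ge0.
have cP p : exists c : R, coef (u n) p @[n --> G] --> c.
  exact: (@ultra_bounded_cvg G (fun n => coef (u n) p)).
pose a p := projT1 (cid (cP p)).
have aP p : coef (u n) p @[n --> G] --> a p by rewrite /a; case: cid.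
have at_ m M : \sum_(p <- s M | (m <= l p)%N) a p ^+ 2 <= t m.
  have c : \sum_(p <- s M | (m <= l p)%N) coef (u n) p ^+ 2 @[n --> G] -->
      \sum_(p <- s M | (m <= l p)%N) a p ^+ 2.
    by apply: cvg_sumr => p _; apply: cvgM; exact: aP.
  rewrite -(cvg_lim _ c)//; apply: limr_le; first by apply/cvg_ex; eexists; exact: c.
  exact: nearW.
have [v vP _] := @riesz_fischer a (t 0) (fun M => at_ 0 M).
exists v => eps eps0.
have e80 : 0 < eps / 8 by rewrite divr_gt0.
have /cvgr0Pnorm_lt/(_ _ e80) [m _ /(_ m (leqnn m)) tm] := t0.
have {}tm : t m < eps / 8 by apply: le_lt_trans tm; exact: ler_norm.
have c : \sum_(p <- s m) (coef (u n) p - a p) ^+ 2 @[n --> G] --> (0 : R).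
  rewrite [X in _ --> X](_ : 0 = \sum_(p <- s m) 0 ^+ 2); last first.
    by rewrite big1// => p _; rewrite expr0n.
  apply: cvg_sumr => p _; have h : coef (u n) p - a p @[n --> G] --> (0 : R).
    by rewrite -[X in _ --> X](subrr (a p)); apply: cvgB; [exact: aP|exact: cvg_cst].
  exact: cvgM.
have e20 : 0 < eps / 4 by rewrite divr_gt0.
have /cvgr0Pnorm_lt/(_ _ e20) := c; apply: filterS => n /= hn.
(* Levels below [m] contribute [eps / 4] by coordinatewise convergence along [G]; the tails of [u n]
   and of the limit contribute [2 * (eps / 8)] each. *)
apply: (@le_lt_trans _ _ (eps / 4 + (2 * (eps / 8) + 2 * (eps / 8)))); last by lra.
apply: dot_le_sum => M; have [Mm|mM] := leqP M m.
  apply: (@le_trans _ _ (eps / 4)); last by lra.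
  apply: le_trans (ltW (le_lt_trans (ler_norm _) hn)).
  rewrite (sum_exhaust _ Mm) -[leLHS]addr0 lerD ?sumr_ge0//.
    by apply: ler_sum => p _; rewrite /coef sdotBl -!/(coef _ p) vP.
  by move=> p _; rewrite sqr_ge0.
rewrite (sum_exhaust _ (ltnW mM)) lerD//.
  apply: le_trans (ltW (le_lt_trans (ler_norm _) hn)).
  by apply: ler_sum => p _; rewrite /coef sdotBl -!/(coef _ p) vP.
apply: (@le_trans _ _ (\sum_(p <- s M | (m <= l p)%N) (2 * coef (u n) p ^+ 2 + 2 * a p ^+ 2))).
  apply: ler_sum => p _; rewrite /coef sdotBl -!/(coef _ p) vP.
  by have := sqr_ge0 (coef (u n) p + a p); lra.
rewrite big_split -!mulr_sumr lerD// ler_wpM2l//.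
  exact: le_trans (ut _ _ _) (ltW tm).
exact: le_trans (at_ _ _) (ltW tm).
Qed.

Lemma diag_compact z : ~ half_negative z -> compact_inverse dot A z.
Proof.
move=> nz U F UF [B FB].
have [del d0 dP] := d_lower nz.
(* The witness is the infimum of [d z] over the levels from [m] on; the last clause, applied to
   large [B'], will make it tend to infinity with [m]. *)
have tex m : exists2 D, 0 < D & (forall n, (m <= n)%N -> D <= d z n) /\
    (forall B', (forall n, (m <= n)%N -> B' <= d z n) -> B' <= D + 1).
  pose S := [set x | exists2 n, (m <= n)%N & x = d z n].
  have S0 : has_inf S.
    split; first by exists (d z m), m.
    by exists del => _ [n _ ->].
  exists (inf S); first by apply: lt_le_trans d0 _; apply: lb_le_inf; [exact: S0.1|move=> _ [n _ ->]].
  split=> [n mn|B' hB'].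
    by apply: ge_inf; [exact: S0.2|exists n].
  apply: (@le_trans _ _ (inf S)); last by rewrite lerDl.
  by apply: lb_le_inf; [exact: S0.1|move=> _ [n mn ->]; exact: hB'].
pose D m := projT1 (cid2 (tex m)).
have D0 m : 0 < D m by rewrite /D; case: cid2.
have Dle m n : (m <= n)%N -> D m <= d z n by rewrite /D; case: cid2 => x /= _ [h _]; exact: h.
have Dinf m B' : (forall n, (m <= n)%N -> B' <= d z n) -> B' <= D m + 1.
  by rewrite /D; case: cid2 => x /= _ [_ h]; exact: h.
pose t m := B ^+ 2 / D m.
have t0 : t m @[m --> \oo] --> (0 : R).
  apply/cvgr0Pnorm_lt => eps eps0.
  have [N hN] := d_large z (B ^+ 2 / eps + 2); exists N => // m /= Nm.
  have := @Dinf m (B ^+ 2 / eps + 2) (fun n mn => hN n (leq_trans Nm mn)) => h.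
  rewrite ger0_norm ?divr_ge0 ?sqr_ge0 ?ltW// /t ltr_pdivrMr// mulrC.
  rewrite -ltr_pdivrMr//; lra.
(* On these levels the squared coefficients of [F n] are at least [D m] times those of [U n], so the
   tails of [U n] are small uniformly in [n]. *)
have tail n m M : \sum_(p <- s M | (m <= l p)%N) (coef (U n).1 p ^+ 2 + coef (U n).2 p ^+ 2) <= t m.
  rewrite /t ler_pdivlMr// mulr_suml.
  apply: (@le_trans _ _ (\sum_(p <- s M | (m <= l p)%N) (coef (F n).1 p ^+ 2 + coef (F n).2 p ^+ 2))).
    apply: ler_sum => p mp; rewrite (cshift_sq p (UF n)) mulrC ler_wpM2r ?Dle//.
    by rewrite addr_ge0 ?sqr_ge0.
  apply: (@le_trans _ _ (\sum_(p <- s M) (coef (F n).1 p ^+ 2 + coef (F n).2 p ^+ 2))).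
    rewrite [leRHS](bigID (fun p => (m <= l p)%N))/= lerDl sumr_ge0// => p _.
    by rewrite addr_ge0 ?sqr_ge0.
  apply: le_trans (bessel2 _ _) _.
  by rewrite ler_pXn2r ?nnegrE ?cnorm_ge0// (le_trans (cnorm_ge0 _) (FB n)).
have [G [UG sG]] := @ultraFilterLemma _ (nbhs \oo) _.
have [|v1 v1P] := @ultra_tail_cvg G (fun n => (U n).1) t UG _ t0.
  by move=> n m M; apply: le_trans (tail n m M); apply: ler_sum => p _; rewrite lerDl sqr_ge0.
have [|v2 v2P] := @ultra_tail_cvg G (fun n => (U n).2) t UG _ t0.
  by move=> n m M; apply: le_trans (tail n m M); apply: ler_sum => p _; rewrite lerDr sqr_ge0.
(* The ultrafilter contains every final segment of the integers, so a closer term can always be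
   found beyond the previous index; iterating this extracts the subsequence. *)
have nxt (kN : nat * nat) : exists n, (kN.2 < n)%N /\
    cnorm dot (U n - (v1, v2)) ^+ 2 < kN.1.+1%:R^-1.
  have h0 : 0 < kN.1.+1%:R^-1 / 2 :> R by rewrite divr_gt0.
  have G1 := v1P _ h0; have G2 := v2P _ h0.
  have G3 : G [set n | (kN.2 < n)%N] by apply: sG; exists kN.2.+1.
  have [n [[n1 n2] n3]] := filter_ex (filterI (filterI G1 G2) G3).
  exists n; split => //; rewrite cnormE [ltRHS]splitr; exact: ltrD n1 n2.
pose step kN := projT1 (cid (nxt kN)).
pose k := fix k n := if n is n'.+1 then step (n'.+1, k n') else step (0, 0)%N.
have kS n : (k n < k n.+1)%N /\ cnorm dot (U (k n) - (v1, v2)) ^+ 2 < n.+1%:R^-1.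
  split=> [|]; first by rewrite /= /step; case: cid => x [].
  by case: n => [|n] /=; rewrite /step; case: cid => x [].
exists k, (v1, v2); split.
  by apply: homo_ltn => [|n]; [exact: ltn_trans|exact: (kS n).1].
apply: cvg_sqr0; apply: (@sqz0 _ (fun n => n.+1%:R^-1)); last exact: cvg_harmonic.
by move=> n; rewrite sqr_ge0 ltW// (kS n).2.
Qed.

Lemma diag_compact_resolvent : compact_resolvent dot A.
Proof.
split; last by move=> z; rewrite diag_resolvent; exact: diag_compact.
exists (0 +i* 1)%C; rewrite diag_resolvent => -[n [_ /eqP]].
by rewrite oner_eq0.
Qed.

Lemma cshift_eigen_coef n U p : cshift A ((- (n%:R / 2))%:C%C) U 0 -> l p != n ->
  coef U.1 p = 0 /\ coef U.2 p = 0.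
Proof.
move=> /cshift_coef/(_ p) /=; rewrite /coef sdot0l -!/(coef _ p) /Rz /Iz /=.
rewrite -(eqr_nat R) -subr_eq0 !mul0r addr0 subr0 => -[h1 h2] ln.
have X : - ((l p)%:R / 2 + - (n%:R / 2)) != 0 :> R.
  apply: contra ln => /eqP h; apply/eqP; lra.
by split; apply: (mulfI X); rewrite mulr0.
Qed.

Lemma diag_purely_discrete : purely_discrete_spectrum dot A.
Proof.
move=> z; rewrite diag_spectrum => -[n ->]; split.
(* Consecutive points of the spectrum are at distance 1/2. *)
- exists (1 / 2 : R) => // _ [m ->].
  rewrite -rmorphB /= normc_def /= expr0n addr0 sqrtr_sqr ltcR => h.
  congr ((- (_%:R / 2))%:C%C); apply/eqP; rewrite eqn_leq.
  move: h; rewrite ltr_norml => /andP[h1 h2].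
  by apply/andP; split; rewrite -ltnS -(ltr_nat R) -natr1; lra.
- exists (e (level n), 0); first exact: cshift_level.
  by rewrite cnorm_e oner_neq0.
- pose r := [seq p <- s n.+1 | l p == n].
  exists (size r), (fun i => (e (tnth (in_tuple r) i), 0)) => U HU.
  exists (fun i => coef U.1 (tnth (in_tuple r) i) +i* coef U.2 (tnth (in_tuple r) i))%C.
  have ur : uniq r by exact: filter_uniq.
    have E : \sum_(i < size r) Defs.cscale (coef U.1 (tnth (in_tuple r) i) +i* coef U.2 (tnth (in_tuple r) i))%C
       (e (tnth (in_tuple r) i), 0) =
     (\sum_(p <- r) coef U.1 p *: e p, \sum_(p <- r) coef U.2 p *: e p).
    rewrite (big_tnth _ _ r) (big_tnth _ _ r) /=.
    elim/big_rec3: _ => [//|i a b c _ ->].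
    by rewrite /Defs.cscale /= !scaler0 subr0 add0r.
  (* A vector whose coefficients live on a single level agrees with a finite sum up to a null
     vector, as their difference has no coefficient left. *)
  have key (u : V) : (forall p, l p != n -> coef u p = 0) ->
      dot (u - \sum_(p <- r) coef u p *: e p) (u - \sum_(p <- r) coef u p *: e p) = 0.
    move=> hu; apply: e_total => p; rewrite sdotBl sdot_suml.
    have [/eqP pn|pn] := boolP (l p == n).
      rewrite (bigD1_seq p)//=; last by rewrite mem_filter mem_s pn eqxx ltnSn.
      rewrite sdotZl e_on eqxx mulr1 big1 ?addr0 ?subrr// => q qp.
      by rewrite sdotZl e_on (negbTE qp) mulr0.
    rewrite -/(coef u p) hu// big_seq big1 ?subrr// => q; rewrite mem_filter => /andP[/eqP qn _].
    rewrite sdotZl e_on; case: eqP => [qp|]; last by rewrite mulr0.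
    by move: pn; rewrite -qp qn eqxx.
  apply/eqP; rewrite -sqrf_eq0 cnormE E /= !key ?addr0// => p pn.
    exact: (cshift_eigen_coef HU pn).2.
  exact: (cshift_eigen_coef HU pn).1.
Qed.

End diagonal_operator.

End exhaustion.
End semi_inner_product.


(** * Integrals of real-valued functions *)

Section real_integrals.
Context d (T : measurableType d) (R : realType) (mu : {measure set T -> \bar R}).
Implicit Types f g h : T -> R.

Local Notation meas f := (measurable_fun [set: T] (f : T -> measurableTypeR R)).

Definition intg f := mu.-integrable setT (EFin \o f).

Lemma intg_meas f : intg f -> meas f.
Proof. by move=> /integrableP[/measurable_EFinP]. Qed.

Lemma intg_le f g : meas f -> intg g -> (forall x, `|f x| <= g x) -> intg f.
Proof.
move=> mf ig fg; apply: (le_integrable measurableT _ _ ig).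
  exact/measurable_EFinP.
by move=> x _ /=; rewrite lee_fin (le_trans (fg x))// ler_norm.
Qed.

Lemma intgD f g : intg f -> intg g -> intg (fun x => f x + g x).
Proof.
move=> fi gi; rewrite /intg (_ : _ \o _ = (EFin \o f) \+ (EFin \o g))%E.
  exact: integrableD.
by apply/funext => x /=; rewrite EFinD.
Qed.

Lemma intgZ a f : intg f -> intg (fun x => a * f x).
Proof.
move=> fi; rewrite /intg (_ : _ \o _ = fun x => a%:E * (EFin \o f) x)%E.
  exact: integrableZl.
by apply/funext => x /=; rewrite EFinM.
Qed.

Lemma intgN f : intg f -> intg (fun x => - f x).
Proof. by move=> /(intgZ (-1)); under eq_fun do rewrite mulN1r. Qed.

Lemma intg_norm f : intg f -> intg (fun x => `|f x|).
Proof. exact: integrable_norm. Qed.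

Lemma RintZ a f : intg f -> \int[mu]_x (a * f x) = a * \int[mu]_x f x.
Proof. exact: RintegralZl. Qed.

Lemma RintN f : intg f -> \int[mu]_x (- f x) = - \int[mu]_x f x.
Proof. by move=> /(RintZ (-1)); rewrite mulN1r; under eq_Rintegral do rewrite mulN1r. Qed.

Lemma RintD f g : intg f -> intg g ->
  \int[mu]_x (f x + g x) = \int[mu]_x f x + \int[mu]_x g x.
Proof. exact: RintegralD. Qed.

Lemma RintB f g : intg f -> intg g ->
  \int[mu]_x (f x - g x) = \int[mu]_x f x - \int[mu]_x g x.
Proof. exact: RintegralB. Qed.

Lemma Rint_le f g : intg f -> intg g -> (forall x, f x <= g x) ->
  \int[mu]_x f x <= \int[mu]_x g x.
Proof. by move=> fi gi fg; apply: le_Rintegral => // x _; exact: fg. Qed.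

Lemma Rint_ae f g : meas f -> meas g -> {ae mu, forall x, f x = g x} ->
  \int[mu]_x f x = \int[mu]_x g x.
Proof.
move=> mf mg fg; congr fine; apply: ae_eq_integral => //.
- exact/measurable_EFinP.
- exact/measurable_EFinP.
- by apply: filterS fg => x -> _.
Qed.

Lemma intg_ae f g : meas g -> intg f -> {ae mu, forall x, f x = g x} -> intg g.
Proof.
move=> mg fi fg; apply/integrableP; split; first exact/measurable_EFinP.
have /integrableP[mf] := fi; rewrite (@ae_eq_integral _ _ _ mu setT (fun x => `|(g x)%:E|%E))//.
- exact/measurableT_comp.
- by apply/measurableT_comp => //; exact/measurable_EFinP.
- by apply: filterS fg => x /= -> _.
Qed.

Lemma Rint_eq0_ae f : intg f -> (forall x, 0 <= f x) -> \int[mu]_x f x = 0 ->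
  {ae mu, forall x, f x = 0}.
Proof.
move=> fi f0 If0; have mf := measurable_int _ fi.
have : (\int[mu]_(x in setT) `|(EFin \o f) x| = 0)%E.
  rewrite (eq_integral (EFin \o f)); last by move=> x _ /=; rewrite ger0_norm.
  by rewrite -(fineK (integrable_fin_num _ fi))//; congr (_%:E).
move=> /(ae_eq_integral_abs mu measurableT mf); apply: filterS => x /(_ I) /= [].
by [].
Qed.

Lemma Rdct (F : nat -> T -> R) f g : (forall n, meas (F n)) -> meas f -> intg g ->
  (forall n x, `|F n x| <= g x) -> {ae mu, forall x, F n x @[n --> \oo] --> f x} ->
  \int[mu]_x F n x @[n --> \oo] --> \int[mu]_x f x.
Proof.
move=> mF mf ig Fg Ff.
have [||||if_ _ c] := @dominated_convergence _ _ _ mu setT measurableT (fun n => EFin \o F n) (EFin \o f)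
  (EFin \o g) _ _ _ ig.
- by move=> n; apply/measurable_EFinP; exact: mF.
- by apply/measurable_EFinP; exact: mf.
- by apply: filterS Ff => x h _; apply: cvg_EFin => //; exact: nearW.
- by apply: aeW => x n _ /=; rewrite lee_fin.
apply: fine_cvg; rewrite /= fineK; last exact: integrable_fin_num.
exact: c.
Qed.

Lemma intg_lty f : meas f -> (forall x, 0 <= f x) -> (\int[mu]_x (f x)%:E < +oo)%E -> intg f.
Proof.
move=> mf f0 fy; apply/integrableP; split; first exact/measurable_EFinP.
by under eq_integral do rewrite /= ger0_norm//.
Qed.

Lemma intg_ltyE f : intg f -> (\int[mu]_x (f x)%:E = (\int[mu]_x f x)%:E)%E.
Proof. by move=> fi; rewrite /Rintegral fineK//; exact: integrable_fin_num. Qed.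

End real_integrals.

(** * The weighted space: change of measure, inner product, completeness *)

Section weighted_space.
Context (R : realType).
Local Notation plane := (R * R)%type.
Local Notation mu := (leb2 R).
Local Notation mR := (measurableTypeR R).
Local Notation P := (mR * mR)%type.
Local Notation meas f := (measurable_fun [set: P] (f : P -> mR)).
Local Notation G := (@gaussG R).
Implicit Types (u v w : X R) (f g k : plane -> R) (xi : plane).

Lemma meas_sqnorm : meas (@sqnorm R).
Proof. by apply: measurable_funD; apply: measurable_funX. Qed.

Lemma meas_gauss : meas G.
Proof.
apply: measurable_funM => //; apply: measurableT_comp => //.
apply: measurable_funM => //; apply: measurableT_comp => //.
exact: meas_sqnorm.
Qed.

Lemma meas_gaussV : meas (fun x => (G x)^-1).
Proof. exact: measurable_gaussGV. Qed.

Lemma gaussG_gt0 xi : 0 < G xi.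
Proof. by rewrite mulr_gt0 ?expR_gt0// invr_gt0 mulr_gt0// pi_gt0. Qed.

Import HBNNSimple.

(** By monotone convergence it suffices to treat simple functions, and on an indicator the identity
    is the definition of [weighted]. *)
Lemma integral_weighted (f : P -> \bar R) : measurable_fun setT f -> (forall x, 0 <= f x)%E ->
  (\int[@weighted R]_x f x = \int[mu]_x (f x * (G x)^-1%:E))%E.
Proof.
move=> mf f0; pose h := nnsfun_approx measurableT mf.
have gV0 x : (0 <= (G x)^-1%:E)%E by rewrite lee_fin invr_ge0 gaussG_ge0.
have mgV : measurable_fun setT (fun x : P => (G x)^-1%:E).
  by apply/measurable_EFinP; exact: meas_gaussV.
have cf x : EFin (h n x) @[n --> \oo] --> f x by exact: cvg_nnsfun_approx.
have L : (\int[@weighted R]_x (h n x)%:E @[n --> \oo] --> \int[@weighted R]_x f x)%E.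
  rewrite (_ : f = fun x => limn (fun n => (h n x)%:E)); last first.
    by apply/funext => x; apply/esym/cvg_lim => //; exact: cf.
  apply: cvg_monotone_convergence => //.
  - by move=> n; apply/measurable_EFinP.
  - by move=> n x _; rewrite lee_fin.
  - by move=> x _ a b ab; rewrite lee_fin; exact/lefP/nd_nnsfun_approx.
have L' : (\int[mu]_x ((h n x)%:E * (G x)^-1%:E) @[n --> \oo] --> \int[mu]_x (f x * (G x)^-1%:E))%E.
  rewrite (_ : (fun x => f x * (G x)^-1%:E)%E = fun x => limn (fun n => (h n x)%:E * (G x)^-1%:E)%E); last first.
    apply/funext => x; apply/esym/cvg_lim => //; apply: cvgeZr => //; exact: cf.
  apply: cvg_monotone_convergence => //.
  - by move=> n; apply: emeasurable_funM => //; apply/measurable_EFinP.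
  - by move=> n x _; apply: mule_ge0 => //; rewrite lee_fin.
  - move=> x _ a b ab; rewrite lee_wpmul2r// lee_fin; exact/lefP/nd_nnsfun_approx.
rewrite -(cvg_lim (@ereal_hausdorff R) L) -(cvg_lim (@ereal_hausdorff R) L'); congr (limn _); apply/funext => n.
have indich r : measurable_fun setT (fun x => (r * \1_(h n @^-1` [set r]) x)%:E).
  by apply/measurable_EFinP; exact: measurable_funM.
transitivity (\int[@weighted R]_x (\sum_(y \in range (h n)) (y * \1_(h n @^-1` [set y]) x)%:E))%E.
  by apply: eq_integral => x _; rewrite fsumEFin// -fimfunE.
transitivity (\int[mu]_x (\sum_(y \in range (h n)) ((y * \1_(h n @^-1` [set y]) x)%:E * (G x)^-1%:E)))%E;
  last first.
  apply: eq_integral => x _; rewrite -ge0_mule_fsuml; last by move=> y; exact: nnfun_muleindic_ge0.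
  by rewrite fsumEFin// -fimfunE.
rewrite ge0_integral_fsum//; last by move=> y x _; exact: nnfun_muleindic_ge0.
rewrite ge0_integral_fsum//; last 2 first.
- by move=> y; apply: emeasurable_funM.
- by move=> y x _; apply: mule_ge0 => //; exact: nnfun_muleindic_ge0.
apply: eq_fsbigr => r; rewrite inE => -[x0 _ rx].
have r0 : (0 <= r%:E)%E by rewrite -rx lee_fin.
under eq_integral do rewrite EFinM.
rewrite ge0_integralZl//; last by apply/measurable_EFinP.
under [RHS]eq_integral do rewrite EFinM -muleA.
rewrite ge0_integralZl//; last 2 first.
- by apply: emeasurable_funM => //; apply/measurable_EFinP.
- by move=> x _; apply: mule_ge0 => //; rewrite lee_fin.
congr (_ * _)%E; rewrite integral_indic// setIT [LHS]/= /weighted [LHS]integral_mkcond.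
apply: eq_integral => x _; rewrite patchE indicE; case: ifPn => _ /=.
  by rewrite mul1e.
by rewrite mul0e.
Qed.

Lemma X_meas w : meas w.
Proof. exact: (@measurable_funPT _ _ _ _ w). Qed.

Lemma X_sqr_intg w : intg mu (fun x => (G x)^-1 * w x ^+ 2).
Proof.
have := Lfun2_integrable_sqr (LfunP w) => /integrableP[mw].
rewrite integral_weighted//; last exact: measurableT_comp.
move=> h; apply: intg_lty.
- by apply: measurable_funM; [exact: meas_gaussV|apply: measurable_funX; exact: X_meas].
- by move=> x; rewrite mulr_ge0 ?sqr_ge0// invr_ge0 gaussG_ge0.
- apply: le_lt_trans h; rewrite le_eqVlt; apply/orP; left; apply/eqP.
  by apply: eq_integral => x _ /=; rewrite normrX real_normK ?num_real// -EFinM mulrC.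
Qed.

Lemma X_of f : meas f -> intg mu (fun x => (G x)^-1 * f x ^+ 2) ->
  exists u : X R, forall x, u x = f x.
Proof.
move=> mf fi.
have fL : f \in Lfun (@weighted R) 2%:E.
  rewrite inE; apply/andP; split; rewrite inE//= /finite_norm unlock.
  apply: poweR_lty; rewrite integral_weighted; last 2 first.
  - under eq_fun do rewrite /= powR_mulrn//.
    by apply/measurable_EFinP; apply: measurable_funX; exact: measurableT_comp.
  - by move=> x; rewrite lee_fin powR_ge0.
  have := integrable_lty _ fi => /(_ measurableT) /=.
  apply: le_lt_trans; rewrite le_eqVlt; apply/orP; left; apply/eqP.
  apply: eq_integral => x _ /=.
  by rewrite powR_mulrn// real_normK ?num_real// -EFinM mulrC.
by exists (Lfun_Sub (lee1n 2) fL) => x.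
Qed.

Lemma X_lin a u v xi : (a *: u + v) xi = a * u xi + v xi.
Proof. by []. Qed.

Lemma dotX_intg u v : intg mu (fun x => (G x)^-1 * u x * v x).
Proof.
apply: intg_le (intgD (X_sqr_intg u) (X_sqr_intg v)) _.
  apply: measurable_funM; last exact: X_meas.
  by apply: measurable_funM; [exact: meas_gaussV|exact: X_meas].
move=> x; rewrite -mulrDr -mulrA normrM ger0_norm ?invr_ge0 ?gaussG_ge0//.
rewrite ler_wpM2l ?invr_ge0 ?gaussG_ge0// normrM.
rewrite -(real_normK (num_real (u x))) -(real_normK (num_real (v x))).
have := sqr_ge0 (`|u x| - `|v x|); have := sqr_ge0 (`|u x| + `|v x|); nra.
Qed.

Lemma dotXC u v : dotX u v = dotX v u.
Proof. by rewrite /dotX; apply: eq_Rintegral => x _; rewrite mulrAC. Qed.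

Lemma dotXL a u v w : dotX (a *: u + v) w = a * dotX u w + dotX v w.
Proof.
rewrite /dotX -RintZ; last exact: dotX_intg.
rewrite -RintD; [|exact/intgZ/dotX_intg|exact: dotX_intg].
by apply: eq_Rintegral => x _; rewrite X_lin; ring.
Qed.

Lemma dotX_ge0 u : 0 <= dotX u u.
Proof.
apply: Rintegral_ge0 => x _; rewrite -mulrA -expr2.
by rewrite mulr_ge0 ?sqr_ge0// invr_ge0 gaussG_ge0.
Qed.

Lemma dotX_eq0 u : dotX u u = 0 <-> {ae mu, forall x : P, u x = 0}.
Proof.
split=> [u0|u0].
  have := Rint_eq0_ae (X_sqr_intg u); case.
  - by move=> x; rewrite mulr_ge0 ?sqr_ge0// invr_ge0 gaussG_ge0.
  - by rewrite -u0; apply: eq_Rintegral => x _; rewrite expr2 mulrA.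
  - move=> N [mN N0 h]; exists N; split => // x /= ux; apply: h => /= /eqP.
    by rewrite mulf_eq0 invr_eq0 gt_eqF ?gaussG_gt0//= sqrf_eq0 => /eqP.
rewrite /dotX (@Rint_ae _ _ _ _ _ (fun=> 0)); first by rewrite Rintegral_cst ?mul0r.
- exact: intg_meas (dotX_intg u u).
- exact: measurable_cst.
- by apply: filterS u0 => x ->; rewrite mulr0.
Qed.

Lemma heqX u v : heq (@dotX R) u v <-> {ae mu, forall x : P, u x = v x}.
Proof.
rewrite (heqP dotXC dotX_ge0) dotX_eq0; split; apply: filterS => x.
  by move=> /eqP; rewrite subr_eq0 => /eqP.
by move=> /= h; apply/eqP; rewrite subr_eq0 h.
Qed.


Let gaussV_ge0 x : 0 <= (G x)^-1.
Proof. by rewrite invr_ge0 gaussG_ge0. Qed.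

Let gsq_ge0 x (a : R) : 0 <= (G x)^-1 * a ^+ 2.
Proof. by apply: mulr_ge0; [exact: gaussV_ge0|exact: sqr_ge0]. Qed.

Lemma dotX_sub_lty u v : (\int[mu]_x ((G x)^-1 * (u x - v x) ^+ 2)%:E = (dotX (u - v) (u - v))%:E)%E.
Proof.
have h := dotX_intg (u - v) (u - v); rewrite /dotX -(intg_ltyE h).
by apply: eq_integral => x _; rewrite expr2 mulrA.
Qed.

Lemma geometric_abs_cvg (v : nat -> R) (C : R) :
  (forall j, `|v j.+1 - v j| <= C * 2^-1 ^+ j) -> cvgn v.
Proof.
move=> hv.
have h2 : `|2^-1 : R| < 1 by rewrite gtr0_norm ?invf_lt1 ?invr_gt0// ltr1n.
have c : cvgn (series (fun j => v j.+1 - v j)).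
  apply: normed_cvg; apply: (series_le_cvg _ _ hv) => //.
  - move=> n; apply: mulr_ge0; last exact: exprn_ge0.
    by have := hv 0%N; rewrite expr0 mulr1; exact: le_trans.
  - exact: (is_cvg_geometric_series (a := C) h2).
have -> : v = (fun n => v 0%N + series (fun j => v j.+1 - v j) n).
  by apply/funext => n; rewrite /series /= telescope_sumr// addrC subrK.
by apply: is_cvgD => //; exact: is_cvg_cst.
Qed.

(* Riesz-Fischer: a subsequence with rapidly decreasing increments converges
   almost everywhere, and Fatou's lemma bounds its distance to the limit. *)
Lemma X_complete (u : nat -> X R) : cauchyH (@dotX R) u -> exists v, cvgH (@dotX R) u v.
Proof.
move=> cu.
have e0 j : 0 < (16^-1 : R) ^+ j by rewrite exprn_gt0.
pose N j := projT1 (cid (cu _ (e0 j))).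
have NP j m n : (N j <= m)%N -> (m <= n)%N -> dotX (u n - u m) (u n - u m) < 16^-1 ^+ j.
  by rewrite /N; case: cid => x /= h; exact: h.
pose k j := (\sum_(i < j.+1) N i)%N.
have Nk j : (N j <= k j)%N by rewrite /k big_ord_recr /= leq_addl.
have kS j : (k j <= k j.+1)%N by rewrite /k [in leqRHS]big_ord_recr /= leq_addr.
have kk i j : (i <= j)%N -> (k i <= k j)%N.
  by move=> ij; apply: (homo_leq _ leq_trans kS) => // x; exact: leqnn.
pose v j := u (k j).
have vP i j : (i <= j)%N -> dotX (v j - v i) (v j - v i) <= 16^-1 ^+ i.
  by move=> ij; rewrite ltW// NP// kk.
(* Squared increments are at most 16^-j in norm, so the weights 4^j keep [S] integrable; where [S]
   is finite they force [v j.+1 x - v j x] to be of order 2^-j. *)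
pose S (x : P) := (\sum_(0 <= j <oo) (4 ^+ j * ((G x)^-1 * (v j.+1 x - v j x) ^+ 2))%:E)%E.
have t0 j x : (0 <= (4 ^+ j * ((G x)^-1 * (v j.+1 x - v j x) ^+ 2))%:E)%E.
  by rewrite lee_fin; apply: mulr_ge0; [exact: exprn_ge0|exact: gsq_ge0].
have mt j : measurable_fun setT (fun x : P => (4 ^+ j * ((G x)^-1 * (v j.+1 x - v j x) ^+ 2))%:E).
  apply/measurable_EFinP; apply: measurable_funM => //; apply: measurable_funM.
    exact: meas_gaussV.
  by apply: measurable_funX; apply: measurable_funB; exact: X_meas.
have Sfin : (\int[mu]_x S x < +oo)%E.
  rewrite integral_nneseries//.
  apply: (@le_lt_trans _ _ (\sum_(0 <= j <oo) (2 / (2 ^ (j + 1))%:R)%:E)%E); last first.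
    rewrite (_ : limn _ = (2 / 2 ^+ 0)%:E) ?ltry//; apply/cvg_lim => //.
    by have := @cvg_geometric_eseries_half R 2 0; rewrite /eseries.
  apply: lee_nneseries => [j _ _|j _]; first by apply: integral_ge0 => x _; exact: t0.
  under eq_integral do rewrite EFinM.
  rewrite ge0_integralZl ?lee_fin ?exprn_ge0//; last 2 first.
  - apply/measurable_EFinP; apply: measurable_funM; first exact: meas_gaussV.
    by apply: measurable_funX; apply: measurable_funB; exact: X_meas.
  - by move=> x _; rewrite lee_fin.
  rewrite dotX_sub_lty -EFinM lee_fin.
  apply: (@le_trans _ _ (4 ^+ j * 16^-1 ^+ j)); first by rewrite ler_wpM2l ?exprn_ge0// vP.
  rewrite -exprMn addn1 expnS natrM invfM mulrA divff// mul1r natrX -exprVn.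
  by apply: lerXn2r; rewrite ?nnegrE; lra.
have mS : measurable_fun setT S by apply: ge0_emeasurable_sum => [j x _ _|j _]; [exact: t0|exact: mt].
have aeS : {ae mu, forall x : P, S x \is a fin_num}.
  have : mu.-integrable setT S.
    apply/integrableP; split; first exact: mS.
    apply: le_lt_trans Sfin; rewrite le_eqVlt; apply/orP; left; apply/eqP.
    by apply: eq_integral => x _; rewrite gee0_abs// nneseries_ge0.
  by move=> /(integrable_ae measurableT); apply: filterS => x; exact.
have aec : {ae mu, forall x : P, cvgn (fun j => v j x)}.
  apply: filterS aeS => x Sx.
  apply: (@geometric_abs_cvg _ (Num.sqrt (G x * fine (S x)))) => j.
  have h : 4 ^+ j * ((G x)^-1 * (v j.+1 x - v j x) ^+ 2) <= fine (S x).
    rewrite -lee_fin fineK//; apply: le_trans (nneseries_lim_ge j.+1 _) => //.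
    by rewrite big_nat_recr//= leeDr// sume_ge0.
  have Sx0 : 0 <= fine (S x) by apply: le_trans h; apply: mulr_ge0 => //; exact: exprn_ge0.
  rewrite -sqrtr_sqr -[2^-1 ^+ j]ger0_norm ?exprn_ge0// -sqrtr_sqr -sqrtrM ?(mulr_ge0 (gaussG_ge0 x) Sx0)//.
  rewrite ler_sqrt; last by apply: mulr_ge0; [exact: mulr_ge0 (gaussG_ge0 x) Sx0|exact: sqr_ge0].
  rewrite -exprM mulnC exprM (_ : 2^-1 ^+ 2 = 4^-1 :> R); last by lra.
  rewrite exprVn ler_pdivlMr ?exprn_gt0// mulrC.
  by move: h; rewrite mulrCA ler_pdivrMl ?gaussG_gt0.
(* The upper limit is measurable on the whole plane and is the limit wherever there is one; [fine]
   makes it real elsewhere. *)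
pose w (x : P) := fine (limn_esup (fun j => (v j x)%:E)).
have mw : meas w.
  apply: measurableT_comp; first exact: fine_measurable.
  by apply: measurable_fun_limn_esup => j; apply/measurable_EFinP; exact: X_meas.
have wE : {ae mu, forall x : P, v j x @[j --> \oo] --> w x}.
  apply: filterS aec => x /cvg_ex[l vl].
  rewrite /w is_cvg_limn_esupE; last first.
    by apply/cvg_ex; exists l%:E; apply: cvg_EFin => //; exact: nearW.
  rewrite (_ : limn _ = l%:E)//; apply/cvg_lim => //.
  by apply: cvg_EFin => //; exact: nearW.
have key i : (\int[mu]_x ((G x)^-1 * (w x - v i x) ^+ 2)%:E <= (16^-1 ^+ i)%:E)%E.
  pose f j (x : P) := ((G x)^-1 * (v j x - v i x) ^+ 2)%:E.
  have mf j : measurable_fun setT (f j).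
    apply/measurable_EFinP; apply: measurable_funM; first exact: meas_gaussV.
    by apply: measurable_funX; apply: measurable_funB; exact: X_meas.
  rewrite (@ae_eq_integral _ _ _ mu setT (fun x => limn_einf (f^~ x)))//; last 3 first.
  - apply/measurable_EFinP; apply: measurable_funM; first exact: meas_gaussV.
    by apply: measurable_funX; apply: measurable_funB => //; exact: X_meas.
  - rewrite (_ : (fun x => limn_einf _) = (fun x => - limn_esup (fun j => - f j x))%E).
      apply: measurableT_comp => //; apply: measurable_fun_limn_esup => j.
      exact: (measurableT_comp _ (mf j)).
    apply/funext => x; rewrite -limn_einfN; congr limn_einf.
    by apply/funext => j; rewrite [RHS]oppeK.
  - apply: filterS wE => x vw _.
    have c : f j x @[j --> \oo] --> ((G x)^-1 * (w x - v i x) ^+ 2)%:E.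
      apply: cvg_EFin; first exact: nearW.
      apply: cvgM; first exact: cvg_cst.
      by apply: cvgM; (apply: cvgB; [exact: vw|exact: cvg_cst]).
    by rewrite is_cvg_limn_einfE; [apply/esym/cvg_lim|apply/cvg_ex; eexists; exact: c].
  apply: le_trans (fatou mu measurableT mf _) _.
    by move=> j x _; rewrite lee_fin.
  rewrite limn_einf_lim; apply: lime_le; first exact: is_cvg_einfs.
  apply: nearW => n; apply: (@le_trans _ _ (\int[mu]_x f (maxn n i) x)%E).
    by apply: ereal_inf_lbound; exists (maxn n i) => //=; exact: leq_maxl.
  by rewrite dotX_sub_lty lee_fin vP// leq_maxr.
have fw i : intg mu (fun x => (G x)^-1 * (w x - v i x) ^+ 2).
  apply: intg_lty; last by apply: le_lt_trans (key i) _; rewrite ltry.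
    apply: measurable_funM; first exact: meas_gaussV.
    by apply: measurable_funX; apply: measurable_funB => //; exact: X_meas.
  by [].
(* The Fatou bound puts [w - v 0] in X, and [w] follows by adding [v 0] back. *)
have [w' w'E] := @X_of (fun x => w x - v 0%N x) (measurable_funB mw (X_meas (v 0%N))) (fw 0%N).
pose W := w' + v 0%N.
have WE x : W x = w x.
  by rewrite -[W x]/(w' x + v 0%N x) w'E subrK.
have Wv i : dotX (W - v i) (W - v i) <= 16^-1 ^+ i.
  rewrite -lee_fin -dotX_sub_lty; apply: le_trans (key i).
  by rewrite le_eqVlt; apply/orP; left; apply/eqP; apply: eq_integral => x _; rewrite WE.
exists W; apply/cvgr0Pnorm_lt => e e_gt0.
have [i hi] : exists i, (16^-1 : R) ^+ i < e / 4.
  have : (16^-1 : R) ^+ i @[i --> \oo] --> (0 : R).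
    by apply: cvg_expr; rewrite gtr0_norm ?invf_lt1// ltr1n.
  have e40 : 0 < e / 4 by rewrite divr_gt0.
  move=> /cvgr0Pnorm_lt/(_ _ e40)[i _ /(_ i (leqnn i)) /= h]; exists i.
  exact: le_lt_trans (ler_norm _) h.
exists (k i) => // n /= kn; rewrite ger0_norm ?dotX_ge0//.
have aux (a b t : R) : a < t -> b <= t -> t < e / 4 -> 2 * a + 2 * b < e by lra.
have h1 := NP i (k i) n (Nk i) kn.
have h2 := Wv i.
apply: le_lt_trans (sdot_subsq dotXC dotXL dotX_ge0 (u n) (v i) W) _.
rewrite -(opprB W (v i)) (sdotNl dotXL) (sdotNr dotXC dotXL) opprK.
exact: aux h1 h2 hi.
Qed.
End weighted_space.


(** * Smooth functions of one variable and a bump function *)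

Section smooth_functions.
Context (R : realType).
Implicit Types (f g : R -> R) (p q : {poly R}) (n : nat) (x : R).

(** One-variable counterpart of [class_C]: products of smooth functions of the two coordinates will
    supply the test functions. *)
Fixpoint Cn n f : Prop := continuous f /\
  if n is n'.+1 then (forall x, derivable f x 1) /\ Cn n' f^`()%classic else True.

Definition smooth f := forall n, Cn n f.

Lemma Cn_cont n f : Cn n f -> continuous f.
Proof. by case: n => [|n] []. Qed.

Lemma CnW n f : Cn n.+1 f -> Cn n f.
Proof.
elim: n f => [|n ih] f; first by case.
by move=> [cf [df h]]; split => //; split => //; exact: ih.
Qed.

Lemma smooth_cont f : smooth f -> continuous f.
Proof. by move=> /(_ 0%N)/Cn_cont. Qed.

Lemma smooth_derivable f x : smooth f -> derivable f x 1.
Proof. by move=> /(_ 1%N)[_ []]. Qed.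

Lemma smooth_derive f : smooth f -> smooth f^`()%classic.
Proof. by move=> sf n; have [_ []] := sf n.+1. Qed.

Lemma smooth_is_derive f x : smooth f -> is_derive x 1 f (f^`()%classic x).
Proof. by move=> sf; rewrite derive1E; apply: derivableP; exact: smooth_derivable. Qed.

Lemma CnD n f g : Cn n f -> Cn n g -> Cn n (fun x => f x + g x).
Proof.
elim: n f g => [|n ih] f g; move=> [cf hf] [cg hg]; split.
- by move=> x; apply: cvgD; [exact: cf|exact: cg].
- by [].
- by move=> x; apply: cvgD; [exact: cf|exact: cg].
- case: hf hg => df Cf [dg Cg]; split; first by move=> x; exact: derivableD.
  rewrite (_ : _^`()%classic = fun x => f^`()%classic x + g^`()%classic x).
    exact: ih.
  by apply/funext => x; rewrite !derive1E deriveD.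
Qed.

Lemma CnM n f g : Cn n f -> Cn n g -> Cn n (fun x => f x * g x).
Proof.
elim: n f g => [|n ih] f g; move=> [cf hf] [cg hg]; split.
- by move=> x; apply: cvgM; [exact: cf|exact: cg].
- by [].
- by move=> x; apply: cvgM; [exact: cf|exact: cg].
- case: hf hg => df Cf [dg Cg]; split; first by move=> x; exact: derivableM.
  rewrite (_ : _^`()%classic = fun x => f x * g^`()%classic x + g x * f^`()%classic x).
    apply: CnD; apply: ih => //; exact: CnW.
  by apply/funext => x; rewrite !derive1E deriveM.
Qed.

Lemma smoothM f g : smooth f -> smooth g -> smooth (fun x => f x * g x).
Proof. by move=> sf sg n; exact: CnM. Qed.

Lemma smooth_cst (c : R) : smooth (fun=> c).
Proof.
move=> n; elim: n c => [|n ih] c; split => //; try by move=> x; exact: cvg_cst.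
split => [x|]; first exact: derivable_cst.
rewrite (_ : _^`()%classic = fun=> 0) //.
by apply/funext => x; rewrite derive1E derive_cst.
Qed.

Lemma smooth_horner p : smooth (fun x => p.[x]).
Proof.
move=> n; elim: n p => [|n ih] p; split => //; try exact: continuous_horner.
split => [x|]; first exact: derivable_horner.
by rewrite -[_^`()%classic]/((horner p)^`()%classic) -derivE.
Qed.

Lemma is_derive_affine a c x : is_derive x 1 (fun y : R => a * y + c) a.
Proof.
have -> : (fun y : R => a * y + c) = (a *: id + cst c).
  by apply/funext.
by apply: is_derive_eq; rewrite addr0 -[RHS]mulr1.
Qed.

Lemma smooth_affine f a c : smooth f -> smooth (fun x => f (a * x + c)).
Proof.
move=> sf n; elim: n f sf => [|n ih] f sf; split => //.
- move=> x; apply: (cvg_comp (fun x => a * x + c) f); last exact: smooth_cont.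
  by apply: cvgD; [apply: cvgM; [exact: cvg_cst|exact: cvg_id]|exact: cvg_cst].
- move=> x; apply: (cvg_comp (fun x => a * x + c) f); last exact: smooth_cont.
  by apply: cvgD; [apply: cvgM; [exact: cvg_cst|exact: cvg_id]|exact: cvg_cst].
have dfa x : is_derive x 1 (fun x => f (a * x + c)) (a * f^`()%classic (a * x + c)).
  have h1 := is_derive_affine a c x.
  have h2 := smooth_is_derive (a * x + c) sf.
  have := @is_derive1_comp R f (fun y => a * y + c) x _ _ h2 h1.
  by rewrite mulrC.
split; first by move=> x; have [] := dfa x.
rewrite (_ : _^`()%classic = fun x => a * f^`()%classic (a * x + c)).
  by apply: CnM; [exact: smooth_cst|apply: ih; exact: smooth_derive].
by apply/funext => x; rewrite derive1E; have [_ ->] := dfa x.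
Qed.

(** Each power satisfies [u ^+ i <= i! * expR u], from one term of the exponential series. *)
Lemma poly_le_exp q : exists2 K : R, 0 <= K & forall u, 0 <= u -> `|q.[u]| <= K * expR u.
Proof.
exists (\sum_(i < size q) `|q`_i| * (i`!)%:R).
  by apply: sumr_ge0 => i _; rewrite mulr_ge0.
move=> u u0; rewrite horner_coef mulr_suml; apply: le_trans (ler_norm_sum _ _ _) _.
apply: ler_sum => i _; rewrite normrM normrX (ger0_norm u0) -mulrA ler_wpM2l//.
case: (nat_of_ord i) => [|j].
  by rewrite expr0 fact0 mul1r -expR0 ler_expR.
rewrite mulrC -ler_pdivrMr ?ltr0n ?fact_gt0//.
by apply: le_trans (expR_ge1Dxn j u0); rewrite lerDr.
Qed.

(* The derivatives of exp(-1/x) 1_{x>0} are again of this form. *)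
Definition flat p x : R := if 0 < x then p.[x^-1] * expR (- x^-1) else 0.

Lemma flat_pos p x : 0 < x -> flat p x = p.[x^-1] * expR (- x^-1).
Proof. by rewrite /flat => ->. Qed.

Lemma flat_neg p x : x <= 0 -> flat p x = 0.
Proof. by rewrite /flat ltNge => ->. Qed.

(** Bounding ['X * p], rather than [p], by the exponential at [x^-1] leaves the factor [x], hence
    continuity at 0. *)
Lemma flat_le p : exists2 K : R, 0 <= K & forall x, `|flat p x| <= K * `|x|.
Proof.
have [K K0 hK] := poly_le_exp ('X * p).
exists K => // x; have [x0|x0] := ltP 0 x; last first.
  by rewrite flat_neg// normr0 mulr_ge0.
rewrite flat_pos// (gtr0_norm x0) -ler_pdivrMr// normrM (gtr0_norm (expR_gt0 _)).
have := hK x^-1; rewrite invr_ge0 (ltW x0) => /(_ isT).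
rewrite !hornerE normrM gtr0_norm ?invr_gt0// => h.
by rewrite mulrAC expRN ler_pdivrMr ?expR_gt0// mulrC.
Qed.

Lemma flat_cont0 p : {for 0, continuous (flat p)}.
Proof.
have [K K0 hK] := flat_le p.
rewrite /prop_for /continuous_at flat_neg//.
apply/cvgr0Pnorm_le => e e0; near=> x.
apply: le_trans (hK x) _.
apply: (@le_trans _ _ ((K + 1) * `|x|)); first by rewrite ler_wpM2r// lerDl.
rewrite mulrC -ler_pdivlMr; last by rewrite ltr_wpDl.
near: x; apply: (@nbhs0_le R R^o); by rewrite divr_gt0// ltr_wpDl.
Unshelve. all: by end_near. Qed.

Lemma flat_is_derive p x : is_derive x 1 (flat p) (flat ('X^2 * (p - p^`())) x).
Proof.
have [x0|x0|->] := ltrgtP x 0.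
- rewrite [flat _ x]flat_neg ?ltW//.
  have h : \near x, (fun=> 0) x = flat p x :> R.
    near=> y; rewrite flat_neg// ltW//; near: y; exact: lt_nbhsl.
  apply: DeriveDef; first by apply: (near_eq_derivable h); exact: derivable_cst.
  by rewrite -(near_eq_derive _ h) derive_cst.
- rewrite flat_pos//.
  have h : \near x, (fun y => p.[y^-1] * expR (- y^-1)) x = flat p x :> R.
    near=> y; rewrite flat_pos//; near: y; exact: lt_nbhsr.
  have xn0 : x != 0 by rewrite gt_eqF.
  have dV : is_derive x 1 (fun y : R => y^-1) (- x ^- 2).
    have := @is_deriveV R id x 1 1 xn0 (is_derive_id x 1).
    by rewrite scaler1 -exprVn.
  have d1 : is_derive x 1 (fun y => p.[y^-1]) (p^`().[x^-1] * - x ^- 2).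
    exact: (@is_derive1_comp R (horner p) (fun y => y^-1) x _ _ (is_derive_poly p x^-1) dV).
  have d2 : is_derive x 1 (fun y => expR (- y^-1)) (expR (- x^-1) * - - x ^- 2).
    have dN : is_derive x 1 (fun y : R => - y^-1) (- - x ^- 2) by exact: is_deriveN.
    exact: (@is_derive1_comp R (@expR R) (fun y => - y^-1) x _ _ (is_derive_expR _) dN).
  have d3 := is_deriveM d1 d2.
  apply: DeriveDef; first by apply: (near_eq_derivable h); case: d3.
  rewrite -(near_eq_derive _ h); have [_ ->] := d3.
  rewrite !hornerE -[_ *: _]/(_ * _) -[X in _ + X]/(_ * _) -exprVn; ring.
(* The slope [flat p z / z] at 0 is again of this form, with ['X * p] for [p], and is continuous
   there. *)
- apply/is_derive1_caratheodory; exists (flat ('X * p)); split.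
    move=> z; rewrite [flat p 0]flat_neg// !subr0; have [z0|z0] := ltP 0 z; last first.
      by rewrite !flat_neg// mul0r.
    by rewrite !flat_pos// !hornerE; field; rewrite gt_eqF.
  + exact: flat_cont0.
  + by rewrite !flat_neg.
Unshelve. all: by end_near. Qed.

Lemma smooth_flat p : smooth (flat p).
Proof.
have cf q : continuous (flat q).
  move=> x; apply/differentiable_continuous/derivable1_diffP.
  by have [] := flat_is_derive q x.
move=> n; elim: n p => [|n ih] p; split => //.
split => [x|]; first by have [] := flat_is_derive p x.
rewrite (_ : _^`()%classic = flat ('X^2 * (p - p^`()))) //.
by apply/funext => x; rewrite derive1E; have [_ ->] := flat_is_derive p x.
Qed.

(** The factors vanish for [x <= -1] and for [x >= 1]; [expR 2] normalizes the value at 0. Both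
    arguments are in the form of [smooth_affine]. *)
Definition bump x : R := expR 2 * (flat 1 (1 * x + 1) * flat 1 (-1 * x + 1)).

Lemma smooth_bump : smooth bump.
Proof.
apply: smoothM; first exact: smooth_cst.
by apply: smoothM; apply: smooth_affine; exact: smooth_flat.
Qed.

Lemma bump0 : bump 0 = 1.
Proof.
rewrite /bump !mulr0 !add0r !flat_pos// !hornerC !mul1r invr1 -!expRD.
by rewrite -[RHS]expR0; congr expR; ring.
Qed.

Lemma bump_out x : 1 <= `|x| -> bump x = 0.
Proof.
rewrite /bump ler_normr => /orP[h|h].
  by rewrite [X in _ * (_ * X)]flat_neg ?mulr0//; lra.
by rewrite [X in _ * (X * _)]flat_neg ?(mul0r,mulr0)//; lra.
Qed.

Lemma cont_compact_bounded f (M : R) : continuous f -> (forall x, M < `|x| -> f x = 0) ->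
  exists2 B : R, 0 <= B & forall x, `|f x| <= B.
Proof.
move=> cf fM.
have : compact (f @` `[- M, M]%classic).
  apply: continuous_compact; last exact: segment_compact.
  exact: continuous_subspaceT.
move=> /compact_bounded[B [_ hB]].
exists (`|B| + 1) => // x; have [xM|xM] := ltP M `|x|.
  by rewrite fM// normr0.
apply: hB; first by rewrite (le_lt_trans (ler_norm _))// ltrDl.
by exists x => //=; rewrite in_itv/= -ler_norml.
Qed.

Lemma derive1_out f (M : R) : (forall x, M < `|x| -> f x = 0) ->
  forall x, M < `|x| -> f^`()%classic x = 0.
Proof.
move=> fM x Mx; rewrite derive1E -(@near_eq_derive _ _ _ (fun=> 0)) ?derive_cst//.
near=> y; rewrite fM//; near: y.
have : (fun y : R => `|y|) @ x --> `|x| by exact: norm_continuous.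
by move=> /(_ _ (lt_nbhsr Mx)).
Unshelve. all: by end_near. Qed.

(* Cut-offs [p b(x/(N+1))] of a polynomial [p], whose derivatives converge to
   those of [p] with a bound uniform in [N]. *)
Definition cutoff p (N : nat) x : R := p.[x] * bump (N.+1%:R^-1 * x + 0).

Lemma smooth_cutoff p N : smooth (cutoff p N).
Proof.
by apply: smoothM; [exact: smooth_horner|apply: smooth_affine; exact: smooth_bump].
Qed.

Lemma cutoff_out p N x : N.+1%:R <= `|x| -> cutoff p N x = 0.
Proof.
move=> h; rewrite /cutoff bump_out ?mulr0// addr0 normrM normfV normr_nat.
by rewrite mulrC ler_pdivlMr ?ltr0n// mul1r.
Qed.

End smooth_functions.


(** * Tensor products and functions of slow growth *)

Section tensor_products.
Context d1 d2 (T1 : measurableType d1) (T2 : measurableType d2) (R : realType).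
Context (m1 : {sigma_finite_measure set T1 -> \bar R}) (m2 : {sigma_finite_measure set T2 -> \bar R}).

Lemma intg_tensor (f : T1 -> R) (g : T2 -> R) : intg m1 f -> intg m2 g ->
  intg (m1 \x m2)%E (fun x => f x.1 * g x.2).
Proof.
move=> fi gi.
have mf := intg_meas fi; have mg := intg_meas gi.
have m : measurable_fun [set: T1 * T2] (fun x => (f x.1 * g x.2)%:E).
  apply/measurable_EFinP; apply: measurable_funM.
    exact: measurableT_comp mf _.
  exact: measurableT_comp mg _.
apply/integrable12ltyP => //.
have /integrableP[_ fy] := fi; have /integrableP[_ gy] := gi.
have mg' : measurable_fun setT (fun y => `|(g y)%:E|%E).
  by apply: measurableT_comp => //; exact/measurable_EFinP.
rewrite (eq_integral (fun x => `|(f x)%:E| * \int[m2]_y `|(g y)%:E|)%E).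
  rewrite ge0_integralZr//; last 2 first.
  - by apply: measurableT_comp => //; exact/measurable_EFinP.
  - exact: integral_ge0.
  by rewrite lte_mul_pinfty// ?integral_ge0// ge0_fin_numE// integral_ge0.
move=> x _; rewrite -ge0_integralZl//.
by apply: eq_integral => y _; rewrite /= -EFinM normrM.
Qed.

End tensor_products.

Section growth.
Context (R : realType).
Local Notation plane := (R * R)%type.
Local Notation mu := (leb2 R).
Local Notation mR := (measurableTypeR R).
Local Notation P := (mR * mR)%type.
Local Notation meas f := (measurable_fun [set: P] (f : P -> mR)).
Local Notation G := (@gaussG R).
Implicit Types (u v w : X R) (f g k : plane -> R) (xi : plane).

(** Measurability refers to the product sigma-algebra, so an open set is written as a countable
    union of rational boxes. *)
Lemma continuous_meas f : continuous f -> meas f.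
Proof.
move=> cf; apply: (measurability _ (RGenOInfty.measurableE R)) => //.
move=> _ [_ [c ->] <-]; rewrite setTI.
pose A : set plane := f @^-1` `]c, +oo[%classic.
have oA : open A by move/continuousP : cf; apply; exact: interval_open.
pose box (q : (rat * rat) * (rat * rat)) : set P :=
  `]ratr q.1.1, ratr q.1.2[%classic `*` `]ratr q.2.1, ratr q.2.2[%classic.
rewrite (_ : f @^-1` _ = \bigcup_(q in [set q | box q `<=` A]) box q).
  rewrite bigcup_mkcond; apply: countable_bigcupT_measurable => [|q].
    exact: countableP.
  by case: ifP => // _; apply: measurableX; exact: measurable_itv.
apply/seteqP; split => [z Az|z [q qA]]; last exact: qA.
have /nbhs_ballP[e /= e0 eA] : nbhs z A by apply: open_nbhs_nbhs.
have itv (x : R) : exists2 q : rat * rat, ratr q.1 < x < ratr q.2 &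
    (forall y, ratr q.1 < y < ratr q.2 -> ball x e y).
  have /rat_in_itvoo[a /itvP ha] : x - e < x by rewrite gtrBl.
  have /rat_in_itvoo[b /itvP hb] : x < x + e by rewrite ltrDl.
  have a1 : x - e < ratr a by rewrite ha.
  have b1 : ratr b < x + e by rewrite hb.
  exists (a, b) => [|y] /=; first by rewrite ha hb.
  by move=> /andP[ay yb]; rewrite /ball/= ltr_norml; apply/andP; split; lra.
have [q1 z1 h1] := itv z.1; have [q2 z2 h2] := itv z.2.
exists (q1, q2); last by split; rewrite /= in_itv.
by move=> y [/=]; rewrite !in_itv/= => y1 y2; apply: eA; split; [exact: h1|exact: h2].
Qed.

Lemma intg_gauss1 : intg (@lebesgue_measure R) (fun x => expR (- (x ^+ 2 / 8))).
Proof.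
have two0 : (2 : R) != 0 by [].
(* Standard deviation 2 gives the exponent [- (x ^+ 2 / 8)]. *)
have := @integrable_normal_pdf R 0 2.
rewrite normal_pdfE// => h.
have := @intgZ _ _ _ _ (normal_peak 2)^-1 _ h.
rewrite (_ : (fun x => _) = (fun x => expR (- (x ^+ 2 / 8))))//.
apply/funext => x; rewrite mulKf ?gt_eqF ?normal_peak_gt0//.
rewrite /normal_fun subr0; congr expR; rewrite mulNr -mulr_natr; congr (- (_ / _)); lra.
Qed.

Lemma intg_gauss2 : intg mu (fun x => expR (- (sqnorm x / 8))).
Proof.
have := intg_tensor intg_gauss1 intg_gauss1.
rewrite (_ : (fun x => _) = (fun x => expR (- (@sqnorm R x / 8))))//.
by apply/funext => x; rewrite -expRD; congr expR; rewrite /sqnorm; lra.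
Qed.

(* [sg]: growth slow enough for [k |-> G k] to land in X. *)
Definition sg k := meas k /\ exists C, forall x, `|k x| <= C * expR (sqnorm x / 16).

(** Growth below every Gaussian rate: unlike [sg], this class is stable under products. *)
Definition slow k := meas k /\
  forall e, 0 < e -> exists C, forall x, `|k x| <= C * expR (e * sqnorm x).

Lemma sqnorm_ge0 xi : 0 <= sqnorm xi.
Proof. by rewrite addr_ge0 ?sqr_ge0. Qed.

Lemma slow_sg k : slow k -> sg k.
Proof.
move=> [mk h]; split => //; have [|C hC] := h (16^-1); first by rewrite invr_gt0.
by exists C => x; rewrite [sqnorm x / _]mulrC.
Qed.

Lemma slow_bounded k (B : R) : meas k -> (forall x, `|k x| <= B) -> slow k.
Proof.
move=> mk kB; split => // e e0; exists B => x; apply: le_trans (kB x) _.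
rewrite ler_peMr ?(le_trans _ (kB x))//.
by rewrite -expR0 ler_expR mulr_ge0 ?sqnorm_ge0// ltW.
Qed.

Lemma slow_cst (c : R) : slow (fun=> c).
Proof. by apply: (@slow_bounded _ `|c|). Qed.

Lemma slowM k1 k2 : slow k1 -> slow k2 -> slow (fun x => k1 x * k2 x).
Proof.
move=> [m1 h1] [m2 h2]; split; first exact: measurable_funM.
move=> e e0; have e20 : 0 < e / 2 by rewrite divr_gt0.
have [C1 hC1] := h1 _ e20; have [C2 hC2] := h2 _ e20.
exists (C1 * C2) => x; rewrite [e]splitr mulrDl expRD normrM mulrACA.
exact: ler_pM.
Qed.

Lemma slowD k1 k2 : slow k1 -> slow k2 -> slow (fun x => k1 x + k2 x).
Proof.
move=> [m1 h1] [m2 h2]; split; first exact: measurable_funD.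
move=> e e0; have [C1 hC1] := h1 _ e0; have [C2 hC2] := h2 _ e0.
exists (C1 + C2) => x; rewrite mulrDl; apply: le_trans (ler_normD _ _) _.
exact: lerD.
Qed.

Lemma slowZ (c : R) k : slow k -> slow (fun x => c * k x).
Proof. by apply: slowM; exact: slow_cst. Qed.

Lemma le_expsq (e t : R) : 0 < e -> `|t| <= (1 + e^-1) * expR (e * t ^+ 2).
Proof.
move=> e0; apply: (@le_trans _ _ ((1 + e^-1) * (1 + e * t ^+ 2))).
  rewrite (_ : _ * (1 + _) = 1 + e * t ^+ 2 + e^-1 + t ^+ 2); last by field; rewrite gt_eqF.
  have h1 : `|t| <= 1 + t ^+ 2.
    by rewrite -real_normK ?num_real//; have := sqr_ge0 (`|t| - 1); nra.
  have h2 : 0 <= e^-1 by rewrite invr_ge0 ltW.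
  have h3 : 0 <= e * t ^+ 2 by rewrite mulr_ge0 ?sqr_ge0 ?ltW.
  lra.
rewrite ler_wpM2l ?expR_ge1Dx// addr_ge0// invr_ge0 ltW//.
Qed.

Lemma slow_fst : slow (fun x => x.1).
Proof.
split=> [|e e0]; first exact: measurable_fst.
exists (1 + e^-1) => x; apply: le_trans (le_expsq _ e0) _.
apply: ler_wpM2l; first by rewrite addr_ge0// invr_ge0 ltW.
by rewrite ler_expR; apply: ler_wpM2l; [exact: ltW|rewrite lerDl sqr_ge0].
Qed.

Lemma slow_snd : slow (fun x => x.2).
Proof.
split=> [|e e0]; first exact: measurable_snd.
exists (1 + e^-1) => x; apply: le_trans (le_expsq _ e0) _.
apply: ler_wpM2l; first by rewrite addr_ge0// invr_ge0 ltW.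
by rewrite ler_expR; apply: ler_wpM2l; [exact: ltW|rewrite lerDr sqr_ge0].
Qed.

Lemma slow_poly1 (p : {poly R}) : slow (fun x => p.[x.1]).
Proof.
elim/poly_ind: p => [|p c ih].
  by under eq_fun do rewrite horner0; exact: slow_cst.
under eq_fun do rewrite hornerD hornerM hornerX hornerC.
by apply: slowD; [apply: slowM => //; exact: slow_fst|exact: slow_cst].
Qed.

Lemma slow_poly2 (p : {poly R}) : slow (fun x => p.[x.2]).
Proof.
elim/poly_ind: p => [|p c ih].
  by under eq_fun do rewrite horner0; exact: slow_cst.
under eq_fun do rewrite hornerD hornerM hornerX hornerC.
by apply: slowD; [apply: slowM => //; exact: slow_snd|exact: slow_cst].
Qed.

Lemma slow_pq (p q : {poly R}) : slow (fun x => p.[x.1] * q.[x.2]).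
Proof. by apply: slowM; [exact: slow_poly1|exact: slow_poly2]. Qed.

(** Squaring the growth allowed in [sg] uses up half of the Gaussian; the other half remains
    integrable. *)
Lemma gaussE xi : G xi * expR (sqnorm xi / 16) ^+ 2 = (4 * pi)^-1 * expR (- (sqnorm xi / 8)).
Proof.
by rewrite /gaussG -mulrA expr2 -!expRD; congr (_ * expR _); lra.
Qed.

Lemma sg_sqr_intg k : sg k -> intg mu (fun x => (G x)^-1 * (G x * k x) ^+ 2).
Proof.
move=> [mk [C hC]].
apply: intg_le (intgZ (C ^+ 2 * (4 * pi)^-1) intg_gauss2) _.
  apply: measurable_funM; first exact: meas_gaussV.
  by apply: measurable_funX; apply: measurable_funM => //; exact: meas_gauss.
move=> x; have Gx : G x != 0 by rewrite gt_eqF ?gaussG_gt0.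
rewrite (_ : _ * _ ^+ 2 = G x * k x ^+ 2); last by field.
rewrite -mulrA -gaussE normrM ger0_norm ?gaussG_ge0// mulrCA ler_wpM2l ?gaussG_ge0//.
rewrite normrX -exprMn; have h := hC x.
by rewrite lerXn2r ?nnegrE// (le_trans _ h).
Qed.

Lemma sg_X k : sg k -> exists u : X R, forall x, u x = G x * k x.
Proof.
move=> sk; apply: X_of; last exact: sg_sqr_intg.
by apply: measurable_funM; [exact: meas_gauss|exact: sk.1].
Qed.

(** The factor [G] cancels the weight, so that plain integration against [k] becomes an inner
    product of X. *)
Definition gX k (h : sg k) : X R := projT1 (cid (sg_X h)).

Lemma gXE k (h : sg k) x : gX h x = G x * k x.
Proof. by rewrite /gX; case: cid. Qed.

Lemma dotX_gX w k (h : sg k) : dotX w (gX h) = \int[mu]_x (w x * k x).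
Proof.
apply: eq_Rintegral => x _; rewrite gXE; field.
by rewrite gt_eqF ?gaussG_gt0.
Qed.

Lemma intg_sg w k : sg k -> intg mu (fun x => w x * k x).
Proof.
move=> h; have := dotX_intg w (gX h).
rewrite (_ : (fun x => _) = (fun x => w x * k x))//.
apply/funext => x; rewrite gXE; field.
by rewrite gt_eqF ?gaussG_gt0.
Qed.

Lemma intg_slow w k : slow k -> intg mu (fun x => w x * k x).
Proof. by move=> /slow_sg; exact: intg_sg. Qed.

Lemma sg_gauss_intg k : sg k -> intg mu (fun x => G x * k x).
Proof.
move=> h; have := intg_slow (gX h) (slow_cst 1).
by rewrite (_ : (fun x => _) = (fun x => G x * k x))//; apply/funext => x; rewrite gXE mulr1.
Qed.

End growth.


(** * Partial derivatives, test functions and integrals of derivatives *)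

Section plane_calculus.
Context (R : realType).
Local Notation plane := (R * R)%type.
Local Notation mu := (leb2 R).
Local Notation mR := (measurableTypeR R).
Local Notation P := (mR * mR)%type.
Local Notation meas f := (measurable_fun [set: P] (f : P -> mR)).
Local Notation G := (@gaussG R).
Local Notation e1 := (e1 R).
Local Notation e2 := (e2 R).
Implicit Types (w : X R) (f g phi : plane -> R) (x xi : plane).

(** Difference quotients along a coordinate are those of a slice, which reduces partial derivatives
    to one variable. *)
Let quot1 f x : (fun h : R => h^-1 *: ((f \o shift x) (h *: e1) - f x)) =
  (fun h : R => h^-1 *: (((fun t => f (t, x.2)) \o shift x.1) (h *: (1 : R)) - f x)).
Proof.
apply/funext => h /=; congr (_ *: (f _ - _)).
by case: x => a b; rewrite /e1 /shift /=; congr (_, _); rewrite /= ?scaler0 ?add0r.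
Qed.

Let quot2 f x : (fun h : R => h^-1 *: ((f \o shift x) (h *: e2) - f x)) =
  (fun h : R => h^-1 *: (((fun t => f (x.1, t)) \o shift x.2) (h *: (1 : R)) - f x)).
Proof.
apply/funext => h /=; congr (_ *: (f _ - _)).
by case: x => a b; rewrite /e2 /shift /=; congr (_, _); rewrite /= ?scaler0 ?add0r.
Qed.

Lemma derivable_e1 f x : derivable f x e1 <-> derivable (fun t : R => f (t, x.2)) x.1 1.
Proof. by rewrite /derivable quot1; case: x. Qed.

Lemma derivable_e2 f x : derivable f x e2 <-> derivable (fun t : R => f (x.1, t)) x.2 1.
Proof. by rewrite /derivable quot2; case: x. Qed.

Lemma derive_e1 f x : 'D_e1 f x = 'D_1 (fun t : R => f (t, x.2)) x.1.
Proof. by rewrite /derive quot1; case: x. Qed.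

Lemma derive_e2 f x : 'D_e2 f x = 'D_1 (fun t : R => f (x.1, t)) x.2.
Proof. by rewrite /derive quot2; case: x. Qed.

Lemma tensor_D1 (u v : R -> R) : (forall t, derivable u t 1) ->
  (forall x, derivable (fun x => u x.1 * v x.2) x e1) /\
  'D_e1 (fun x => u x.1 * v x.2) = (fun x => u^`()%classic x.1 * v x.2).
Proof.
move=> du.
have d (x : plane) : is_derive x.1 1 (fun t : R => u t * v x.2) (u^`()%classic x.1 * v x.2).
  have h1 : is_derive x.1 1 u (u^`()%classic x.1) by rewrite derive1E; exact: derivableP.
  have := is_deriveM h1 (is_derive_cst (v x.2) x.1 1).
  rewrite (_ : _ *: 0 + _ = u^`()%classic x.1 * v x.2) => [//|].
  by rewrite scaler0 add0r mulrC.
split; first by move=> x; apply/derivable_e1; case: (d x).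
by apply/funext => x; rewrite derive_e1; case: (d x).
Qed.

Lemma tensor_D2 (u v : R -> R) : (forall t, derivable v t 1) ->
  (forall x, derivable (fun x => u x.1 * v x.2) x e2) /\
  'D_e2 (fun x => u x.1 * v x.2) = (fun x => u x.1 * v^`()%classic x.2).
Proof.
move=> dv.
have d (x : plane) : is_derive x.2 1 (fun t : R => u x.1 * v t) (u x.1 * v^`()%classic x.2).
  have h1 : is_derive x.2 1 v (v^`()%classic x.2) by rewrite derive1E; exact: derivableP.
  have := is_deriveM (is_derive_cst (u x.1) x.2 1) h1.
  rewrite (_ : _ + _ *: 0 = u x.1 * v^`()%classic x.2) => [//|].
  by rewrite scaler0 addr0.
split; first by move=> x; apply/derivable_e2; case: (d x).
by apply/funext => x; rewrite derive_e2; case: (d x).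
Qed.

Lemma tensor_continuous (u v : R -> R) : continuous u -> continuous v ->
  continuous (fun x : plane => u x.1 * v x.2).
Proof.
move=> cu cv x; apply: cvgM.
  by apply: (cvg_comp fst u); [exact: cvg_fst|exact: cu].
by apply: (cvg_comp snd v); [exact: cvg_snd|exact: cv].
Qed.

Lemma tensor_class_C n (u v : R -> R) : smooth u -> smooth v ->
  class_C n (fun x => u x.1 * v x.2).
Proof.
elim: n u v => [|n ih] u v su sv; split => //.
- by apply: tensor_continuous; exact: smooth_cont.
- by apply: tensor_continuous; exact: smooth_cont.
have [d1 D1] := tensor_D1 v (fun t => @smooth_derivable _ _ t su).
have [d2 D2] := tensor_D2 u (fun t => @smooth_derivable _ _ t sv).
split; [exact: d1|exact: d2| |].
  by rewrite D1; apply: ih; [exact: smooth_derive|exact: sv].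
by rewrite D2; apply: ih; [exact: su|exact: smooth_derive].
Qed.

(** Compact support in a form that restricts to slices and is inherited by partial derivatives. *)
Definition box_supp f (M : R) := forall x, M < `|x.1| \/ M < `|x.2| -> f x = 0.

Lemma box_compact (M : R) : compact [set x : plane | `|x.1| <= M /\ `|x.2| <= M].
Proof.
rewrite (_ : [set x | _] = `[- M, M]%classic `*` `[- M, M]%classic).
  by apply: compact_setX; exact: segment_compact.
by apply/seteqP; split => x /=; rewrite !in_itv/= -!ler_norml.
Qed.

Lemma box_closed (M : R) : closed [set x : plane | `|x.1| <= M /\ `|x.2| <= M].
Proof. by apply: compact_closed; [exact: norm_hausdorff|exact: box_compact]. Qed.

Lemma box_supp_compact f M : box_supp f M -> compact (closure [set x | f x != 0]).
Proof.
move=> fM; apply: (subclosed_compact _ (@box_compact M)); first exact: closed_closure.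
have /closure_id -> := @box_closed M.
apply: closure_subset => x /= fx; split; rewrite leNgt; apply/negP => h.
  by move: fx; rewrite fM ?eqxx//; left.
by move: fx; rewrite fM ?eqxx//; right.
Qed.

Lemma compact_box_supp f : compact (closure [set x | f x != 0]) -> exists M, box_supp f M.
Proof.
move=> /compact_bounded[B [_ hB]]; exists (`|B| + 1) => x Bx.
have [//|fx] := eqVneq (f x) 0.
have : `|x| <= `|B| + 1.
  by apply: hB; [rewrite (le_lt_trans (ler_norm _))// ltrDl|exact: subset_closure].
rewrite prod_normE ge_max => /andP[h1 h2].
by case: Bx; rewrite ltNge (h1, h2).
Qed.

Lemma tensor_test (u v : R -> R) (M : R) : smooth u -> smooth v ->
  (forall t, M < `|t| -> u t = 0) -> (forall t, M < `|t| -> v t = 0) ->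
  test_function (fun x => u x.1 * v x.2).
Proof.
move=> su sv uM vM; split; first by move=> n; exact: tensor_class_C.
apply: (@box_supp_compact _ M) => x [h|h]; first by rewrite uM ?mul0r.
by rewrite vM ?mulr0.
Qed.

Lemma box_supp_D1 f M : box_supp f M -> box_supp ('D_e1 f) M.
Proof.
move=> fM x h; rewrite derive_e1 -derive1E; case: h => h.
  by apply: (@derive1_out _ _ M) => // t Mt; apply: fM; left.
rewrite (_ : (fun t => _) = fun=> 0) ?derive1_cst//.
by apply/funext => t; apply: fM; right.
Qed.

Lemma box_supp_D2 f M : box_supp f M -> box_supp ('D_e2 f) M.
Proof.
move=> fM x h; rewrite derive_e2 -derive1E; case: h => h; last first.
  by apply: (@derive1_out _ _ M) => // t Mt; apply: fM; right.
rewrite (_ : (fun t => _) = fun=> 0) ?derive1_cst//.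
by apply/funext => t; apply: fM; left.
Qed.

Lemma test_supp phi : test_function phi -> exists M, box_supp phi M.
Proof. by move=> [_ /compact_box_supp]. Qed.

Lemma test_cont phi : test_function phi -> continuous phi.
Proof. by move=> [/(_ 0%N) []]. Qed.

Lemma test_D1 phi : test_function phi ->
  (forall x, derivable phi x e1) /\ test_function ('D_e1 phi).
Proof.
move=> tphi; have [M hM] := test_supp tphi; case: tphi => h _; split.
  by case: (h 1%N) => _ [d _ _ _] x; exact: d.
split; first by move=> n; case: (h n.+1) => _ [_ _ d _]; exact: d.
exact: (box_supp_compact (box_supp_D1 hM)).
Qed.

Lemma test_D2 phi : test_function phi ->
  (forall x, derivable phi x e2) /\ test_function ('D_e2 phi).
Proof.
move=> tphi; have [M hM] := test_supp tphi; case: tphi => h _; split.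
  by case: (h 1%N) => _ [_ d _ _] x; exact: d.
split; first by move=> n; case: (h n.+1) => _ [_ _ _ d]; exact: d.
exact: (box_supp_compact (box_supp_D2 hM)).
Qed.

Lemma box_supp_bounded f M : continuous f -> box_supp f M ->
  exists2 B : R, 0 <= B & forall x, `|f x| <= B.
Proof.
move=> cf fM.
have : compact (f @` [set x : plane | `|x.1| <= M /\ `|x.2| <= M]).
  by apply: continuous_compact; [exact: continuous_subspaceT|exact: box_compact].
move=> /compact_bounded[B [_ hB]].
exists (`|B| + 1) => // x.
have [xM|/not_andP xM] := pselect (`|x.1| <= M /\ `|x.2| <= M).
  apply: hB; first by rewrite (le_lt_trans (ler_norm _))// ltrDl.
  by exists x.
by rewrite fM ?normr0//; case: xM => /negP; rewrite -ltNge; [left|right].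
Qed.

Lemma test_meas phi : test_function phi -> meas phi.
Proof. by move=> h; apply: continuous_meas; exact: test_cont. Qed.

Lemma test_bounded phi : test_function phi -> exists2 B : R, 0 <= B & forall x, `|phi x| <= B.
Proof. by move=> h; have [M hM] := test_supp h; exact: box_supp_bounded (test_cont h) hM. Qed.

Lemma test_slow phi : test_function phi -> slow phi.
Proof. by move=> h; have [B _ hB] := test_bounded h; apply: slow_bounded hB; exact: test_meas. Qed.

Lemma box_supp_intg f M : meas f -> (exists2 B : R, 0 <= B & forall x, `|f x| <= B) ->
  box_supp f M -> intg mu f.
Proof.
move=> mf [B B0 hB] fM.
(* On the box [sqnorm x <= 2 * M ^+ 2], so this multiple of the Gaussian is at least [B] there. *)
apply: intg_le (intgZ (B * expR (2 * M ^+ 2 / 8)) (intg_gauss2 R)) _ => // x.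
have [[x1 x2]|/not_andP xM] := pselect (`|x.1| <= M /\ `|x.2| <= M).
  apply: le_trans (hB x) _; rewrite -mulrA -expRD ler_peMr//; apply: le_trans (expR_ge1Dx _); rewrite lerDl.
  have M0 : 0 <= M by apply: le_trans x1.
  have h1 : x.1 ^+ 2 <= M ^+ 2 by rewrite -real_normK ?num_real// lerXn2r ?nnegrE.
  have h2 : x.2 ^+ 2 <= M ^+ 2 by rewrite -real_normK ?num_real// lerXn2r ?nnegrE.
  by rewrite /sqnorm; lra.
rewrite fM ?normr0 ?mulr_ge0 ?expR_ge0//.
by case: xM => /negP; rewrite -ltNge; [left|right].
Qed.

(** The fundamental theorem is applied on [[-N, N]] with [N > M], where [F] vanishes at both
    ends. *)
Lemma integral_derivative_0 (F f : R -> R) (M : R) : (forall t : R, is_derive t (1 : R) F (f t)) -> continuous f ->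
  (forall t, M < `|t| -> F t = 0) ->
  (\int[lebesgue_measure]_t (f t)%:E = 0)%E.
Proof.
move=> dF cf FM.
have f0 t : M < `|t| -> f t = 0.
  move=> Mt; have := derive1_out FM Mt; rewrite derive1E; have [_ ->] := dF t.
  by [].
pose N : R := `|M| + 1.
have MN : M < N by rewrite (le_lt_trans (ler_norm _))// ltrDl.
have N0 : 0 < N by rewrite ltr_wpDl.
have cF : continuous F.
  by move=> t; apply/differentiable_continuous/derivable1_diffP; case: (dF t).
transitivity (\int[lebesgue_measure]_(t in `[(- N)%R, N]) (f t)%:E)%E.
  rewrite [RHS]integral_mkcond; apply: eq_integral => t _; rewrite patchE.
  case: ifPn => //; rewrite notin_setE /= in_itv/= -ler_norml => /negP; rewrite -ltNge => Nt.
  by rewrite f0// (lt_trans MN).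
rewrite (@continuous_FTC2 _ f F).
- rewrite !FM ?subee// ?normrN gtr0_norm//.
- lra.
- exact: continuous_subspaceT.
- split; [by move=> t _; case: (dF t)|apply: cvg_at_right_filter; exact: cF|apply: cvg_at_left_filter; exact: cF].
- by move=> t _; rewrite derive1E; case: (dF t).
Qed.

Lemma slice1_continuous f (b : R) : continuous f -> continuous (fun t : R => f (t, b)).
Proof.
move=> cf t; have c : (s, b) @[s --> t] --> (t, b).
  exact: (@cvg_pair _ _ _ _ (nbhs t) (nbhs b) _ _ _ _ _ cvg_id (cvg_cst b)).
exact: (cvg_comp _ _ c (cf (t, b))).
Qed.

Lemma slice2_continuous f (a : R) : continuous f -> continuous (fun t : R => f (a, t)).
Proof.
move=> cf t; have c : (a, s) @[s --> t] --> (a, t).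
  exact: (@cvg_pair _ _ _ _ (nbhs a) (nbhs t) _ _ _ _ _ (cvg_cst a) cvg_id).
exact: (cvg_comp _ _ c (cf (a, t))).
Qed.

(** Fubini, integrating first along the direction of the derivative. *)
Lemma int_D1 f M : box_supp f M -> (forall x, derivable f x e1) -> continuous ('D_e1 f) ->
  \int[mu]_x 'D_e1 f x = 0.
Proof.
move=> fM df cf; rewrite /Rintegral.
have i : mu.-integrable setT (EFin \o 'D_e1 f).
  apply: (@box_supp_intg _ M); [exact: continuous_meas|exact: box_supp_bounded cf (box_supp_D1 fM)|exact: box_supp_D1].
rewrite -(integral21_prod_meas1 i) /fubini_G integral0_eq//= => y _.
apply: (@integral_derivative_0 (fun t => f (t, y)) _ M).
- move=> t; rewrite (derive_e1 f (t, y)); apply: derivableP.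
  exact: (derivable_e1 f (t, y)).1.
- exact: (@slice1_continuous ('D_e1 f) y cf).
- by move=> t Mt; apply: fM; left.
Qed.

Lemma int_D2 f M : box_supp f M -> (forall x, derivable f x e2) -> continuous ('D_e2 f) ->
  \int[mu]_x 'D_e2 f x = 0.
Proof.
move=> fM df cf; rewrite /Rintegral.
have i : mu.-integrable setT (EFin \o 'D_e2 f).
  apply: (@box_supp_intg _ M); [exact: continuous_meas|exact: box_supp_bounded cf (box_supp_D2 fM)|exact: box_supp_D2].
rewrite -(integral12_prod_meas1 i) /fubini_F integral0_eq//= => y _.
apply: (@integral_derivative_0 (fun t => f (y, t)) _ M).
- move=> t; rewrite (derive_e2 f (y, t)); apply: derivableP.
  exact: (derivable_e2 f (y, t)).1.
- exact: (@slice2_continuous ('D_e2 f) y cf).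
- by move=> t Mt; apply: fM; right.
Qed.

End plane_calculus.


(** * Removing cut-offs by dominated convergence *)

Section dominated_limits.
Context (R : realType).
Local Notation plane := (R * R)%type.
Local Notation mu := (leb2 R).
Local Notation mR := (measurableTypeR R).
Local Notation P := (mR * mR)%type.
Local Notation meas f := (measurable_fun [set: P] (f : P -> mR)).
Local Notation G := (@gaussG R).
Implicit Types (w f g : X R) (p q : {poly R}).

(** Pointwise convergence with a majorant that is slow in either coordinate, so that the same
    sequence can be used as the first or the second factor of a tensor product. *)
Definition dlim (a_ : nat -> R -> R) (a : R -> R) := [/\
  forall N, continuous (a_ N),
  exists alpha : R -> R, [/\ forall N t, `|a_ N t| <= alpha t,
    slow (fun x => alpha x.1) & slow (fun x => alpha x.2)] &
  forall t, a_ N t @[N --> \oo] --> a t].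

Lemma dlimD a_ b_ a b : dlim a_ a -> dlim b_ b ->
  dlim (fun N t => a_ N t + b_ N t) (fun t => a t + b t).
Proof.
move=> [ca [al [ha s1 s2]] la] [cb [be [hb r1 r2]] lb]; split.
- by move=> N t; apply: cvgD; [exact: ca|exact: cb].
- exists (fun t => al t + be t); split; [|exact: slowD|exact: slowD].
  by move=> N t; apply: le_trans (ler_normD _ _) _; exact: lerD.
- by move=> t; apply: cvgD.
Qed.

Lemma dlim_small a_ a : dlim a_ a -> dlim (fun N t => N.+1%:R^-1 * a_ N t) (fun=> 0).
Proof.
move=> [ca [al [ha s1 s2]] la]; split.
- by move=> N t; apply: cvgM; [exact: cvg_cst|exact: ca].
- exists al; split => // N t; rewrite normrM; apply: le_trans (ha N t).
  by rewrite ler_piMl// ger0_norm// invf_le1// ler1n.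
- move=> t; rewrite -[X in _ --> X](mul0r (a t)).
  by apply: cvgM => //; exact: cvg_harmonic.
Qed.

Lemma scale_mul (a b : R) : a *: b = a * b.
Proof. by []. Qed.

Lemma smooth_derive1n n (f : R -> R) : smooth f -> smooth f^`(n)%classic.
Proof. by elim: n => [//|n ih] sf; rewrite derive1nS; apply: smooth_derive; exact: ih. Qed.

Lemma bump_n_out n (x : R) : 1 < `|x| -> (@bump R)^`(n)%classic x = 0.
Proof.
elim: n x => [|n ih] x h; first by rewrite derive1n0 bump_out// ltW.
by rewrite derive1nS; apply: derive1_out h => y; exact: ih.
Qed.

(** Differentiating a cut-off stays within this family, up to factors [N.+1%:R^-1] that vanish in
    the limit. *)
Definition dcut p j (N : nat) (t : R) : R := p.[t] * (@bump R)^`(j)%classic (N.+1%:R^-1 * t + 0).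

Lemma dcut_lim p j : dlim (dcut p j) (fun t => p.[t] * (@bump R)^`(j)%classic 0).
Proof.
have sb := smooth_derive1n j (@smooth_bump R).
split.
- by move=> N; apply: smooth_cont; apply: smoothM; [exact: smooth_horner|exact: smooth_affine].
- have [B B0 hB] := cont_compact_bounded (smooth_cont sb) (@bump_n_out j).
  exists (fun t => B * `|p.[t]|); split.
  + by move=> N t; rewrite normrM mulrC ler_wpM2r.
  + apply: slowZ; have [m h] := slow_poly1 p; split; first exact: measurableT_comp.
    by move=> e e0; have [C hC] := h e e0; exists C => x; rewrite normr_id.
  + apply: slowZ; have [m h] := slow_poly2 p; split; first exact: measurableT_comp.
    by move=> e e0; have [C hC] := h e e0; exists C => x; rewrite normr_id.
- move=> t; apply: cvgM; first exact: cvg_cst.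
  apply: (cvg_comp (fun N : nat => N.+1%:R^-1 * t + 0) ((@bump R)^`(j)%classic)); last first.
    exact: (smooth_cont sb).
  have c : N.+1%:R^-1 * t + 0 @[N --> \oo] --> 0 * t + 0.
    apply: cvgD; last exact: cvg_cst.
    by apply: cvgM; [exact: cvg_harmonic|exact: cvg_cst].
  by rewrite mul0r addr0 in c.
Qed.

Lemma dcut_derive p j N :
  (dcut p j N)^`()%classic = (fun t => dcut p^`() j N t + N.+1%:R^-1 * dcut p j.+1 N t).
Proof.
have sb := smooth_derive1n j (@smooth_bump R).
apply/funext => t.
have h1 := is_derive_affine (N.+1%:R^-1) 0 t.
have h2 := smooth_is_derive (N.+1%:R^-1 * t + 0) sb.
have h3 := @is_derive1_comp R _ (fun y => N.+1%:R^-1 * y + 0) t _ _ h2 h1.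
have h4 := is_deriveM (is_derive_poly p t) h3.
rewrite derive1E; have [_ ->] := (h4 : is_derive t (1 : R) (dcut p j N) _).
by rewrite /dcut derive1nS !scale_mul /=; ring.
Qed.

Lemma cutoffE p N : cutoff p N = dcut p 0 N.
Proof. by []. Qed.

Lemma cutoff_lim p : dlim (cutoff p) (horner p).
Proof.
have := dcut_lim p 0; rewrite derive1n0 bump0.
by rewrite (_ : (fun t => _) = horner p)//; apply/funext => t; rewrite mulr1.
Qed.

Lemma cutoff_D_lim p : dlim (fun N => (cutoff p N)^`()%classic) (horner p^`()).
Proof.
have := dlimD (cutoff_lim p^`()) (dlim_small (dcut_lim p 1)).
rewrite (_ : (fun t => _ + 0) = horner p^`()); last by apply/funext => t; rewrite addr0.
rewrite (_ : (fun N t => _) = (fun N => (cutoff p N)^`()%classic))//.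
by apply/funext => N; rewrite [in RHS]cutoffE dcut_derive.
Qed.

Lemma cutoff_DD_lim p : dlim (fun N => (cutoff p N)^`()^`()%classic) (horner p^`()^`()).
Proof.
have h1 := cutoff_D_lim p^`().
have h2 := dlim_small (dlimD (dcut_lim p^`() 1) (dlim_small (dcut_lim p 2))).
have := dlimD h1 h2.
rewrite (_ : (fun t => _ + 0) = horner p^`()^`()); last by apply/funext => t; rewrite addr0.
rewrite (_ : (fun N t => _) = (fun N => (cutoff p N)^`()^`()%classic))//.
apply/funext => N; rewrite [in RHS]cutoffE dcut_derive cutoffE.
have s1 : smooth (dcut p^`() 0 N) by exact: smooth_cutoff.
have s2 : smooth (dcut p 1 N).
  apply: smoothM; first exact: smooth_horner.
  by apply: smooth_affine; apply: smooth_derive1n; exact: smooth_bump.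
apply/funext => t; rewrite [RHS]derive1E.
have h3 := is_deriveD (smooth_is_derive t s1)
  (is_deriveZ (N.+1%:R^-1) (smooth_is_derive t s2)).
have [_ hE] := h3; apply/esym; apply: (eq_trans hE).
by rewrite (dcut_derive p 1 N).
Qed.

Definition cutoff2 p q N (x : plane) : R := cutoff p N x.1 * cutoff q N x.2.

Lemma cutoff2_test p q N : test_function (cutoff2 p q N).
Proof.
apply: (@tensor_test _ _ _ N.+1%:R); try exact: smooth_cutoff.
  by move=> t h; rewrite cutoff_out// ltW.
by move=> t h; rewrite cutoff_out// ltW.
Qed.

Lemma cutoff2_D1 p q N :
  'D_(e1 R) (cutoff2 p q N) = (fun x => (cutoff p N)^`()%classic x.1 * cutoff q N x.2).
Proof. by apply: (tensor_D1 _ _).2 => t; apply: smooth_derivable; exact: smooth_cutoff. Qed.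

Lemma cutoff2_D2 p q N :
  'D_(e2 R) (cutoff2 p q N) = (fun x => cutoff p N x.1 * (cutoff q N)^`()%classic x.2).
Proof. by apply: (tensor_D2 _ _).2 => t; apply: smooth_derivable; exact: smooth_cutoff. Qed.

Lemma cutoff2_D11 p q N : 'D_(e1 R) ('D_(e1 R) (cutoff2 p q N)) =
  (fun x => (cutoff p N)^`()^`()%classic x.1 * cutoff q N x.2).
Proof.
rewrite cutoff2_D1; apply: (tensor_D1 _ _).2 => t; apply: smooth_derivable.
by apply: smooth_derive; exact: smooth_cutoff.
Qed.

Lemma cutoff2_D22 p q N : 'D_(e2 R) ('D_(e2 R) (cutoff2 p q N)) =
  (fun x => cutoff p N x.1 * (cutoff q N)^`()^`()%classic x.2).
Proof.
rewrite cutoff2_D2; apply: (tensor_D2 _ _).2 => t; apply: smooth_derivable.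
by apply: smooth_derive; exact: smooth_cutoff.
Qed.

Lemma dlim_slow a_ p b_ q N : dlim a_ (horner p) -> dlim b_ (horner q) ->
  slow (fun x => a_ N x.1 * b_ N x.2).
Proof.
move=> [ca [al [ha s1 s2]] la] [cb [be [hb r1 r2]] lb]; split.
  by apply: continuous_meas; exact: tensor_continuous.
move=> e e0; have [C hC] := (slowM s1 r2).2 e e0; exists C => x.
apply: le_trans (hC x); rewrite !normrM; apply: ler_pM => //.
  by apply: le_trans (ha N _) _; exact: ler_norm.
by apply: le_trans (hb N _) _; exact: ler_norm.
Qed.

(** The factor [h] will be 1 or a coordinate, coming from the coefficients of xi . grad and of the
    angular derivative. *)
Lemma cvg_Rint_dlim w (h : plane -> R) a_ p b_ q : slow h ->
  dlim a_ (horner p) -> dlim b_ (horner q) ->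
  \int[mu]_x (w x * (h x * (a_ N x.1 * b_ N x.2))) @[N --> \oo] -->
  \int[mu]_x (w x * (h x * (p.[x.1] * q.[x.2]))).
Proof.
move=> sh da db.
have sN N := slowM sh (dlim_slow N da db).
have [ca [al [ha s1 s2]] la] := da; have [cb [be [hb r1 r2]] lb] := db.
apply: (@Rdct _ _ _ _ _ _ (fun x => `|w x * (h x * (al x.1 * be x.2))|)).
- by move=> N; apply: measurable_funM; [exact: X_meas|exact: (sN N).1].
- by apply: measurable_funM; [exact: X_meas|exact: (slowM sh (slow_pq p q)).1].
- by apply: intg_norm; apply: intg_slow; apply: slowM => //; apply: slowM.
- move=> N x; rewrite !normrM; do 2!(apply: ler_wpM2l => //); apply: ler_pM => //.
    by apply: le_trans (ha N _) _; exact: ler_norm.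
  by apply: le_trans (hb N _) _; exact: ler_norm.
- apply: aeW => x; apply: cvgM; first exact: cvg_cst.
  by apply: cvgM; [exact: cvg_cst|apply: cvgM; [exact: la|exact: lb]].
Qed.

End dominated_limits.

(** * Polynomials times the Gaussian and Hermite functions *)

Section polynomial_gaussians.
Context (R : realType).
Local Notation plane := (R * R)%type.
Local Notation mu := (leb2 R).
Local Notation mR := (measurableTypeR R).
Local Notation P := (mR * mR)%type.
Local Notation meas f := (measurable_fun [set: P] (f : P -> mR)).
Local Notation G := (@gaussG R).
Local Notation e1 := (e1 R).
Local Notation e2 := (e2 R).
Implicit Types (w f g : X R) (p q : {poly R}).

Definition psi p q : X R := gX (slow_sg (slow_pq p q)).

Lemma psiE p q x : psi p q x = G x * (p.[x.1] * q.[x.2]).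
Proof. exact: gXE. Qed.

Lemma dotX_psi w p q : dotX w (psi p q) = \int[mu]_x (w x * (p.[x.1] * q.[x.2])).
Proof. exact: dotX_gX. Qed.

Lemma X_ext w f : (forall x, w x = f x) -> w = f.
Proof. by move=> h; apply/LfuneqP. Qed.

Lemma psiDl a p p' q : psi (a *: p + p') q = a *: psi p q + psi p' q.
Proof. by apply: X_ext => x; rewrite X_lin !psiE hornerD hornerZ; ring. Qed.

Lemma psiDr a p q q' : psi p (a *: q + q') = a *: psi p q + psi p q'.
Proof. by apply: X_ext => x; rewrite X_lin !psiE hornerD hornerZ; ring. Qed.

(* (p exp(-t^2/4))' = (gder p) exp(-t^2/4) *)
Definition gder p : {poly R} := p^`() - 2^-1 *: ('X * p).

Let g (t : R) := expR (- (t ^+ 2 / 4)).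

Let g_derive (t : R) : is_derive t (1 : R) g (- (t / 2) * g t).
Proof.
have h1 : is_derive t (1 : R) (fun t : R => - (t ^+ 2 / 4)) (- (t / 2)).
  have := is_derive_poly (- (4^-1 *: 'X^2)) t.
  rewrite (_ : horner _ = (fun t : R => - (t ^+ 2 / 4))); last first.
    by apply/funext => s; rewrite hornerN hornerZ hornerXn mulrC.
  by rewrite (_ : _.[t] = - (t / 2))// derivN derivZ derivXn hornerN hornerZ hornerMn hornerXn expr1 -mulr_natr; field.
have := @is_derive1_comp R (@expR R) _ t _ _ (is_derive_expR _) h1.
by rewrite mulrC.
Qed.

Lemma gder_derive p (t : R) : is_derive t (1 : R) (fun t : R => p.[t] * g t) ((gder p).[t] * g t).
Proof.
have := is_deriveM (is_derive_poly p t) (g_derive t).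
rewrite -[X in _ -> is_derive _ _ X _](_ : horner p * g = _) => [h|//].
apply: is_derive_eq.
by rewrite !scale_mul /gder hornerD hornerN hornerZ hornerM hornerX; ring.
Qed.

Lemma psi_tensor p q : (psi p q : plane -> R) =
  (fun x => ((4 * pi)^-1 * (p.[x.1] * g x.1)) * (q.[x.2] * g x.2)).
Proof.
apply/funext => x; rewrite psiE /gaussG /sqnorm /g.
rewrite (_ : - _ / 4 = - (x.1 ^+ 2 / 4) + - (x.2 ^+ 2 / 4)); last by field.
by rewrite expRD; ring.
Qed.

Let pg_cont p : continuous (fun t => p.[t] * g t).
Proof.
move=> t; apply/differentiable_continuous/derivable1_diffP.
by case: (gder_derive p t).
Qed.

Lemma psi_D1 p q x : is_derive (x : plane) e1 (psi p q : plane -> R) (psi (gder p) q x).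
Proof.
rewrite psi_tensor.
have d (t : R) : is_derive t 1 (fun t => (4 * pi)^-1 * (p.[t] * g t)) ((4 * pi)^-1 * ((gder p).[t] * g t)).
  exact: (is_deriveZ (4 * pi)^-1 (gder_derive p t)).
have [h1 h2] := @tensor_D1 R (fun t : R => (4 * pi)^-1 * (p.[t] * g t)) (fun t : R => q.[t] * g t) (fun t => @ex_derive _ _ _ _ _ _ _ (d t)).
apply: DeriveDef; first exact: h1.
apply: (eq_trans (congr1 (fun F => F x) h2)); rewrite /= derive1E.
by rewrite (@derive_val _ _ _ _ _ _ _ (d x.1)) psi_tensor.
Qed.

Lemma psi_D2 p q x : is_derive (x : plane) e2 (psi p q : plane -> R) (psi p (gder q) x).
Proof.
rewrite psi_tensor.
have [h1 h2] := @tensor_D2 R (fun t : R => (4 * pi)^-1 * (p.[t] * g t)) (fun t : R => q.[t] * g t)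
  (fun t => @ex_derive _ _ _ _ _ _ _ (gder_derive q t)).
apply: DeriveDef; first exact: h1.
apply: (eq_trans (congr1 (fun F => F x) h2)); rewrite /= derive1E.
by rewrite (@derive_val _ _ _ _ _ _ _ (gder_derive q x.2)) psi_tensor.
Qed.

Lemma psi_cont p q : continuous (psi p q : plane -> R).
Proof.
rewrite psi_tensor; apply: (tensor_continuous (u := fun t => (4 * pi)^-1 * (p.[t] * g t))
  (v := fun t => q.[t] * g t)); last exact: pg_cont.
by move=> t; apply: cvgM; [exact: cvg_cst|exact: pg_cont].
Qed.

Lemma ibp_psi1 phi p q : test_function phi ->
  \int[mu]_x (psi p q x * 'D_e1 phi x) = - \int[mu]_x (psi (gder p) q x * phi x).
Proof.
move=> tphi; have [M hM] := test_supp tphi.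
have [dphi tD] := test_D1 tphi.
have DE x : is_derive x e1 ((psi p q : plane -> R) * phi)
    (psi p q x * 'D_e1 phi x + psi (gder p) q x * phi x).
  have := is_deriveM (psi_D1 p q x) (derivableP (dphi x)).
  by move=> h; apply: is_derive_eq; rewrite -[_ *: _]/(_ * _) -[X in _ + X]/(_ * _); ring.
have E : 'D_e1 ((psi p q : plane -> R) * phi) =
    (fun x => psi p q x * 'D_e1 phi x + psi (gder p) q x * phi x).
  by apply/funext => x; case: (DE x).
have := @int_D1 R ((psi p q : plane -> R) * phi) M.
rewrite E RintD; [|exact: intg_slow (test_slow tD)|exact: intg_slow (test_slow tphi)].
move=> /(_ _ _ _)/eqP; rewrite addr_eq0 => h; apply/eqP; apply: h.
- by move=> x h; rewrite -[LHS]/(_ * _) hM ?mulr0.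
- by move=> x; case: (DE x).
- move=> x; apply: cvgD; apply: cvgM; [exact: psi_cont|exact: (test_cont tD)|exact: psi_cont|exact: (test_cont tphi)].
Qed.

Lemma ibp_psi2 phi p q : test_function phi ->
  \int[mu]_x (psi p q x * 'D_e2 phi x) = - \int[mu]_x (psi p (gder q) x * phi x).
Proof.
move=> tphi; have [M hM] := test_supp tphi.
have [dphi tD] := test_D2 tphi.
have DE x : is_derive x e2 ((psi p q : plane -> R) * phi)
    (psi p q x * 'D_e2 phi x + psi p (gder q) x * phi x).
  have := is_deriveM (psi_D2 p q x) (derivableP (dphi x)).
  by move=> h; apply: is_derive_eq; rewrite -[_ *: _]/(_ * _) -[X in _ + X]/(_ * _); ring.
have E : 'D_e2 ((psi p q : plane -> R) * phi) =
    (fun x => psi p q x * 'D_e2 phi x + psi p (gder q) x * phi x).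
  by apply/funext => x; case: (DE x).
have := @int_D2 R ((psi p q : plane -> R) * phi) M.
rewrite E RintD; [|exact: intg_slow (test_slow tD)|exact: intg_slow (test_slow tphi)].
move=> /(_ _ _ _)/eqP; rewrite addr_eq0 => h; apply/eqP; apply: h.
- by move=> x h; rewrite -[LHS]/(_ * _) hM ?mulr0.
- by move=> x; case: (DE x).
- move=> x; apply: cvgD; apply: cvgM; [exact: psi_cont|exact: (test_cont tD)|exact: psi_cont|exact: (test_cont tphi)].
Qed.

Lemma cvg_dlim w a_ p b_ q : dlim a_ (horner p) -> dlim b_ (horner q) ->
  \int[mu]_x (w x * (a_ N x.1 * b_ N x.2)) @[N --> \oo] --> dotX w (psi p q).
Proof.
move=> da db; have := cvg_Rint_dlim (w := w) (slow_cst (1 : R)) da db.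
rewrite dotX_psi; under eq_fun do under eq_Rintegral do rewrite mul1r.
by under [X in _ --> X]eq_Rintegral do rewrite mul1r.
Qed.

(** Cut-offs of [p] and [q] multiply to test functions, and both sides pass to the limit. With [w]
    itself of the form [psi p0 q0] this gives the adjoint of [gder]. *)
Lemma weak_D1_poly w f : (forall phi, test_function phi ->
    \int[mu]_x (w x * 'D_e1 phi x) = - \int[mu]_x (f x * phi x)) ->
  forall p q, dotX w (psi p^`() q) = - dotX f (psi p q).
Proof.
move=> h p q.
have c1 := cvg_dlim (w := w) (cutoff_D_lim p) (cutoff_lim q).
have c2 : (- \int[mu]_x (f x * (cutoff p N x.1 * cutoff q N x.2))) @[N --> \oo] --> - dotX f (psi p q).
  by apply: cvgN; exact: cvg_dlim (cutoff_lim p) (cutoff_lim q).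
rewrite -(cvg_lim _ c1)// -(cvg_lim _ c2)//; congr (limn _); apply/funext => N.
apply: (eq_trans _ (h _ (cutoff2_test p q N))); apply: eq_Rintegral => x _; congr (_ * _).
exact/esym/(congr1 (fun F => F x) (cutoff2_D1 p q N)).
Qed.

Lemma weak_D2_poly w f : (forall phi, test_function phi ->
    \int[mu]_x (w x * 'D_e2 phi x) = - \int[mu]_x (f x * phi x)) ->
  forall p q, dotX w (psi p q^`()) = - dotX f (psi p q).
Proof.
move=> h p q.
have c1 := cvg_dlim (w := w) (cutoff_lim p) (cutoff_D_lim q).
have c2 : (- \int[mu]_x (f x * (cutoff p N x.1 * cutoff q N x.2))) @[N --> \oo] --> - dotX f (psi p q).
  by apply: cvgN; exact: cvg_dlim (cutoff_lim p) (cutoff_lim q).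
rewrite -(cvg_lim _ c1)// -(cvg_lim _ c2)//; congr (limn _); apply/funext => N.
apply: (eq_trans _ (h _ (cutoff2_test p q N))); apply: eq_Rintegral => x _; congr (_ * _).
exact/esym/(congr1 (fun F => F x) (cutoff2_D2 p q N)).
Qed.

Lemma dot_psi_gder1 p0 q0 p q : dotX (psi (gder p0) q0) (psi p q) = - dotX (psi p0 q0) (psi p^`() q).
Proof. by rewrite (weak_D1_poly (fun phi => @ibp_psi1 phi p0 q0)) opprK. Qed.

Lemma dot_psi_gder2 p0 q0 p q : dotX (psi p0 (gder q0)) (psi p q) = - dotX (psi p0 q0) (psi p q^`()).
Proof. by rewrite (weak_D2_poly (fun phi => @ibp_psi2 phi p0 q0)) opprK. Qed.

(** The m-th derivative of exp(-t^2/4) is [hermite m] times exp(-t^2/4): a rescaled Hermite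
    polynomial, with leading coefficient (-1/2)^m. *)
Definition hermite m : {poly R} := iter m gder 1.

Lemma gderZ a p : gder (a *: p) = a *: gder p.
Proof. by rewrite /gder derivZ scalerBr -scalerAr !scalerA mulrC. Qed.

(** The commutator of differentiation with [gder] is -1/2; each of the [m.+1] factors [gder]
    contributes once. *)
Lemma hermite_deriv m : (hermite m.+1)^`() = - (m.+1%:R / 2) *: hermite m.
Proof.
have gd p : (gder p)^`() = gder p^`() - 2^-1 *: p.
  by rewrite /gder derivB derivZ derivM derivX mul1r scalerDr opprD addrA addrAC -addrA.
elim: m => [|m ih].
  by rewrite /hermite /= gd derivC /gder derivC mulr0 scaler0 subr0 add0r -scaleNr mul1r.
rewrite {1}/hermite iterS -/(hermite m.+1) gd ih gderZ -[gder (hermite m)]/(hermite m.+1).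
rewrite -scalerBl; congr (_ *: _); rewrite -[m.+2%:R]natr1; by field.
Qed.

Lemma mulX_hermite m : 'X * hermite m = 2 *: ((hermite m)^`() - hermite m.+1).
Proof.
rewrite {3}/hermite iterS -/(hermite m) /gder opprB addrCA subrr addr0 scalerA.
by rewrite divff ?scale1r.
Qed.

(** The left-hand side is [gder] of the derivative: the index is lowered, then raised. *)
Lemma hermite_eigen m : (hermite m)^`()^`() - 2^-1 *: ('X * (hermite m)^`()) = - (m%:R / 2) *: hermite m.
Proof.
case: m => [|m]; first by rewrite /hermite /= derivC mulr0 scaler0 subr0 mul0r oppr0 scale0r derivC.
by rewrite -/(gder _) hermite_deriv gderZ.
Qed.

Definition hpsi (m n : nat) : X R := psi (hermite m) (hermite n).

Let psi0l q : psi 0 q = 0.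
Proof. by apply: X_ext => x; rewrite psiE horner0 mul0r mulr0. Qed.

Let psi0r p : psi p 0 = 0.
Proof. by apply: X_ext => x; rewrite psiE horner0 !mulr0. Qed.

Lemma psiZl a p q : psi (a *: p) q = a *: psi p q.
Proof. by rewrite -[a *: p]addr0 psiDl psi0l addr0. Qed.

Lemma psiZr a p q : psi p (a *: q) = a *: psi p q.
Proof. by rewrite -[a *: q]addr0 psiDr psi0r addr0. Qed.

Lemma dot_hpsiS1 m n k l :
  dotX (hpsi m.+1 n) (hpsi k.+1 l) = k.+1%:R / 2 * dotX (hpsi m n) (hpsi k l).
Proof.
rewrite /hpsi {1}/hermite iterS -/(hermite m) dot_psi_gder1 hermite_deriv psiZl.
by rewrite (sdotZr (@dotXC R) (@dotXL R)); ring.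
Qed.

Lemma dot_hpsiS2 m n k l :
  dotX (hpsi m n.+1) (hpsi k l.+1) = l.+1%:R / 2 * dotX (hpsi m n) (hpsi k l).
Proof.
rewrite /hpsi {2}/hermite iterS -/(hermite n) dot_psi_gder2 hermite_deriv psiZr.
by rewrite (sdotZr (@dotXC R) (@dotXL R)); ring.
Qed.

Lemma dot_hpsi01 m n l : dotX (hpsi m.+1 n) (hpsi 0 l) = 0.
Proof.
rewrite /hpsi {1}/hermite iterS -/(hermite m) dot_psi_gder1 derivC psi0l.
by rewrite (sdot0r (@dotXC R) (@dotXL R)) oppr0.
Qed.

Lemma dot_hpsi02 m n k : dotX (hpsi m n.+1) (hpsi k 0) = 0.
Proof.
rewrite /hpsi {2}/hermite iterS -/(hermite n) dot_psi_gder2 derivC psi0r.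
by rewrite (sdot0r (@dotXC R) (@dotXL R)) oppr0.
Qed.

Definition hnorm2 (m n : nat) : R := (m`!)%:R * (n`!)%:R / 2 ^+ (m + n) * dotX (hpsi 0 0) (hpsi 0 0).

Lemma hnorm2S m n : hnorm2 m.+1 n = m.+1%:R / 2 * hnorm2 m n.
Proof. by rewrite /hnorm2 addSn factS natrM exprS; field. Qed.

Lemma hnorm2Sr m n : hnorm2 m n.+1 = n.+1%:R / 2 * hnorm2 m n.
Proof. by rewrite /hnorm2 addnS factS natrM exprS; field. Qed.

(** Moving one [gder] across the inner product lowers an index on each side; when one side reaches 0
    first, a constant is differentiated. *)
Lemma dot_hpsi m n k l : dotX (hpsi m n) (hpsi k l) = ((m == k) && (n == l))%:R * hnorm2 m n.
Proof.
elim: m k n l => [|m ih] [|k] n l.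
- elim: n l => [|n ih] [|l].
  + by rewrite /hnorm2 addn0 fact0 expr0 invr1 /= !mul1r.
  + by rewrite dotXC dot_hpsi02 mul0r.
  + by rewrite dot_hpsi02 mul0r.
  + rewrite dot_hpsiS2 ih eqSS /=; have [->|_] := eqVneq n l; last by rewrite !mul0r mulr0.
    by rewrite /= !mul1r hnorm2Sr.
- by rewrite dotXC dot_hpsi01 mul0r.
- by rewrite dot_hpsi01 mul0r.
- rewrite dot_hpsiS1 ih eqSS; have [/andP[/eqP -> /eqP ->]|_] := boolP ((m == k) && (n == l)).
    by rewrite /= !mul1r hnorm2S.
  by rewrite !mul0r mulr0.
Qed.

Lemma hnorm2_gt0 m n : 0 < hnorm2 m n.
Proof.
rewrite !mulr_gt0 ?invr_gt0 ?exprn_gt0 ?ltr0n ?fact_gt0//.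
(* [G] vanishes nowhere, so if [hpsi 0 0] were null the whole plane would be negligible, against the
   measure of the unit square. *)
rewrite lt_neqAle dotX_ge0 andbT eq_sym; apply/eqP => /dotX_eq0 [N [mN N0 hN]].
have : N = setT.
  apply/seteqP; split=> // x _; apply: hN => /= /eqP.
  by rewrite psiE /hermite /= !hornerC !mulr1 gt_eqF// gaussG_gt0.
move=> NT; move: N0; rewrite NT => mu0.
pose B : set P := `[0, 1]%classic `*` `[0, 1]%classic.
have mB : measurable B by apply: measurableX; exact: measurable_itv.
have : (mu B <= mu setT)%E by apply: le_measure; rewrite ?inE.
have -> : mu B = (@lebesgue_measure R `[0%R, 1%R]%classic * @lebesgue_measure R `[0%R, 1%R]%classic)%E.
  by apply: product_measure1E; exact: measurable_itv.
rewrite mu0 lebesgue_measure_itv/= lte_fin ltr01 oppr0 adde0 mule1.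
by rewrite lee_fin ler10.
Qed.

End polynomial_gaussians.


(** * Elementary limits used for totality *)

Section sequences_of_reals.
Context (R : realType).

Lemma expR_series_cvg (x : R) : series (exp_coeff x) n @[n --> \oo] --> expR x.
Proof. exact: is_cvg_series_exp_coeff. Qed.

Lemma expR_series_le (x : R) n : `|series (exp_coeff x) n| <= expR `|x|.
Proof.
apply: (@le_trans _ _ (series (exp_coeff `|x|) n)).
  apply: le_trans (ler_norm_sum _ _ _) _; apply: ler_sum => i _.
  by rewrite /exp_coeff /= normrM normrX normfV normr_nat.
have c := @expR_series_cvg `|x|; rewrite -(cvg_lim _ c)//.
apply: nondecreasing_cvgn_le; last by apply/cvg_ex; exists (expR `|x|).
by move=> i j ij; rewrite /series /= [leRHS](big_cat_nat _ ij)//= lerDl sumr_ge0// => k _; rewrite exp_coeff_ge0.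
Qed.

Lemma bernoulli_ineq (x : R) N : 0 <= x <= 1 -> 1 - N%:R * x <= (1 - x) ^+ N.
Proof.
move=> /andP[x0 x1]; elim: N => [|N ih]; first by rewrite mul0r subr0 expr0.
rewrite exprS -natr1; have h : 0 <= 1 - x by lra.
have := ler_wpM2l h ih; have : 0 <= N%:R * x * x by rewrite !mulr_ge0.
nra.
Qed.

Lemma natmul_exp_cvg0 (r : R) : 0 <= r < 1 -> n%:R * r ^+ n @[n --> \oo] --> (0 : R).
Proof.
move=> /andP[r0 r1].
have [->|rn0] := eqVneq r 0.
  apply: cvg_near_cst; apply: nearW => n.
  by rewrite expr0n; case: n => [|n] /=; rewrite ?(mul0r, mulr0).
have rp : 0 < r by rewrite lt_neqAle eq_sym rn0.
have [a aE] := expR_total rp.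
have a0 : a < 0 by rewrite -expR_lt1 aE.
(* With [r = expR a], the quadratic term of the exponential bounds [n * r ^+ n] by
   [2 / (a ^+ 2 * n)], and [1 / n <= 2 / n.+1]. *)
apply: (@sqz0 _ _ (fun n => 2 / a ^+ 2 * n.+1%:R^-1 + 2 / a ^+ 2 * n.+1%:R^-1)); last first.
  rewrite -[X in _ --> X](_ : 2 / a ^+ 2 * 0 + 2 / a ^+ 2 * 0 = 0); last by rewrite mulr0 addr0.
  by apply: cvgD; apply: cvgM; try exact: cvg_cst; exact: cvg_harmonic.
move=> n; rewrite mulr_ge0 ?exprn_ge0//= -mulrDr -aE -expRM_natl.
have an : a != 0 by rewrite lt_eqF.
have [->|n0] := posnP n.
  by rewrite mul0r mulr_ge0// ?divr_ge0// ?sqr_ge0// addr_ge0.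
have np : 0 < n%:R :> R by rewrite ltr0n.
have h : (n%:R * a) ^+ 2 / 2 <= expR (- (n%:R * a)).
  have x0 : 0 <= - (n%:R * a) by rewrite -mulrN mulr_ge0// oppr_ge0 ltW.
  have := expR_ge1Dxn 1 x0; rewrite sqrrN (_ : 2`!%:R = 2 :> R)//; lra.
rewrite -[n%:R * a]opprK expRN.
apply: (@le_trans _ _ (n%:R * ((n%:R * a) ^+ 2 / 2)^-1)).
  rewrite ler_wpM2l// lef_pV2// ?posrE ?expR_gt0//.
  by rewrite divr_gt0// exprn_even_gt0//= mulf_neq0// gt_eqF.
rewrite (_ : n%:R * _ = 2 / a ^+ 2 * n%:R^-1); last by field; rewrite an gt_eqF.
rewrite ler_wpM2l ?divr_ge0 ?sqr_ge0//.
rewrite -[leRHS]mulr2n -[leRHS]mulr_natl -[leRHS]invrK invfM invrK lef_pV2 ?posrE//.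
  rewrite mulrC ler_pdivrMr// -natr1; have : 1 <= n%:R :> R by rewrite ler1n.
  lra.
Qed.

(* The powers separate [t < 1/2] from [t >= 1/2]. *)
Definition sep (t : R) n : R := (1 - t ^+ n) ^+ (n * 2 ^ n).

Lemma sep_bound t n : 0 <= t <= 1 -> 0 <= sep t n <= 1.
Proof.
move=> /andP[t0 t1]; have h0 : 0 <= 1 - t ^+ n by rewrite subr_ge0 exprn_ile1.
by rewrite exprn_ge0//= exprn_ile1// lerBlDr lerDl exprn_ge0.
Qed.

(** Below 1/2, Bernoulli's inequality bounds [sep t n] from below by [1 - n * (2 t)^n]. From 1/2 on,
    [1 - t^n <= expR (- 2^-n)], and the exponent [n * 2^n] gives at most [expR (- n)]. *)
Lemma sep_cvg t : 0 <= t <= 1 -> sep t n @[n --> \oo] --> (if t < 1 / 2 then 1 else 0 : R).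
Proof.
move=> t01; have /andP[t0 t1] := t01; case: ifPn => [th|].
  apply: (@squeeze_cvgr _ _ _ _ (fun n => 1 - n%:R * (2 * t) ^+ n) (fun=> 1)).
  - apply: nearW => n; have /andP[_ ->] := sep_bound n t01; rewrite andbT.
    rewrite (_ : n%:R * (2 * t) ^+ n = (n * 2 ^ n)%:R * t ^+ n).
      by apply: bernoulli_ineq; rewrite exprn_ge0//= exprn_ile1.
    by rewrite natrM natrX exprMn mulrA.
  - rewrite -[X in _ --> X](_ : 1 - 0 = 1); last by rewrite subr0.
    by apply: cvgB; [exact: cvg_cst|apply: natmul_exp_cvg0; lra].
  - exact: cvg_cst.
rewrite -leNgt => th.
apply: (@sqz0 _ _ (fun n => (expR (-1)) ^+ n)); last first.
  by apply: cvg_expr; rewrite gtr0_norm ?expR_gt0// expR_lt1.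
move=> n; have /andP[-> _] /= := sep_bound n t01.
apply: (@le_trans _ _ ((expR (- (2 ^+ n)^-1)) ^+ (n * 2 ^ n))).
  apply: lerXn2r; rewrite ?nnegrE ?expR_ge0//.
    by rewrite subr_ge0 exprn_ile1.
  apply: (@le_trans _ _ (1 - (2 ^+ n)^-1)); last exact: expR_ge1Dx.
  by rewrite lerB// -exprVn lerXn2r// ?nnegrE; lra.
by rewrite -!expRM_natl ler_expR natrM natrX mulrN mulfK ?mulrN1// expf_neq0.
Qed.

End sequences_of_reals.

(** * Totality of the polynomials times the Gaussian *)

Section totality.
Context (R : realType).
Local Notation plane := (R * R)%type.
Local Notation mu := (leb2 R).
Local Notation mR := (measurableTypeR R).
Local Notation P := (mR * mR)%type.
Local Notation meas f := (measurable_fun [set: P] (f : P -> mR)).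
Local Notation G := (@gaussG R).
Implicit Types (w f g : X R) (p q : {poly R}) (k m : plane -> R).

Definition bounded_meas k := meas k /\ exists B, forall x, `|k x| <= B.

Lemma bounded_slow k : bounded_meas k -> slow k.
Proof. by move=> [mk [B hB]]; exact: slow_bounded hB. Qed.

Lemma bounded_cst (c : R) : bounded_meas (fun=> c).
Proof. by split => //; exists `|c|. Qed.

Lemma boundedM k m : bounded_meas k -> bounded_meas m -> bounded_meas (fun x => k x * m x).
Proof.
move=> [mk [B hB]] [mm [C hC]]; split; first exact: measurable_funM.
by exists (B * C) => x; rewrite normrM ler_pM.
Qed.

Lemma boundedD k m : bounded_meas k -> bounded_meas m -> bounded_meas (fun x => k x + m x).
Proof.
move=> [mk [B hB]] [mm [C hC]]; split; first exact: measurable_funD.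
by exists (B + C) => x; apply: le_trans (ler_normD _ _) _; exact: lerD.
Qed.

(** The rate 1/32 is used for [k], and 1/64 + 1/32 <= 1/16. This product will dominate power series
    of Gaussians of rate at most 1/64. *)
Lemma sg_exp k : slow k -> sg (fun x => expR (sqnorm x / 64) * k x).
Proof.
move=> [mk h]; split.
  apply: measurable_funM => //; apply: measurableT_comp => //.
  by apply: measurable_funM => //; exact: meas_sqnorm.
have [|C hC] := h (1 / 32); first by rewrite divr_gt0.
exists C => x; rewrite normrM gtr0_norm ?expR_gt0//.
apply: (@le_trans _ _ (expR (sqnorm x / 64) * (C * expR (1 / 32 * sqnorm x)))).
  by rewrite ler_wpM2l ?expR_ge0.
rewrite mulrCA -expRD ler_wpM2l//.
  by have := le_trans (normr_ge0 _) (hC 0); rewrite pmulr_lge0// expR_gt0.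
by rewrite ler_expR; have := sqnorm_ge0 x; lra.
Qed.

(* Dominated convergence for the power series of [expR (- y)]. *)
Lemma exp_series_lim w k h (y : plane -> R) : bounded_meas k -> slow h -> meas y ->
  (forall x, 0 <= y x <= sqnorm x / 64) ->
  \int[mu]_x (w x * (k x * series (exp_coeff (- y x)) n * h x)) @[n --> \oo] -->
  \int[mu]_x (w x * (k x * expR (- y x) * h x)).
Proof.
move=> [mk [B hB]] sh my hy.
have ms n : meas (fun x => series (exp_coeff (- y x)) n).
  rewrite /series /=; apply: measurable_sum => i; rewrite /exp_coeff /=.
  by apply: measurable_funM => //; apply: measurable_funX; exact: measurableT_comp.
apply: (@Rdct _ _ _ _ _ _ (fun x => `|B| * `|w x * (expR (sqnorm x / 64) * h x)|)).
- move=> n; apply: measurable_funM; first exact: X_meas.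
  apply: measurable_funM; last exact: sh.1.
  exact: (measurable_funM mk (ms n)).
- apply: measurable_funM; first exact: X_meas.
  apply: measurable_funM; last exact: sh.1.
  by apply: measurable_funM => //; apply: measurableT_comp => //; exact: measurableT_comp.
- by apply: intgZ; apply: intg_norm; apply: intg_sg; exact: sg_exp.
- move=> n x; rewrite !normrM [leRHS]mulrCA ler_wpM2l//.
  rewrite mulrA ler_wpM2r//; apply: ler_pM => //.
    by apply: le_trans (hB x) _; exact: ler_norm.
  apply: le_trans (expR_series_le _ _) _.
  rewrite normrN gtr0_norm ?expR_gt0// ler_expR.
  by have /andP[y0 yx] := hy x; rewrite ger0_norm.
- apply: aeW => x; apply: cvgM; first exact: cvg_cst.
  apply: cvgM; last exact: cvg_cst.
  by apply: cvgM; [exact: cvg_cst|exact: expR_series_cvg].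
Qed.

Context (w : X R) (w0 : forall p q, dotX w (psi p q) = 0).

(** [K] collects the bounded [k] for which [w k] is still orthogonal to polynomials. Its multipliers
    [M] form an algebra, which need not be clear for [K] itself; as 1 is in [K], they also belong to
    [K]. *)
Let K k := bounded_meas k /\ forall p q, \int[mu]_x (w x * (k x * (p.[x.1] * q.[x.2]))) = 0.
Let M m := bounded_meas m /\ forall k, K k -> K (fun x => k x * m x).

Let co (b : bool) (x : plane) := if b then x.1 else x.2.

Let meas_co b : meas (co b).
Proof. by case: b; [exact: measurable_fst|exact: measurable_snd]. Qed.

Let co_le b x : co b x ^+ 2 <= sqnorm x.
Proof. by case: b; rewrite /co /sqnorm; [rewrite lerDl sqr_ge0|rewrite lerDr sqr_ge0]. Qed.

Let Kint k p q : K k -> intg mu (fun x => w x * (k x * (p.[x.1] * q.[x.2]))).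
Proof. by move=> [bk _]; apply: intg_slow; apply: slowM; [exact: bounded_slow|exact: slow_pq]. Qed.

Let K1 : K (fun=> 1).
Proof.
split=> [|p q]; first exact: bounded_cst.
by under eq_Rintegral do rewrite mul1r; rewrite -dotX_psi.
Qed.

Let K_poly k (b : bool) (r : {poly R}) p q : K k ->
  \int[mu]_x (w x * (k x * r.[co b x] * (p.[x.1] * q.[x.2]))) = 0.
Proof.
move=> [_ Kk]; case: b.
  rewrite -[RHS](Kk (r * p) q); apply: eq_Rintegral => x _.
  by rewrite hornerM /co; ring.
rewrite -[RHS](Kk p (r * q)); apply: eq_Rintegral => x _.
by rewrite hornerM /co; ring.
Qed.

Let E b x := expR (- (co b x ^+ 2 / 64)).

Let E_meas b : meas (E b).
Proof.
apply: measurableT_comp => //; apply: measurableT_comp => //.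
apply: measurable_funM => //; apply: measurable_funX; exact: (@meas_co b).
Qed.

Let E_le1 b x : 0 < E b x <= 1.
Proof.
rewrite expR_gt0/= -[leRHS]expR0 ler_expR oppr_le0.
by rewrite divr_ge0 ?sqr_ge0.
Qed.

(** The partial sums of the power series of [E b] are polynomials, which are absorbed into [p] or
    [q]; dominated convergence reaches [E b]. *)
Let ME_poly b (r : {poly R}) : (exists B, forall x, `|r.[co b x] * E b x| <= B) ->
  M (fun x => r.[co b x] * E b x).
Proof.
move=> hB.
have mr : meas (fun x => r.[co b x] * E b x).
  apply: measurable_funM; last exact: E_meas.
  by case: (b); [exact: (slow_poly1 r).1|exact: (slow_poly2 r).1].
split=> // k Kk; split=> [|p q]; first by apply: boundedM => //; exact: Kk.1.
have sh : slow (fun x => r.[co b x] * (p.[x.1] * q.[x.2])).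
  apply: slowM; last exact: slow_pq.
  by case: (b); [exact: slow_poly1|exact: slow_poly2].
have my : meas (fun x => co b x ^+ 2 / 64).
  apply: measurable_funM => //; apply: measurable_funX; exact: (@meas_co b).
have := exp_series_lim (w := w) Kk.1 sh my.
move=> /(_ _)/cvg_lim h; rewrite -[RHS](_ : limn (fun=> 0) = 0); last exact: lim_cst.
transitivity (\int[mu]_x (w x * (k x * expR (- (co b x ^+ 2 / 64)) * (r.[co b x] * (p.[x.1] * q.[x.2]))))).
  by apply: eq_Rintegral => x _; rewrite /E; ring.
rewrite -h//; last first.
  move=> x; rewrite divr_ge0 ?sqr_ge0//= ler_wpM2r ?invr_ge0 ?co_le//.
congr (limn _); apply/funext => n.
pose S : {poly R} := \sum_(0 <= i < n) ((- 64^-1) ^+ i / i`!%:R) *: 'X^2 ^+ i.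
rewrite -[RHS](@K_poly k b (S * r) p q Kk); apply: eq_Rintegral => x _.
rewrite hornerM (_ : S.[co b x] = series (exp_coeff (- (co b x ^+ 2 / 64))) n); first by ring.
rewrite /S horner_sum; apply: eq_bigr => i _.
by rewrite hornerZ !horner_exp hornerX /exp_coeff /= -mulrN !exprMn [LHS]mulrAC [X in X / _ = _]mulrC.
Qed.

Let M_cst (c : R) : M (fun=> c).
Proof.
split=> [|k Kk]; first exact: bounded_cst.
split=> [|p q]; first by apply: boundedM; [exact: Kk.1|exact: bounded_cst].
transitivity (\int[mu]_x (c * (w x * (k x * (p.[x.1] * q.[x.2]))))).
  by apply: eq_Rintegral => x _; ring.
by rewrite RintZ ?Kk.2 ?mulr0//; exact: Kint.
Qed.

Let MD m1 m2 : M m1 -> M m2 -> M (fun x => m1 x + m2 x).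
Proof.
move=> [b1 h1] [b2 h2]; split=> [|k Kk]; first exact: boundedD.
split=> [|p q]; first by apply: boundedM; [exact: Kk.1|exact: boundedD].
have k1 := h1 _ Kk; have k2 := h2 _ Kk.
transitivity (\int[mu]_x (w x * (k x * m1 x * (p.[x.1] * q.[x.2])) + w x * (k x * m2 x * (p.[x.1] * q.[x.2])))).
  by apply: eq_Rintegral => x _; ring.
by rewrite RintD ?k1.2 ?k2.2 ?addr0//; exact: Kint.
Qed.

Let MM m1 m2 : M m1 -> M m2 -> M (fun x => m1 x * m2 x).
Proof.
move=> [b1 h1] [b2 h2]; split=> [|k Kk]; first exact: boundedM.
have := h2 _ (h1 _ Kk).
by rewrite (_ : (fun x => _) = (fun x => k x * (m1 x * m2 x)))//; apply/funext => x; rewrite mulrA.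
Qed.

Let MX m n : M m -> M (fun x => m x ^+ n).
Proof.
move=> Mm; elim: n => [|n ih]; first exact: M_cst.
rewrite (_ : (fun x => _) = (fun x => m x * m x ^+ n)); first exact: MM.
by apply/funext => x; rewrite exprS.
Qed.

Let MB m : M m -> M (fun x => 1 - m x).
Proof.
move=> Mm; apply: MD; first exact: M_cst.
rewrite (_ : (fun x => _) = (fun x => (-1) * m x)); first by apply: MM => //; exact: M_cst.
by apply/funext => x; rewrite mulN1r.
Qed.

(** Closure under bounded pointwise limits, by dominated convergence, is what leads from smooth
    multipliers to indicators. *)
Let M_lim (m_ : nat -> plane -> R) m (B : R) : (forall n, M (m_ n)) -> meas m ->
  (forall n x, `|m_ n x| <= B) -> (forall x, m_ n x @[n --> \oo] --> m x) -> M m.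
Proof.
move=> Mm mm mB mc.
have mB' x : `|m x| <= B.
  have c : `|m_ n x| @[n --> \oo] --> `|m x| by apply: cvg_norm; exact: mc.
  rewrite -(cvg_lim _ c)//.
  by apply: limr_le; [apply/cvg_ex; eexists; exact: c|exact: nearW].
have bm : bounded_meas m by split => //; exists B.
split=> // k Kk; split=> [|p q]; first by apply: boundedM => //; exact: Kk.1.
have [mk [C hC]] := Kk.1.
have : \int[mu]_x (w x * (k x * m_ n x * (p.[x.1] * q.[x.2]))) @[n --> \oo] -->
    \int[mu]_x (w x * (k x * m x * (p.[x.1] * q.[x.2]))).
  apply: (@Rdct _ _ _ _ _ _ (fun x => B * `|w x * (k x * (p.[x.1] * q.[x.2]))|)).
  - move=> n; have bn := boundedM Kk.1 (Mm n).1.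
    by apply: intg_meas; apply: intg_slow; apply: slowM; [exact: bounded_slow|exact: slow_pq].
  - have bn := boundedM Kk.1 bm.
    by apply: intg_meas; apply: intg_slow; apply: slowM; [exact: bounded_slow|exact: slow_pq].
  - by apply: intgZ; apply: intg_norm; exact: Kint.
  - move=> n x; rewrite (_ : w x * _ = m_ n x * (w x * (k x * (p.[x.1] * q.[x.2])))); last by ring.
    by rewrite normrM ler_wpM2r.
  - apply: aeW => x; apply: cvgM; first exact: cvg_cst.
    apply: cvgM; last exact: cvg_cst.
    by apply: cvgM; [exact: cvg_cst|exact: mc].
move=> /(@cvg_lim _ _) <- //.
rewrite (_ : (fun n => _) = fun=> 0); first exact: lim_cst.
by apply/funext => n; exact: ((Mm n).2 _ Kk).2.
Qed.

Let bounded_tE (c : R) : exists2 B : R, 0 < B & forall b x, `|(co b x - c) * E b x| <= B.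
Proof.
(* [1 + 64] is the constant of [le_expsq] at the rate 1/64 of [E]. *)
exists (1 + 64 + `|c|) => [|b x]; first by rewrite ltr_pwDl// addr_gt0.
have /andP[E0 E1] := E_le1 b x.
rewrite normrM (gtr0_norm E0).
apply: (@le_trans _ _ ((`|co b x| + `|c|) * E b x)).
  by rewrite ler_wpM2r ?(ltW E0)//; exact: ler_normB.
rewrite mulrDl lerD//; last by rewrite ler_piMr.
have e0 : 0 < 64^-1 :> R by rewrite invr_gt0.
have := le_expsq (co b x) e0; rewrite invrK /E expRN => h.
by rewrite ler_pdivrMr ?expR_gt0// [_ / 64]mulrC.
Qed.

(** [(t - c) * E] is a bounded multiplier with the sign of [t - c]. Rescaled to take values in
    [[0, 1]], with 1/2 exactly at [t = c], it is sharpened by [sep] into the indicator. *)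
Let M_half b (c : R) : M (\1_[set x | co b x < c]).
Proof.
have [B B0 hB] := bounded_tE c.
pose m x := 1 / 2 + (2 * B)^-1 * (('X - c%:P).[co b x] * E b x).
have Mm : M m.
  apply: MD; first exact: M_cst.
  apply: MM; first exact: M_cst.
  by apply: ME_poly; exists B => x; rewrite hornerD hornerN hornerX hornerC; exact: hB.
have mE x : m x = 1 / 2 + (2 * B)^-1 * ((co b x - c) * E b x).
  by rewrite /m hornerD hornerN hornerX hornerC.
have m01 x : 0 <= m x <= 1.
  have := hB b x; rewrite ler_norml => /andP[h1 h2].
  have B2 : 0 < 2 * B by rewrite mulr_gt0.
  have h3 : (2 * B)^-1 * ((co b x - c) * E b x) <= 1 / 2.
    by rewrite mulrC ler_pdivrMr//; lra.
  have h4 : - (1 / 2) <= (2 * B)^-1 * ((co b x - c) * E b x).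
    by rewrite lerNl -mulrN mulrC ler_pdivrMr//; lra.
  by rewrite mE; apply/andP; split; lra.
apply: (@M_lim (fun n x => sep (m x) n) _ 1).
- by move=> n; apply: MX; apply: MB; exact: MX.
- apply: measurable_indic.
  rewrite (_ : [set x | _] = co b @^-1` `]-oo, c[%classic); last first.
    by apply/seteqP; split => x /=; rewrite in_itv.
  by rewrite -[X in measurable X]setTI; apply: meas_co => //; exact: measurable_itv.
- by move=> n x; have /andP[h1 h2] := sep_bound n (m01 x); rewrite ger0_norm.
- move=> x; have := sep_cvg (m01 x).
  rewrite indicE (_ : (x \in _) = (m x < 1 / 2)).
    by case: ifP.
  have /andP[E0 _] := E_le1 b x.
  rewrite mE gtrDl pmulr_rlt0 ?invr_gt0 ?mulr_gt0// pmulr_llt0// subr_lt0.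
  by apply/idP/idP; rewrite inE.
Qed.

(** The indicator of a union is the limit of [1 - \prod (1 - \1_(F i))]. Products are available in
    [M], so sets with multiplier indicators form a sigma-algebra at once, without a monotone class
    argument. *)
Let M_indic_bigcup (F : nat -> set P) : (forall n, measurable (F n)) ->
  (forall n, M (\1_(F n))) -> M (\1_(\bigcup_n F n)).
Proof.
move=> mF MF.
pose m n (x : plane) : R := 1 - \prod_(i < n) (1 - \1_(F i) x).
have p01 n (x : plane) : 0 <= \prod_(i < n) (1 - \1_(F i) x : R) <= 1.
  apply/andP; split; [apply: prodr_ge0|apply: prodr_ile1] => i _; rewrite indicE; case: (_ \in _); rewrite ?subrr ?subr0 ?lexx ?ler01 //.
apply: (@M_lim m _ 1).
- move=> n; apply: MB.
  elim: n => [|n ih].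
    by rewrite (_ : (fun x => _) = fun=> 1); [exact: M_cst|apply/funext => x; rewrite big_ord0].
  rewrite (_ : (fun x => _) = (fun x => (\prod_(i < n) (1 - \1_(F i) x)) * (1 - \1_(F n) x))).
    by apply: MM => //; exact: MB.
  by apply/funext => x; rewrite big_ord_recr.
- by apply: measurable_indic; exact: bigcup_measurable.
- by move=> n x; have := p01 n x; rewrite /m => /andP[h1 h2]; rewrite ger0_norm; lra.
- move=> x; have [[k _ Fk]|nF] := pselect ((\bigcup_n F n) x).
    apply: (@cvg_near_cst); exists k.+1 => // n /= kn.
    rewrite /m (bigD1 (Ordinal kn))//= !indicE !mem_set//; last by exists k.
    by rewrite subrr mul0r subr0.
  apply: cvg_near_cst; apply: nearW => n.
  rewrite /m indicE memNset// big1 ?subrr// => i _.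
  by rewrite indicE memNset ?subr0// => Fi; apply: nF; exists i.
Qed.

Let M_indicC (A : set P) : M (\1_A) -> M (\1_(~` A)).
Proof.
move=> /MB; rewrite (_ : (fun x => _) = \1_(~` A))//.
by apply/funext => x; rewrite !indicE in_setC; case: (_ \in _); rewrite ?subrr ?subr0.
Qed.

Let M_indic0 : M (\1_(set0 : set P)).
Proof. by rewrite indic0; exact: M_cst. Qed.

Let M_slice b (B : set mR) : measurable B -> M (\1_(co b @^-1` B)).
Proof.
pose S : set (set mR) := [set B | measurable B /\ M (\1_(co b @^-1` B))].
suff : @measurable _ mR `<=` S by move=> h /h[].
rewrite -[X in X `<=` _]/((R.-ocitv).-measurable.-sigma.-measurable) (RGenInftyO.measurableE R).
apply: smallest_sub.
  split.
  - by split=> //; rewrite preimage_set0; exact: M_indic0.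
  - move=> A [mA MA]; split; first exact: measurableD.
    by rewrite setTD preimage_setC; exact: M_indicC.
  - move=> F FS; split; first by apply: bigcup_measurable => n _; exact: (FS n).1.
    rewrite preimage_bigcup; apply: M_indic_bigcup => n; last exact: (FS n).2.
    by rewrite -[X in measurable X]setTI; apply: meas_co => //; exact: (FS n).1.
move=> _ [c ->]; split; first exact: measurable_itv.
rewrite (_ : co b @^-1` _ = [set x | co b x < c]); first exact: M_half.
by apply/seteqP; split => x /=; rewrite in_itv.
Qed.

Let M_indic (A : set P) : measurable A -> M (\1_A).
Proof.
pose S : set (set P) := [set A | measurable A /\ M (\1_A)].
suff : @measurable _ P `<=` S by move=> h /h[].
apply: smallest_sub.
  split.
  - by split=> //; exact: M_indic0.
  - move=> A' [mA MA]; split; first exact: measurableD.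
    by rewrite setTD; exact: M_indicC.
  - move=> F FS; split; first by apply: bigcup_measurable => n _; exact: (FS n).1.
    by apply: M_indic_bigcup => n; case: (FS n).
move=> A' [] [B mB <-]; rewrite setTI; split.
- by rewrite -[X in measurable X]setTI; apply: (meas_co true).
- exact: (@M_slice true).
- by rewrite -[X in measurable X]setTI; apply: (meas_co false).
- exact: (@M_slice false).
Qed.

(** Testing against the indicators of [w > 0] and of [w < 0], with constant polynomials, shows that
    both parts of [w] have integral 0. *)
Lemma psi_total : dotX w w = 0.
Proof.
have int0 (A : set P) : measurable A -> \int[mu]_x (w x * \1_A x) = 0.
  move=> mA; have [_ h] := M_indic mA; have [_ /(_ 1 1)] := h _ K1.
  by under eq_Rintegral do rewrite mul1r !hornerC !mulr1.
have bi (A : set P) : measurable A -> bounded_meas (\1_A).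
  by move=> mA; have [] := M_indic mA.
have mw := X_meas w.
have mpos : measurable [set x : P | 0 < w x].
  rewrite (_ : [set x : P | _] = setT `&` w @^-1` `]0, +oo[%classic); first by apply: mw => //; exact: measurable_itv.
  by apply/seteqP; split => x /=; rewrite in_itv/= andbT; tauto.
have mneg : measurable [set x : P | w x < 0].
  rewrite (_ : [set x : P | _] = setT `&` w @^-1` `]-oo, 0[%classic); first by apply: mw => //; exact: measurable_itv.
  by apply/seteqP; split => x /=; rewrite in_itv/=; tauto.
apply/dotX_eq0.
have a1 := Rint_eq0_ae (intg_slow w (bounded_slow (bi _ mpos))).
have a2 := Rint_eq0_ae (intgN (intg_slow w (bounded_slow (bi _ mneg)))).
have {a1} : {ae mu, forall x : P, w x * \1_[set x : P | 0 < w x] x = 0}.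
  apply: a1; last exact: int0.
  by move=> x; rewrite indicE; case: (boolP (x \in _)); rewrite ?mulr1 ?mulr0// inE => /ltW.
have {a2} : {ae mu, forall x : P, - (w x * \1_[set x : P | w x < 0] x) = 0}.
  apply: a2; last by rewrite RintN ?int0 ?oppr0//; exact: (intg_slow w (bounded_slow (bi _ mneg))).
  by move=> x; rewrite indicE; case: (boolP (x \in _)); rewrite ?mulr1 ?mulr0 ?oppr0 ?oppr_ge0// inE => /ltW.
apply: filterS2 => x; rewrite !indicE.
have [x0|x0|//] := ltrgtP (w x) 0.
  by rewrite (@mem_set _ [set x : P | w x < 0])// mulr1 => /eqP; rewrite oppr_eq0 => /eqP.
by rewrite (@mem_set _ [set x : P | 0 < w x])// mulr1.
Qed.

End totality.


(** * The Hermite basis *)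

Section hermite_basis.
Context (R : realType).
Local Notation plane := (R * R)%type.
Local Notation mu := (leb2 R).
Local Notation e1 := (e1 R).
Local Notation e2 := (e2 R).
Local Notation I := (nat * nat)%type.
Implicit Types (w f g : X R) (phi : plane -> R).

Definition lvl (p : I) : nat := (p.1 + p.2)%N.

(** Whole levels are listed one after another, so that partial sums never split a level; the
    skewness of the rotation depends on this. *)
Fixpoint pairs (M : nat) : seq I :=
  if M is N.+1 then pairs N ++ [seq (i, N - i)%N | i <- iota 0 N.+1] else [::].

Lemma mem_pairs M p : (p \in pairs M) = (lvl p < M)%N.
Proof.
elim: M => [|N ih] //; rewrite -[pairs _]/(pairs N ++ [seq (i, N - i)%N | i <- iota 0 N.+1]).
rewrite mem_cat ih ltnS [RHS]leq_eqVlt orbC; congr (_ || _).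
apply/mapP/eqP => [ip | <-].
  by case: ip => i; rewrite mem_iota /= add0n ltnS => iN ->; rewrite /lvl /= subnKC.
exists p.1; first by rewrite mem_iota /= add0n ltnS leq_addr.
by rewrite /lvl addKn -surjective_pairing.
Qed.

Lemma uniq_pairs M : uniq (pairs M).
Proof.
elim: M => [|N ih] //; rewrite -[pairs _]/(pairs N ++ [seq (i, N - i)%N | i <- iota 0 N.+1]).
rewrite cat_uniq ih map_inj_uniq ?iota_uniq ?andbT; last by move=> i j [].
rewrite andTb.
apply/hasPn => j jm; have := mapP jm; case => i; rewrite mem_iota add0n ltnS => /andP[_ iN] ->.
by rewrite mem_pairs /lvl /= subnKC// ltnn.
Qed.

Definition hp (p : I) : X R := hpsi R p.1 p.2.
Definition hn (p : I) : R := hnorm2 R p.1 p.2.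

Lemma hn_gt0 p : 0 < hn p.
Proof. exact: hnorm2_gt0. Qed.

Lemma dot_hp p q : dotX (hp p) (hp q) = (p == q)%:R * hn p.
Proof. by case: p q => m n [k l]; exact: dot_hpsi. Qed.

Definition basis (p : I) : X R := (Num.sqrt (hn p))^-1 *: hp p.

Let dotC := @dotXC R.
Let dotL := @dotXL R.
Let dot0 := @dotX_ge0 R.

Lemma basis_on p q : dotX (basis p) (basis q) = (p == q)%:R.
Proof.
rewrite (sdotZl dotL) (sdotZr dotC dotL) dot_hp; have [->|_] := eqVneq p q; last by rewrite mul0r !mulr0.
rewrite mul1r -{3}(sqr_sqrtr (ltW (hn_gt0 q))) mulrA -expr2 -exprMn mulVf ?expr1n// sqrtr_eq0 -ltNge.
exact: hn_gt0.
Qed.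

(** Instead of expanding [p], the claim is strengthened to [F (p * hermite m) = 0] for all [m]; the
    recurrence for ['X * hermite m] then carries the induction on [p]. *)
Lemma hermite_functional (F : {poly R} -> R) :
  (forall a p q, F (a *: p + q) = a * F p + F q) -> (forall m, F (hermite R m) = 0) ->
  forall p, F p = 0.
Proof.
move=> Fl F0 p; suff h : forall m, F (p * hermite R m) = 0 by rewrite -[p]mulr1; exact: (h 0%N).
have FD a b : F (a + b) = F a + F b by rewrite -[a in LHS]scale1r Fl mul1r.
have F00 : F 0 = 0 by have := FD 0 0; rewrite addr0 => /eqP; rewrite -subr_eq0 opprD addrA subrr sub0r oppr_eq0 => /eqP.
have FZ a b : F (a *: b) = a * F b by rewrite -[a *: b]addr0 Fl F00 addr0.
elim/poly_ind: p => [|p c ih] m; first by rewrite mul0r.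
rewrite mulrDl mul_polyC FD FZ F0 mulr0 addr0 -mulrA mulX_hermite -scalerAr FZ.
rewrite -scaleN1r mulrDr -scalerAr FD FZ ih mulr0 addr0.
case: m => [|m]; first by rewrite derivC mulr0 F00 mulr0.
by rewrite hermite_deriv -scalerAr FZ ih !mulr0.
Qed.

Lemma basis_total w : (forall p, dotX w (basis p) = 0) -> dotX w w = 0.
Proof.
move=> h; have {}h p : dotX w (hp p) = 0.
  have := h p; rewrite (sdotZr dotC dotL) => /eqP; rewrite mulf_eq0 invr_eq0 sqrtr_eq0 leNgt hn_gt0 /=.
  by move=> /eqP.
apply: psi_total => p q.
apply: (@hermite_functional (fun p => dotX w (psi p q))) => [a p1 p2|m].
  by rewrite psiDl (sdotDr dotC dotL) (sdotZr dotC dotL).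
apply: (@hermite_functional (fun q => dotX w (psi (hermite R m) q))) => [a p1 p2|n].
  by rewrite psiDr (sdotDr dotC dotL) (sdotZr dotC dotL).
exact: (h (m, n)).
Qed.

Lemma basis_cvg_psum w : cvgH (@dotX R) (psum (@dotX R) pairs basis w) w.
Proof. exact: (cvg_psum dotC dotL dot0 uniq_pairs mem_pairs (@X_complete R) basis_on basis_total). Qed.

Lemma dot_eq_basis u v u' v' :
  (forall p, dotX u (basis p) * dotX v (basis p) = dotX u' (basis p) * dotX v' (basis p)) ->
  dotX u v = dotX u' v'.
Proof.
exact: (@dot_eq _ _ _ dotC dotL dot0 _ _ _ uniq_pairs mem_pairs (@X_complete R) _ basis_on basis_total).
Qed.

Lemma bessel_basis w M : \sum_(p <- pairs M) dotX w (basis p) ^+ 2 <= dotX w w.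
Proof. exact: (bessel dotC dotL dot0 uniq_pairs mem_pairs basis_on). Qed.

Lemma coef_basis w p : dotX w (basis p) = (Num.sqrt (hn p))^-1 * dotX w (hp p).
Proof. exact: (sdotZr dotC dotL). Qed.

End hermite_basis.

(** * The operator L in the Hermite basis *)

Section operator_L.
Context (R : realType).
Local Notation plane := (R * R)%type.
Local Notation mu := (leb2 R).
Local Notation e1 := (e1 R).
Local Notation e2 := (e2 R).
Local Notation I := (nat * nat)%type.
Implicit Types (w f g : X R) (phi : plane -> R) (p q : {poly R}).

Let dotC := @dotXC R.
Let dotL := @dotXL R.
Let dot0 := @dotX_ge0 R.

Lemma derive_mulx1 phi : test_function phi ->
  'D_e1 ((fst \o id) \* phi) = (fun x : plane => phi x + x.1 * 'D_e1 phi x).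
Proof.
move=> t; have [d _] := test_D1 t; apply/funext => x.
have d1 := (derivable_e1 phi x).1 (d x).
have i1 : is_derive x.1 (1 : R) (fun t : R => phi (t, x.2)) ('D_e1 phi x).
  by rewrite derive_e1; exact: DeriveDef.
have i2 := is_deriveM (is_derive_id x.1 (1 : R)) i1.
rewrite derive_e1; have -> : (fun t : R => ((fst \o id) \* phi) (t, x.2)) = (id * (fun t : R => phi (t, x.2))) by [].
rewrite (@derive_val _ _ _ _ _ _ _ i2) /= -[phi (x.1, x.2)]/((fun y => phi y) (x.1, x.2)) -surjective_pairing.
by rewrite !scale_mul mulr1 addrC.
Qed.

Lemma derive_mulx2 phi : test_function phi ->
  'D_e2 ((snd \o id) \* phi) = (fun x : plane => phi x + x.2 * 'D_e2 phi x).
Proof.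
move=> t; have [d _] := test_D2 t; apply/funext => x.
have d1 := (derivable_e2 phi x).1 (d x).
have i1 : is_derive x.2 (1 : R) (fun t : R => phi (x.1, t)) ('D_e2 phi x).
  by rewrite derive_e2; exact: DeriveDef.
have i2 := is_deriveM (is_derive_id x.2 (1 : R)) i1.
rewrite derive_e2; have -> : (fun t : R => ((snd \o id) \* phi) (x.1, t)) = (id * (fun t : R => phi (x.1, t))) by [].
rewrite (@derive_val _ _ _ _ _ _ _ i2) /= -[phi (x.1, x.2)]/((fun y => phi y) (x.1, x.2)) -surjective_pairing.
by rewrite !scale_mul mulr1 addrC.
Qed.

Lemma test_D11 phi : test_function phi -> test_function ('D_e1 ('D_e1 phi)).
Proof. by move=> /test_D1[_ /test_D1[]]. Qed.

Lemma test_D22 phi : test_function phi -> test_function ('D_e2 ('D_e2 phi)).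
Proof. by move=> /test_D2[_ /test_D2[]]. Qed.

Lemma slow_x1D phi : test_function phi -> slow (fun x : plane => x.1 * 'D_e1 phi x).
Proof. by move=> /test_D1[_ t]; apply: slowM; [exact: slow_fst|exact: test_slow]. Qed.

Lemma slow_x2D phi : test_function phi -> slow (fun x : plane => x.2 * 'D_e2 phi x).
Proof. by move=> /test_D2[_ t]; apply: slowM; [exact: slow_snd|exact: test_slow]. Qed.

Lemma laplacianE w phi : distr_laplacian (distr w) phi =
  \int[mu]_x (w x * 'D_e1 ('D_e1 phi) x) + \int[mu]_x (w x * 'D_e2 ('D_e2 phi) x).
Proof. exact: (congr2 +%R (opprK _) (opprK _)). Qed.

Lemma transport_idE w phi : test_function phi -> distr_transport id (distr w) phi =
  - (2 * distr w phi + \int[mu]_x (w x * (x.1 * 'D_e1 phi x)) +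
     \int[mu]_x (w x * (x.2 * 'D_e2 phi x))).
Proof.
move=> t; rewrite /distr_transport /= /distr_mul /distr_D.
rewrite derive_mulx1// derive_mulx2// /distr.
have -> : \int[mu]_x (w x * (phi x + x.1 * 'D_e1 phi x)) =
    \int[mu]_x (w x * phi x) + \int[mu]_x (w x * (x.1 * 'D_e1 phi x)).
  rewrite -RintD; [|exact: intg_slow (test_slow t)|exact: intg_slow (slow_x1D t)].
  by apply: eq_Rintegral => x _; rewrite mulrDr.
have -> : \int[mu]_x (w x * (phi x + x.2 * 'D_e2 phi x)) =
    \int[mu]_x (w x * phi x) + \int[mu]_x (w x * (x.2 * 'D_e2 phi x)).
  rewrite -RintD; [|exact: intg_slow (test_slow t)|exact: intg_slow (slow_x2D t)].
  by apply: eq_Rintegral => x _; rewrite mulrDr.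
have aux (a b c : R) : - (a + b) - (a + c) = - (2 * a + b + c) by ring.
exact: aux.
Qed.

Definition distrL w phi := distr_laplacian (distr w) phi +
  2^-1 * distr_transport id (distr w) phi + distr w phi.

(** The divergence of xi is 2, and half of it cancels the constant 1 in L: the formal transpose is
    the Laplacian minus half of xi . grad. *)
Lemma distrLE w phi : test_function phi -> distrL w phi =
  \int[mu]_x (w x * 'D_e1 ('D_e1 phi) x) + \int[mu]_x (w x * 'D_e2 ('D_e2 phi) x)
  - 2^-1 * (\int[mu]_x (w x * (x.1 * 'D_e1 phi x)) + \int[mu]_x (w x * (x.2 * 'D_e2 phi x))).
Proof.
have aux (a b c d e : R) : a + b + 2^-1 * (- (2 * e + c + d)) + e = a + b - 2^-1 * (c + d) by field.
by move=> t; rewrite /distrL laplacianE transport_idE//; exact: aux.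
Qed.

Lemma dot_psiBl w p p' q :
  dotX w (psi (p - 2^-1 *: p') q) = dotX w (psi p q) - 2^-1 * dotX w (psi p' q).
Proof. by rewrite -scaleNr addrC psiDl (sdotDr dotC dotL) (sdotZr dotC dotL) addrC mulNr. Qed.

Lemma dot_psiBr w p q q' :
  dotX w (psi p (q - 2^-1 *: q')) = dotX w (psi p q) - 2^-1 * dotX w (psi p q').
Proof. by rewrite -scaleNr addrC psiDr (sdotDr dotC dotL) (sdotZr dotC dotL) addrC mulNr. Qed.

Lemma cvg_comb (a b c d : nat -> R) (A B C D : R) :
  a n @[n --> \oo] --> A -> b n @[n --> \oo] --> B ->
  c n @[n --> \oo] --> C -> d n @[n --> \oo] --> D ->
  (a n + b n - 2^-1 * (c n + d n)) @[n --> \oo] --> A + B - 2^-1 * (C + D).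
Proof.
move=> ha hb hc hd; apply: cvgB; first exact: cvgD.
by apply: cvgM; [exact: cvg_cst|exact: cvgD].
Qed.

Lemma distrL_poly w f p q : represents f (distrL w) ->
  dotX f (psi p q) = dotX w (psi (p^`()^`() - 2^-1 *: ('X * p^`())) q) +
    dotX w (psi p (q^`()^`() - 2^-1 *: ('X * q^`()))).
Proof.
move=> rf.
have c0 := cvg_dlim (w := f) (cutoff_lim p) (cutoff_lim q).
have c11 := cvg_dlim (w := w) (cutoff_DD_lim p) (cutoff_lim q).
have c22 := cvg_dlim (w := w) (cutoff_lim p) (cutoff_DD_lim q).
have c1 := cvg_Rint_dlim (w := w) (slow_fst R) (cutoff_D_lim p) (cutoff_lim q).
have c2 := cvg_Rint_dlim (w := w) (slow_snd R) (cutoff_lim p) (cutoff_D_lim q).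
have h := cvg_lim (@Rhausdorff R) (cvg_comb c11 c22 c1 c2).
rewrite -(cvg_lim (@Rhausdorff R) c0).
transitivity (dotX w (psi p^`()^`() q) + dotX w (psi p q^`()^`()) -
  2^-1 * (dotX w (psi ('X * p^`()) q) + dotX w (psi p ('X * q^`())))); last first.
  rewrite dot_psiBl dot_psiBr.
  have aux (a b c d : R) : a + b - 2^-1 * (c + d) = a - 2^-1 * c + (b - 2^-1 * d) by field.
  exact: aux.
have -> : dotX w (psi ('X * p^`()) q) = \int[mu]_x (w x * (x.1 * ((p^`()).[x.1] * q.[x.2]))).
  by rewrite dotX_psi; apply: eq_Rintegral => x _; rewrite hornerM hornerX -(mulrA x.1).
have -> : dotX w (psi p ('X * q^`())) = \int[mu]_x (w x * (x.2 * (p.[x.1] * (q^`()).[x.2]))).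
  by rewrite dotX_psi; apply: eq_Rintegral => x _; rewrite hornerM hornerX; congr (_ * _); ring.
rewrite -h//; congr (limn _); apply/funext => N.
apply: (eq_trans (rf _ (cutoff2_test p q N))); rewrite distrLE; last exact: cutoff2_test.
congr (_ + _ - _ * (_ + _)); apply: eq_Rintegral => x _; congr (_ * _).
- exact: (congr1 (fun F => F x) (cutoff2_D11 p q N)).
- exact: (congr1 (fun F => F x) (cutoff2_D22 p q N)).
- by congr (_ * _); exact: (congr1 (fun F => F x) (cutoff2_D1 p q N)).
- by congr (_ * _); exact: (congr1 (fun F => F x) (cutoff2_D2 p q N)).
Qed.

Lemma distrL_hp w f (p : I) : represents f (distrL w) ->
  dotX f (hp R p) = - ((lvl p)%:R / 2) * dotX w (hp R p).
Proof.
move=> rf; rewrite /hp /hpsi (distrL_poly _ _ rf) !hermite_eigen psiZl psiZr.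
by rewrite !(sdotZr dotC dotL) /lvl natrD; field.
Qed.

Lemma ibp_D11 phi p q : test_function phi ->
  \int[mu]_x (psi p q x * 'D_e1 ('D_e1 phi) x) = \int[mu]_x (psi (gder (gder p)) q x * phi x).
Proof. by move=> t; rewrite ibp_psi1 ?ibp_psi1 ?opprK//; case: (test_D1 t). Qed.

Lemma ibp_D22 phi p q : test_function phi ->
  \int[mu]_x (psi p q x * 'D_e2 ('D_e2 phi) x) = \int[mu]_x (psi p (gder (gder q)) x * phi x).
Proof. by move=> t; rewrite ibp_psi2 ?ibp_psi2 ?opprK//; case: (test_D2 t). Qed.

Lemma distr_slow_lin a u v k : slow k ->
  distr (a *: u + v : X R) k = a * distr (u : X R) k + distr (v : X R) k.
Proof.
move=> sk; rewrite /distr.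
have iu := intg_slow u sk; have iv := intg_slow v sk.
rewrite -(RintZ a iu) -(RintD (intgZ a iu) iv).
by apply: eq_Rintegral => x _; rewrite X_lin mulrDl mulrA.
Qed.

Lemma distr_lin a u v phi : test_function phi ->
  distr (a *: u + v : X R) phi = a * distr (u : X R) phi + distr (v : X R) phi.
Proof. by move=> /test_slow; exact: distr_slow_lin. Qed.

Lemma distr_addr w (h k : plane -> R) : slow h -> slow k ->
  distr w (fun x => h x + k x) = distr w h + distr w k.
Proof.
move=> sh sk; rewrite /distr -(RintD (intg_slow w sh) (intg_slow w sk)).
by apply: eq_Rintegral => x _; rewrite mulrDr.
Qed.

Lemma distr_scaler w a (k : plane -> R) : slow k ->
  distr w (fun x => a * k x) = a * distr w k.
Proof.
move=> sk; rewrite /distr -(RintZ a (intg_slow w sk)).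
by apply: eq_Rintegral => x _; rewrite mulrCA.
Qed.

Lemma distr0 phi : distr (0 : X R) phi = 0.
Proof.
rewrite /distr; under eq_Rintegral do rewrite mul0r.
by rewrite /Rintegral integral0.
Qed.

Lemma distr_scale a u phi : test_function phi ->
  distr (a *: u : X R) phi = a * distr (u : X R) phi.
Proof. by move=> t; rewrite -[a *: u]addr0 distr_lin// distr0 addr0. Qed.

Lemma distrL_psi p q phi : test_function phi ->
  distrL (psi p q) phi = distr (psi (gder p^`()) q) phi + distr (psi p (gder q^`())) phi.
Proof.
move=> t.
have h1 : \int[mu]_x (psi p q x * (x.1 * 'D_e1 phi x)) = - distr (psi (gder ('X * p)) q) phi.
  rewrite -[RHS](ibp_psi1 _ _ t); apply: eq_Rintegral => x _.
  by rewrite !psiE hornerM hornerX; ring.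
have h2 : \int[mu]_x (psi p q x * (x.2 * 'D_e2 phi x)) = - distr (psi p (gder ('X * q))) phi.
  rewrite -[RHS](ibp_psi2 _ _ t); apply: eq_Rintegral => x _.
  by rewrite !psiE hornerM hornerX; ring.
(* [gder] is applied to [r' = gder r + 'X * r / 2]. *)
have gE r : gder r^`() = 2^-1 *: gder ('X * r) + gder (gder r).
  rewrite -[r^`() in LHS](subrK (2^-1 *: ('X * r))) -/(gder r) {1}/gder derivD derivZ mulrDr scalerDr.
  by rewrite -scalerAr opprD addrACA -/(gder _) addrC [in RHS]/gder scalerBr !scalerA.
rewrite !gE psiDl psiDr !distr_lin//.
have aux (a b c d A B C D : R) : C = c -> D = d -> A = - a -> B = - b ->
  C + D - 2^-1 * (A + B) = 2^-1 * a + c + (2^-1 * b + d) by move=> -> -> -> ->; field.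
apply: etrans (distrLE _ t) _.
exact: aux (ibp_D11 p q t) (ibp_D22 p q t) h1 h2.
Qed.

Lemma distrL_basis (p : I) phi : test_function phi ->
  distrL (hp R p) phi = - ((lvl p)%:R / 2) * distr (hp R p) phi.
Proof.
move=> t; rewrite distrL_psi// /lvl natrD.
have h m : gder (hermite R m)^`() = - (m%:R / 2) *: hermite R m.
  case: m => [|m]; last by rewrite hermite_deriv gderZ.
  by rewrite derivC /gder derivC mulr0 scaler0 subr0 mul0r oppr0 scale0r.
rewrite !h psiZl psiZr !distr_scale//.
have aux (a b c : R) : - (a / 2) * c + - (b / 2) * c = - ((a + b) / 2) * c by field.
exact: aux.
Qed.

(** For a fixed test function both sides are inner products with elements of X, so Parseval reduces
    the claim to the basis functions, where L is computed by parts. *)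
Lemma coef_L w f : (forall p : I, dotX f (basis R p) = - ((lvl p)%:R / 2) * dotX w (basis R p)) ->
  represents f (distrL w).
Proof.
move=> h phi t; have st := test_slow t.
(* [k] is the transpose of L applied to [phi]. *)
have [k [sk kE]] : exists k, slow k /\ forall u, distrL u phi = \int[mu]_x (u x * k x).
  exists (fun x => 'D_e1 ('D_e1 phi) x + 'D_e2 ('D_e2 phi) x +
    (- 2^-1) * (x.1 * 'D_e1 phi x + x.2 * 'D_e2 phi x)).
  have s11 := test_slow (test_D11 t); have s22 := test_slow (test_D22 t).
  have s1 := slow_x1D t; have s2 := slow_x2D t.
  split; first by apply: slowD; [exact: slowD|apply: slowZ; exact: slowD].
  move=> u; rewrite distrLE//.
  have E1 : distr u (fun x => 'D_e1 ('D_e1 phi) x + 'D_e2 ('D_e2 phi) x) =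
      distr u ('D_e1 ('D_e1 phi)) + distr u ('D_e2 ('D_e2 phi)) by exact: distr_addr.
  have E2 : distr u (fun x => x.1 * 'D_e1 phi x + x.2 * 'D_e2 phi x) =
    distr u (fun x => x.1 * 'D_e1 phi x) + distr u (fun x => x.2 * 'D_e2 phi x) by exact: distr_addr.
  have E3 := distr_scaler u (- 2^-1) (slowD s1 s2).
  have E4 := distr_addr u (slowD s11 s22) (slowZ (- 2^-1) (slowD s1 s2)).
  have aux (a b c A : R) : A = b + c -> a + - 2^-1 * A = a - 2^-1 * (b + c) by move=> ->; rewrite mulNr.
  apply/esym; apply: (eq_trans E4); rewrite E1 E3.
  exact: aux E2.
rewrite kE /distr -(dotX_gX f (slow_sg st)) -(dotX_gX w (slow_sg sk)).
apply: dot_eq_basis => p.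
have -> : dotX (gX (slow_sg st)) (basis R p) = (Num.sqrt (hn R p))^-1 * distr (hp R p) phi.
  by rewrite dotC (sdotZl dotL) dotX_gX.
have -> : dotX (gX (slow_sg sk)) (basis R p) = (Num.sqrt (hn R p))^-1 * distrL (hp R p) phi.
  by rewrite dotC (sdotZl dotL) dotX_gX kE.
rewrite h distrL_basis//.
have aux (a b c d : R) : a * b * (c * d) = b * (c * (a * d)) by ring.
exact: aux.
Qed.

(** The left-hand side is the growth of the squared norm when an index is raised by two, that is,
    under a second derivative. *)
Lemma lvl_bound (m n : nat) : m.+2%:R / 2 * (m.+1%:R / 2) <= (m + n).+2%:R ^+ 2 :> R.
Proof.
have E k : k.+1%:R = k%:R + 1 :> R by rewrite natr1.
rewrite (E m.+1) (E m) (E (m + n).+1) (E (m + n)%N) natrD.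
have := ler0n R m; have := ler0n R n; move: (m%:R : R) (n%:R : R) => a b; nra.
Qed.

(* The second derivatives of the Hermite expansion of w are again orthogonal
   expansions, and converge because their weights grow like those of Lw. *)
Lemma weak_second_derivative w f (shift : I -> I) (D : (plane -> R) -> plane -> R) :
  (forall p : I, dotX f (basis R p) = - ((lvl p)%:R / 2) * dotX w (basis R p)) ->
  injective shift -> (forall p : I, hn R (shift p) <= ((lvl p).+2%:R) ^+ 2 * hn R p) ->
  (forall phi, test_function phi -> slow (D phi)) ->
  (forall phi (p : I), test_function phi -> distr (hp R p) (D phi) = distr (hp R (shift p)) phi) ->
  exists v : X R, forall phi, test_function phi -> distr w (D phi) = distr v phi.
Proof.
move=> fw sI hs sD ibp.
pose y (p : I) := (dotX w (basis R p) * (Num.sqrt (hn R p))^-1) *: hp R (shift p).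
have yy (p q : I) : dotX (y p) (y q) = (p == q)%:R * (dotX w (basis R p) ^+ 2 * (hn R p)^-1 * hn R (shift p)).
  rewrite /y (sdotZl dotL) [X in _ * X = _](sdotZr dotC dotL) dot_hp (inj_eq sI).
  have [->|_] := eqVneq p q; last by rewrite !mul0r !mulr0.
  have aux (a s h k : R) : s ^+ 2 = k -> a / s * (a / s * (true%:R * h)) = true%:R * (a ^+ 2 / k * h).
    by move=> <-; rewrite !mul1r -exprVn !expr2 !mulrA; congr (_ * _); rewrite -!mulrA; congr (_ * _); rewrite mulrCA.
  by apply: aux; rewrite sqr_sqrtr// ltW// hn_gt0.
have [v hv] : exists v, cvgH (@dotX R) (fun M => \sum_(p <- pairs M) y p) v.
  (* With [l] the level, [(l + 2)^2 <= 8 * (l / 2)^2 + 8], the difference being [(l - 2)^2]. *)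
  apply: (orthogonal_series dotC dotL dot0 uniq_pairs mem_pairs (@X_complete R) (B := 8 * dotX f f + 8 * dotX w w)).
    by move=> p q pq; rewrite yy (negbTE pq) mul0r.
  move=> M; have bf := bessel_basis f M; have bw := bessel_basis w M.
  apply: (@le_trans _ _ (8 * (\sum_(p <- pairs M) dotX f (basis R p) ^+ 2) +
    8 * (\sum_(p <- pairs M) dotX w (basis R p) ^+ 2))); last by apply: lerD; rewrite ler_wpM2l.
  rewrite !mulr_sumr -big_split /=; apply: ler_sum => p _.
  rewrite yy eqxx mul1r fw; set a := dotX w _.
  apply: (@le_trans _ _ (a ^+ 2 * ((lvl p).+2%:R) ^+ 2)).
    by rewrite -mulrA ler_wpM2l ?sqr_ge0// mulrC ler_pdivrMr ?hn_gt0.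
  rewrite -[_.+2%:R]natr1 -natr1; set l : R := (lvl p)%:R.
  have : 0 <= a ^+ 2 * (l - 2) ^+ 2 by rewrite mulr_ge0 ?sqr_ge0.
  by rewrite !exprMn; nra.
exists v => phi t; have st := test_slow t; have sk := sD _ t.
rewrite /distr -(dotX_gX w (slow_sg sk)) -(dotX_gX v (slow_sg st)).
have c1 := @cvgH_dotl _ _ _ dotC dotL dot0 _ _ (gX (slow_sg sk)) (basis_cvg_psum w).
have c2 := @cvgH_dotl _ _ _ dotC dotL dot0 _ _ (gX (slow_sg st)) hv.
rewrite -(cvg_lim (@Rhausdorff R) c1) -(cvg_lim (@Rhausdorff R) c2).
congr (limn _); apply/funext => M; rewrite /psum !(sdot_suml dotL).
apply: eq_bigr => p _; rewrite !(sdotZl dotL) !dotX_gX -mulrA; congr (_ * (_ * _)).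
exact: ibp.
Qed.

(** The forward direction tests Lw on cut-off Hermite polynomials. In the converse the real content
    is the domain: both pure second derivatives are summed in X, as twofold differentiation of a
    basis function raises one index by two. *)
Lemma graph_LP w f : graph_L w f <->
  forall p : I, dotX f (basis R p) = - ((lvl p)%:R / 2) * dotX w (basis R p).
Proof.
split=> [[_ rf] p|fw].
  by rewrite !coef_basis (distrL_hp p rf) mulrCA.
have rf := coef_L fw; split=> //.
have [v1 h1] : exists v : X R, forall phi, test_function phi -> distr w ('D_e1 ('D_e1 phi)) = distr v phi.
  apply: (@weak_second_derivative w f (fun p : I => (p.1.+2, p.2)) (fun phi => 'D_e1 ('D_e1 phi)) fw).
  - by move=> [m n] [k l] /= [-> ->].
  - move=> [m n]; rewrite /hn /lvl /= !hnorm2S mulrA ler_wpM2r ?(ltW (hnorm2_gt0 _ _ _))//.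
    exact: lvl_bound.
  - by move=> phi /test_D11/test_slow.
  - by move=> phi p /ibp_D11; exact.
have [v2 h2] : exists v : X R, forall phi, test_function phi -> distr w ('D_e2 ('D_e2 phi)) = distr v phi.
  apply: (@weak_second_derivative w f (fun p : I => (p.1, p.2.+2)) (fun phi => 'D_e2 ('D_e2 phi)) fw).
  - by move=> [m n] [k l] /= [-> ->].
  - move=> [m n]; rewrite /hn /lvl /= !hnorm2Sr mulrA ler_wpM2r ?(ltW (hnorm2_gt0 _ _ _))//.
    by rewrite addnC lvl_bound.
  - by move=> phi /test_D22/test_slow.
  - by move=> phi p /ibp_D22; exact.
have D phi : test_function phi -> distr (v1 + v2 : X R) phi = distr_laplacian (distr w) phi.
  move=> t; rewrite laplacianE -[v1]scale1r distr_lin// mul1r.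
  by congr (_ + _); [exact/esym/h1|exact/esym/h2].
split; first by exists (v1 + v2).
(* xi . grad w is recovered as twice Lw minus the Laplacian minus w. *)
exists (2 *: ((-1) *: (v1 + v2) + (-1 *: w + f)) : X R) => phi t.
rewrite distr_scale// !distr_lin// -[v1 + v2]/(v1 + v2 : X R) D// (rf _ t) /distrL.
have aux (a b c : R) : 2 * (-1 * a + (-1 * c + (a + 2^-1 * b + c))) = b by field.
exact: aux.
Qed.

Lemma dom_graph_L : dom (@graph_L R) = @dom_L R.
Proof.
apply/seteqP; split=> w; first by move=> [f []].
move=> dw; have [[v rv] [g rg]] := dw.
exists (v + (2^-1 *: g + w) : X R); split=> // phi t.
rewrite -[v]scale1r distr_lin// mul1r distr_lin// (rv _ t) (rg _ t) addrA.
by [].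
Qed.

Lemma level_lvl n : lvl (n, 0%N) = n.
Proof. exact: addn0. Qed.

Lemma graph_L_spectral_properties :
  [/\ selfadjoint (@dotX R) (@graph_L R),
      compact_resolvent (@dotX R) (@graph_L R),
      purely_discrete_spectrum (@dotX R) (@graph_L R) &
      spectrum (@dotX R) (@graph_L R) = half_negative (R := R)].
Proof.
split.
- exact: (diag_selfadjoint dotC dotL dot0 uniq_pairs mem_pairs (@X_complete R) (@basis_on R) (@basis_total R) graph_LP).
- exact: (diag_compact_resolvent dotC dotL dot0 uniq_pairs mem_pairs (@X_complete R) (@basis_on R) (@basis_total R) graph_LP level_lvl).
- exact: (diag_purely_discrete dotC dotL dot0 uniq_pairs mem_pairs (@X_complete R) (@basis_on R) (@basis_total R) graph_LP level_lvl).
- exact: (diag_spectrum dotC dotL dot0 uniq_pairs mem_pairs (@X_complete R) (@basis_on R) (@basis_total R) graph_LP level_lvl).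
Qed.

End operator_L.


(** * Fubini for real integrals and kernel bounds *)

Section real_fubini.
Context d1 d2 (T1 : measurableType d1) (T2 : measurableType d2) (R : realType).
Context (m1 : {sigma_finite_measure set T1 -> \bar R}) (m2 : {sigma_finite_measure set T2 -> \bar R}).
Implicit Types f : T1 * T2 -> R.
Local Notation m12 := (m1 \x m2)%E.

Lemma meas_section_int f : measurable_fun setT (f : _ -> measurableTypeR R) ->
  measurable_fun setT (fun x => \int[m2]_y f (x, y) : measurableTypeR R).
Proof.
move=> mf; apply: measurableT_comp; first exact: fine_measurable.
have mE : measurable_fun setT (EFin \o f) by exact/measurable_EFinP.
rewrite (_ : (fun x => _) = (fun x => \int[m2]_y ((EFin \o f)^\+ (x, y)) - \int[m2]_y ((EFin \o f)^\- (x, y)))%E).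
  by apply: emeasurable_funB; apply: measurable_fun_fubini_tonelli_F => //;
    [exact: measurable_funepos|exact: measurable_funeneg].
apply/funext=> x; rewrite [LHS]integralE.
by congr (_ - _)%E; apply: eq_integral => y _; rewrite ?funeposE ?funenegE.
Qed.

Let sec1 f : intg m12 f -> {ae m1, forall x, (\int[m2]_y f (x, y))%:E = (\int[m2]_y (f (x, y))%:E)%E}.
Proof.
move=> fi; have := ae_integrable1 fi; apply: filterS => x h.
by rewrite fineK//; exact: integrable_fin_num.
Qed.

Lemma intg_section_int f : intg m12 f -> intg m1 (fun x => \int[m2]_y f (x, y)).
Proof.
move=> fi; have h := integrable_fubini_F fi.
have mF := meas_section_int (intg_meas fi).
apply: (le_integrable measurableT _ _ h); first exact/measurable_EFinP.
by move=> x _; rewrite /= /Rintegral /fubini_F; case: (\int[m2]_y _)%E => [r| |] //=; rewrite leey.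
Qed.

Lemma Rfubini1 f : intg m12 f -> \int[m1]_x \int[m2]_y f (x, y) = \int[m12]_z f z.
Proof.
move=> fi; have mF := meas_section_int (intg_meas fi).
rewrite /Rintegral -(integral12_prod_meas1 fi); congr fine.
apply: ae_eq_integral => //.
- exact/measurable_EFinP.
- exact: measurable_fubini_F fi.
- by apply: filterS (sec1 fi) => x h _.
Qed.

Lemma intg_prod_lty1 f : measurable_fun setT (f : _ -> measurableTypeR R) -> (forall z, 0 <= f z) ->
  (\int[m1]_x \int[m2]_y (f (x, y))%:E < +oo)%E -> intg m12 f.
Proof.
move=> mf f0 h; apply/integrable12ltyP; first exact/measurable_EFinP.
apply: le_lt_trans h; rewrite le_eqVlt; apply/orP; left; apply/eqP.
by apply: eq_integral => x _; apply: eq_integral => y _; rewrite /= ger0_norm.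
Qed.

Lemma intg_prod_lty2 f : measurable_fun setT (f : _ -> measurableTypeR R) -> (forall z, 0 <= f z) ->
  (\int[m2]_y \int[m1]_x (f (x, y))%:E < +oo)%E -> intg m12 f.
Proof.
move=> mf f0 h; apply/integrable21ltyP; first exact/measurable_EFinP.
apply: le_lt_trans h; rewrite le_eqVlt; apply/orP; left; apply/eqP.
by apply: eq_integral => x _; apply: eq_integral => y _; rewrite /= ger0_norm.
Qed.

(** Half of Schur's test: Tonelli integrates the kernel first, in the variable on which [h] does not
    depend. *)
Lemma intg_kernel_l (k : T1 * T2 -> R) (h : T1 -> R) (C : R) :
  measurable_fun setT (k : _ -> measurableTypeR R) -> (forall z, 0 <= k z) ->
  (forall x, (\int[m2]_y (k (x, y))%:E <= C%:E)%E) ->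
  intg m1 h -> (forall x, 0 <= h x) -> intg m12 (fun z => k z * h z.1).
Proof.
move=> mk k0 kC hi h0; have mh := intg_meas hi.
have m : measurable_fun setT (fun z : T1 * T2 => k z * h z.1 : measurableTypeR R).
  by apply: measurable_funM => //; exact: measurableT_comp mh _.
have C0 (x : T1) : 0 <= C.
  by rewrite -lee_fin; apply: le_trans (kC x); apply: integral_ge0 => y _; rewrite lee_fin.
apply: intg_prod_lty1 => //; first by move=> z; rewrite mulr_ge0.
apply: (@le_lt_trans _ _ (\int[m1]_x (C%:E * (h x)%:E))%E); last first.
  by rewrite integralZl// intg_ltyE// -EFinM ltry.
apply: ge0_le_integral => //.
- by move=> x _; apply: integral_ge0 => y _; rewrite lee_fin mulr_ge0.
- apply: (measurable_fun_fubini_tonelli_F (fun z => (k z * h z.1)%:E)).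
    exact/measurable_EFinP.
  by move=> z; rewrite lee_fin mulr_ge0.
- by apply: emeasurable_funM => //; exact/measurable_EFinP.
- move=> x _; under eq_integral do rewrite EFinM.
  rewrite /= ge0_integralZr ?lee_fin//; last 2 first.
  + by apply/measurable_EFinP; exact: measurableT_comp.
  + by move=> y _; rewrite lee_fin.
  by apply: lee_wpmul2r; rewrite ?lee_fin.
Qed.

Lemma intg_kernel_r (k : T1 * T2 -> R) (h : T2 -> R) (C : R) :
  measurable_fun setT (k : _ -> measurableTypeR R) -> (forall z, 0 <= k z) ->
  (forall y, (\int[m1]_x (k (x, y))%:E <= C%:E)%E) ->
  intg m2 h -> (forall x, 0 <= h x) -> intg m12 (fun z => k z * h z.2).
Proof.
move=> mk k0 kC hi h0; have mh := intg_meas hi.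
have m : measurable_fun setT (fun z : T1 * T2 => k z * h z.2 : measurableTypeR R).
  by apply: measurable_funM => //; exact: measurableT_comp mh _.
apply: intg_prod_lty2 => //; first by move=> z; rewrite mulr_ge0.
apply: (@le_lt_trans _ _ (\int[m2]_x (C%:E * (h x)%:E))%E); last first.
  by rewrite integralZl// intg_ltyE// -EFinM ltry.
apply: ge0_le_integral => //.
- by move=> x _; apply: integral_ge0 => y _; rewrite lee_fin mulr_ge0.
- apply: (measurable_fun_fubini_tonelli_G (fun z => (k z * h z.2)%:E)).
    exact/measurable_EFinP.
  by move=> z; rewrite lee_fin mulr_ge0.
- by apply: emeasurable_funM => //; exact/measurable_EFinP.
- move=> x _; under eq_integral do rewrite EFinM.
  rewrite /= ge0_integralZr ?lee_fin//; last 2 first.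
  + by apply/measurable_EFinP; exact: measurableT_comp.
  + by move=> y _; rewrite lee_fin.
  by apply: lee_wpmul2r; rewrite ?lee_fin.
Qed.

Lemma Rfubini2 f : intg m12 f -> \int[m2]_y \int[m1]_x f (x, y) = \int[m12]_z f z.
Proof.
move=> fi; have mG : measurable_fun setT (fun y => \int[m1]_x f (x, y) : measurableTypeR R).
  by apply: measurableT_comp (measurable_fubini_G fi); exact: fine_measurable.
rewrite /Rintegral -(integral21_prod_meas1 fi); congr fine.
apply: ae_eq_integral => //.
- exact/measurable_EFinP.
- exact: measurable_fubini_G fi.
- have := ae_integrable2 fi; apply: filterS => y h _.
  by rewrite fineK//; exact: integrable_fin_num.
Qed.

End real_fubini.

(** * Integrability of the inverse square root *)

Section inverse_square_root.
Context (R : realType).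
Local Notation leb := (@lebesgue_measure R).
Local Notation mR := (measurableTypeR R).

(** Inversion is written with the measurable function [powR]; at 0 both expressions are 0. *)
Lemma measurable_invr : measurable_fun setT ((fun t : R => t^-1) : mR -> mR).
Proof.
rewrite (_ : (fun t : R => _) = (fun t => t * (t ^+ 2) `^ (-1))).
  apply: measurable_funM => //; apply: (measurableT_comp (measurable_powR _)).
  exact: measurable_funX.
apply/funext => t; have [->|t0] := eqVneq t 0; first by rewrite invr0 mul0r.
rewrite powRN powRr1 ?sqr_ge0// expr2 invfM mulrA divff ?mul1r//.
Qed.

Lemma int_bigcup_le (f : R -> R) (F : nat -> set R) (C : R) : measurable_fun setT (f : mR -> mR) ->
  (forall t, 0 <= f t) -> (forall n, measurable (F n : set mR)) -> nondecreasing_seq F ->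
  (forall n, (\int[leb]_(t in F n) (f t)%:E <= C%:E)%E) ->
  (\int[leb]_(t in \bigcup_n F n) (f t)%:E <= C%:E)%E.
Proof.
move=> mf f0 mF nF FC.
have c : (\int[leb]_(t in F n) (f t)%:E)%E @[n --> \oo] --> (\int[leb]_(t in \bigcup_n F n) (f t)%:E)%E.
  apply: ge0_nondecreasing_set_cvg_integral => //.
  - by move=> n; apply/measurable_funTS/measurable_EFinP.
  - by move=> n t _; rewrite lee_fin.
rewrite -(cvg_lim _ c)//; apply: lime_le; first by apply/cvg_ex; eexists; exact: c.
exact: nearW.
Qed.

(** The sign [s] lets one primitive serve on both sides of the singularity. *)
Lemma int_invsqrt (s d p q : R) : s ^+ 2 = 1 -> p < q -> (forall t, p <= t <= q -> 0 < s * t + d) ->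
  (\int[leb]_(t in `[p, q]) ((Num.sqrt (s * t + d))^-1)%:E =
    (2 * s * Num.sqrt (s * q + d) - 2 * s * Num.sqrt (s * p + d))%:E)%E.
Proof.
move=> s1 pq h.
have dF t : p <= t <= q -> is_derive t (1 : R) (fun t => 2 * s * Num.sqrt (s * t + d)) (Num.sqrt (s * t + d))^-1.
  move=> /h t0; have i1 := is_derive_affine s d t; have i2 := is_derive1_sqrt t0.
  have i3 := @is_derive1_comp R (@Num.sqrt R) (fun t => s * t + d) t _ _ i2 i1.
  have i4 := is_deriveZ (2 * s) i3.
  apply: is_derive_eq; rewrite scale_mul mulrA -[2 * s * _]mulrA mulrCA invfM.
  rewrite mulrAC -!mulrA [s * (s * _)]mulrA -expr2 s1 mul1r mulrA divff ?mul1r//.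
have dbl : derivable_oo_LRcontinuous (fun t => 2 * s * Num.sqrt (s * t + d)) p q.
  have cF t : p <= t <= q -> {for t, continuous (fun t => 2 * s * Num.sqrt (s * t + d))}.
    move=> /dF i; apply/differentiable_continuous/derivable1_diffP.
    exact: (@ex_derive _ _ _ _ _ _ _ i).
  split.
  - move=> t; rewrite in_itv /= => /andP[t1 t2].
    by apply: (@ex_derive _ _ _ _ _ _ _ (dF t _)); rewrite !ltW.
  - by apply: cvg_at_right_filter; apply: cF; rewrite lexx ltW.
  - by apply: cvg_at_left_filter; apply: cF; rewrite lexx ltW.
rewrite (continuous_FTC2 pq _ dbl) ?EFinB//.
- apply: continuous_in_subspaceT => t; rewrite inE /= in_itv /= => /h t0.
  apply: cvgV; first by rewrite gt_eqF// sqrtr_gt0.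
  apply: continuous_comp; last exact: sqrt_continuous.
  by apply: cvgD; [apply: cvgM; [exact: cvg_cst|exact: cvg_id]|exact: cvg_cst].
- move=> t; rewrite in_itv /= => /andP[t1 t2].
  by rewrite derive1E; apply: (@derive_val _ _ _ _ _ _ _ (dF t _)); rewrite !ltW.
Qed.

Definition isqrt (t : R) : R := (Num.sqrt `|t|)^-1 * \1_(`]-1, 1[%classic) t.

Lemma isqrt_ge0 t : 0 <= isqrt t.
Proof. by rewrite mulr_ge0// ?invr_ge0 ?sqrtr_ge0. Qed.

Lemma isqrtN t : isqrt (- t) = isqrt t.
Proof.
rewrite /isqrt normrN; congr (_ * _); rewrite !indicE; congr (_%:R).
by apply: congr1; apply/idP/idP; rewrite !inE /= !in_itv /= => /andP[h1 h2]; apply/andP; split; lra.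
Qed.

Lemma meas_invsqrt (s d : R) : measurable_fun setT ((fun t => (Num.sqrt (s * t + d))^-1) : mR -> mR).
Proof.
apply: measurableT_comp; first exact: measurable_invr.
apply: measurableT_comp; first by apply: continuous_measurable_fun; exact: sqrt_continuous.
by apply: measurable_funD => //; exact: measurable_funM.
Qed.

Lemma meas_isqrt : measurable_fun setT (isqrt : mR -> mR).
Proof.
apply: measurable_funM; last by apply: measurable_indic; exact: measurable_itv.
apply: measurableT_comp; first exact: measurable_invr.
apply: measurableT_comp; first by apply: continuous_measurable_fun; exact: sqrt_continuous.
exact: normr_measurable.
Qed.

(** Each side of the singularity is exhausted by intervals away from it and contributes at most 2,
    by the explicit primitive. *)
Lemma int_isqrt (c : R) : (\int[leb]_t (isqrt (c - t))%:E <= 4%:E)%E.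
Proof.
(* [n.+2] rather than [n.+1] keeps the intervals nondegenerate from [n = 0] on. *)
pose Fp n : set R := `[c + n.+2%:R^-1, c + 1]%classic.
pose Fm n : set R := `[c - 1, c - n.+2%:R^-1]%classic.
have inv n : 0 < (n.+2%:R^-1 : R) < 1 by rewrite invr_gt0 ltr0n invf_lt1// ltr1n.
have invle (m n : nat) : (m <= n)%N -> n.+2%:R^-1 <= m.+2%:R^-1 :> R.
  by move=> mn; rewrite lef_pV2 ?posrE ?ltr0n// ler_nat.
have hp : (\int[leb]_(t in \bigcup_n Fp n) ((Num.sqrt (1 * t + - c))^-1)%:E <= 2%:E)%E.
  apply: int_bigcup_le.
  - exact: meas_invsqrt.
  - by move=> t; rewrite invr_ge0 sqrtr_ge0.
  - by move=> n; exact: measurable_itv.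
  - move=> m n mn; rewrite subsetEset => t; rewrite /Fp /= !in_itv /= => /andP[h ->]; rewrite andbT.
    by apply: le_trans h; rewrite lerD2l invle.
  - move=> n; have /andP[i0 i1] := inv n; rewrite int_invsqrt ?expr1n//; last 2 first.
    + by rewrite ltrD2l.
    + by move: (n.+2%:R^-1 : R) i0 => x x0 t /andP[h1 h2]; lra.
    rewrite lee_fin !mulr1 !mul1r addrAC subrr add0r sqrtr1 mulr1.
    by rewrite lerBlDr lerDl mulr_ge0// sqrtr_ge0.
have hm : (\int[leb]_(t in \bigcup_n Fm n) ((Num.sqrt (- 1 * t + c))^-1)%:E <= 2%:E)%E.
  apply: int_bigcup_le.
  - exact: meas_invsqrt.
  - by move=> t; rewrite invr_ge0 sqrtr_ge0.
  - by move=> n; exact: measurable_itv.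
  - move=> m n mn; rewrite subsetEset => t; rewrite /Fm /= !in_itv /= => /andP[-> h] /=.
    by apply: le_trans h _; rewrite lerD2l lerN2 invle.
  - move=> n; have /andP[i0 i1] := inv n; rewrite int_invsqrt ?sqrrN ?expr1n//; last 2 first.
    + by rewrite ltrD2l ltrN2.
    + by move: (n.+2%:R^-1 : R) i0 => x x0 t /andP[h1 h2]; lra.
    rewrite lee_fin (_ : - 1 * (c - 1) + c = 1); last by ring.
    rewrite sqrtr1; have := sqrtr_ge0 (- 1 * (c - n.+2%:R^-1) + c); lra.
pose Ap := \bigcup_n Fp n; pose Am := \bigcup_n Fm n.
have mAp : measurable (Ap : set mR) by apply: bigcup_measurable => n _; exact: measurable_itv.
have mAm : measurable (Am : set mR) by apply: bigcup_measurable => n _; exact: measurable_itv.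
have near0 (e : R) : 0 < e -> exists n : nat, n.+2%:R^-1 <= e.
  move=> e0; exists (Num.bound e^-1); rewrite -[e in _ <= e]invrK lef_pV2 ?posrE ?ltr0n ?invr_gt0//.
  apply: le_trans (ltW (archi_boundP _)) _; first by rewrite invr_ge0 ltW.
  by rewrite ler_nat -addn2 leq_addr.
pose fp (t : R) := ((Num.sqrt (1 * t + - c))^-1)%:E.
pose fm (t : R) := ((Num.sqrt (- 1 * t + c))^-1)%:E.
have fp0 t : (0 <= (fp \_ Ap) t)%E.
  by apply: erestrict_ge0 => {}t _; rewrite lee_fin invr_ge0 sqrtr_ge0.
have fm0 t : (0 <= (fm \_ Am) t)%E.
  by apply: erestrict_ge0 => {}t _; rewrite lee_fin invr_ge0 sqrtr_ge0.
have pw (t : R) : ((isqrt (c - t))%:E <= (fp \_ Ap) t + (fm \_ Am) t)%E.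
  rewrite /isqrt indicE; case: (boolP (_ \in _)) => [|_]; last by rewrite mulr0 adde_ge0.
  rewrite inE /= in_itv /= mulr1 => /andP[h1 h2].
  have [ct|ct|ct] := ltrgtP c t.
  - apply: le_trans (leeDl _ (fm0 t)).
    rewrite patchE mem_set /fp ?mul1r//.
    have [|n hn] := near0 (t - c); first by rewrite subr_gt0.
    by exists n => //; rewrite /Fp /= in_itv /=; move: (n.+2%:R^-1 : R) hn => x hx; apply/andP; split; lra.
  - apply: le_trans (leeDr _ (fp0 t)).
    rewrite patchE mem_set /fm ?mulN1r ?[- t + c]addrC//.
    have [|n hn] := near0 (c - t); first by rewrite subr_gt0.
    by exists n => //; rewrite /Fm /= in_itv /=; move: (n.+2%:R^-1 : R) hn => x hx; apply/andP; split; lra.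
  - by rewrite sqrtr0 invr0 adde_ge0.
apply: (@le_trans _ _ (\int[leb]_t (fp \_ Ap t +
    fm \_ Am t))%E).
  apply: ge0_le_integral => //.
  - by move=> t _; rewrite lee_fin isqrt_ge0.
  - apply/measurable_EFinP; apply: measurableT_comp; first exact: meas_isqrt.
    exact: measurable_funB.
  - apply: emeasurable_funD; apply/(measurable_restrictT _ _).1 => //;
      by apply/measurable_funTS/measurable_EFinP; exact: meas_invsqrt.
rewrite ge0_integralD//; last 2 first.
- apply/(measurable_restrictT _ _).1 => //; by apply/measurable_funTS/measurable_EFinP; exact: meas_invsqrt.
- apply/(measurable_restrictT _ _).1 => //; by apply/measurable_funTS/measurable_EFinP; exact: meas_invsqrt.
rewrite -!integral_mkcond (_ : 4%:E = 2%:E + 2%:E)%E ?leeD//.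
by rewrite -EFinD; congr EFin; ring.
Qed.

End inverse_square_root.


(** * Planar Lebesgue measure as a sigma-finite measure *)

Section plane_measure.
Context (R : realType).
Local Notation leb := (@lebesgue_measure R).
Local Notation mR := (measurableTypeR R).
Local Notation P := (mR * mR)%type.

(* A copy of leb2 on which the sigma-finite structure can be declared. *)
Definition leb_plane : set P -> \bar R := leb2 R.
HB.instance Definition _ := Measure.copy leb_plane (leb2 R).
Lemma leb_plane_sigma_finite : sigma_finite setT leb_plane.
Proof.
pose I n : set mR := `[- (n%:R : R), n%:R]%classic.
have mI n : measurable (I n) by exact: measurable_itv.
exists (fun n => I n `*` I n).
  apply/esym/seteqP; split=> // x _.
  exists (Num.bound (`|x.1| + `|x.2|)) => //.
  have h := ltW (archi_boundP (addr_ge0 (normr_ge0 x.1) (normr_ge0 x.2))).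
  by split; rewrite /I /= in_itv /= -ler_norml; apply: le_trans h; rewrite ?lerDl ?lerDr.
move=> n; split; first exact: measurableX.
have -> : leb_plane (I n `*` I n) = (leb (I n) * leb (I n))%E by exact: product_measure1E.
by rewrite lebesgue_measure_itv /=; case: ifPn => _; rewrite ?mul0e // -EFinB -EFinM ltry.
Qed.

HB.instance Definition _ := Measure_isSigmaFinite.Build _ _ _ leb_plane leb_plane_sigma_finite.

End plane_measure.

(** * The Biot-Savart term *)

Section biot_savart_kernel.
Context (R : realType).
Local Notation plane := (R * R)%type.
Local Notation mu := (leb2 R).
Local Notation leb := (@lebesgue_measure R).
Local Notation mu4 := (@leb_plane R \x @leb_plane R)%E.
Local Notation mR := (measurableTypeR R).
Local Notation P := (mR * mR)%type.
Local Notation meas f := (measurable_fun [set: P] (f : P -> mR)).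
Local Notation meas4 f := (measurable_fun [set: P * P] (f : P * P -> mR)).
Local Notation G := (@gaussG R).
Implicit Types (u v w : X R) (z : plane).

(** The kernel is of order 1/|z|, and |z|^2 >= |z.1 z.2|: near the origin it is dominated by a
    product of one-variable functions, which can be integrated without polar coordinates. *)
Definition kap z : R := isqrt z.1 * isqrt z.2.

Lemma kap_ge0 z : 0 <= kap z.
Proof. by rewrite mulr_ge0// isqrt_ge0. Qed.

Lemma kapN z z' : kap (z - z') = kap (z' - z).
Proof. by rewrite /kap /= -[z.1 - _]opprB -[z.2 - _]opprB !isqrtN. Qed.

Lemma meas_diff (f : plane -> R) : meas f -> meas4 (fun x : P * P => f (x.1 - x.2)).
Proof.
move=> mf; apply: (measurableT_comp mf).
apply/measurable_fun_pairP; split.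
  by apply: measurable_funB; apply: measurableT_comp => //; exact: measurable_fst.
by apply: measurable_funB; apply: measurableT_comp => //; exact: measurable_snd.
Qed.

Lemma meas_kap : meas kap.
Proof. by apply: measurable_funM; apply: measurableT_comp => //; exact: meas_isqrt. Qed.

Lemma meas_translate (f : plane -> R) (a : plane) : meas f -> meas (fun b : P => f (a - b)).
Proof.
move=> mf; apply: (measurableT_comp mf); apply/measurable_fun_pairP; split.
  by apply: measurable_funB => //; exact: measurable_fst.
by apply: measurable_funB => //; exact: measurable_snd.
Qed.

Lemma int_kap (a : P) : (\int[mu]_b (kap (a - b))%:E <= 16%:E)%E.
Proof.
have mi (c : R) : measurable_fun [set: mR] (fun t : mR => (isqrt (c - t))%:E).
  apply/measurable_EFinP; apply: measurableT_comp; first exact: meas_isqrt.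
  exact: measurable_funB.
have mk : measurable_fun setT (fun b : P => (kap (a - b))%:E).
  by apply/measurable_EFinP; apply: meas_translate; exact: meas_kap.
rewrite /leb2 fubini_tonelli1//; last by move=> b; rewrite lee_fin kap_ge0.
rewrite /fubini_F (eq_integral (fun x : mR => (isqrt (a.1 - x))%:E * \int[leb]_y (isqrt (a.2 - y))%:E)%E).
  rewrite ge0_integralZr//; last 2 first.
  - by move=> x _; rewrite lee_fin isqrt_ge0.
  - by apply: integral_ge0 => x _; rewrite lee_fin isqrt_ge0.
  rewrite (_ : 16%:E = 4%:E * 4%:E)%E; last by rewrite -EFinM; congr EFin; ring.
  by apply: lee_pmul; rewrite ?int_isqrt// integral_ge0// => x _; rewrite lee_fin isqrt_ge0.
move=> x _; rewrite -ge0_integralZl//; last by rewrite lee_fin isqrt_ge0.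
by move=> y _; rewrite lee_fin isqrt_ge0.
Qed.

(* Vanishing on the axes (as 0 / 0 = 0), the kernel is bounded by 1 + kap
   everywhere. *)
Definition ker (i : bool) z : R :=
  (if i then (kernelK z).1 else (kernelK z).2) * (z.1 / z.1) * (z.2 / z.2).

Lemma ker_le i z : `|ker i z| <= 1 + kap z.
Proof.
have k0 := kap_ge0 z.
rewrite /ker; have [->|z1] := eqVneq z.1 0; first by rewrite mul0r mulr0 mul0r normr0 addr_ge0.
have [->|z2] := eqVneq z.2 0; first by rewrite mul0r mulr0 normr0 addr_ge0.
rewrite !divff// !mulr1.
pose a := Num.sqrt `|z.1|; pose b := Num.sqrt `|z.2|.
have a2 : a ^+ 2 = `|z.1| by rewrite sqr_sqrtr.
have b2 : b ^+ 2 = `|z.2| by rewrite sqr_sqrtr.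
have a0 : 0 < a by rewrite sqrtr_gt0 normr_gt0.
have b0 : 0 < b by rewrite sqrtr_gt0 normr_gt0.
have sE : sqnorm z = a ^+ 4 + b ^+ 4.
  by rewrite /sqnorm -[z.1 ^+ 2]real_normK ?num_real// -[z.2 ^+ 2]real_normK ?num_real// -a2 -b2 -!exprM.
have s0 : 0 < sqnorm z by rewrite sE addr_gt0// exprn_gt0.
have pi1 : 1 <= 2 * pi :> R by have := pi_ge2 R; lra.
have big (t : R) : (t = `|z.1| \/ t = `|z.2|) -> 1 <= `|z.1| \/ 1 <= `|z.2| -> t / sqnorm z <= 1 + kap z.
  move=> tE h; apply: (@le_trans _ _ 1); last by rewrite lerDl.
  rewrite ler_pdivrMr// mul1r sE -[4%N]/(2 * 2)%N !exprM a2 b2.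
  have := normr_ge0 z.1; have := normr_ge0 z.2; move: tE h.
  move: `|z.1| `|z.2| => A B tE h B0 A0; have := sqr_ge0 (A - 1); have := sqr_ge0 (B - 1).
  by case: h => h; case: tE => ->; nra.
have main (t : R) : (t = `|z.1| \/ t = `|z.2|) -> t / sqnorm z <= 1 + kap z.
  move=> tE; have [l1|l1] := ltP `|z.1| 1; last by apply: big => //; left.
  have [l2|l2] := ltP `|z.2| 1; last by apply: big => //; right.
  have -> : kap z = (a * b)^-1.
    by rewrite /kap /isqrt !indicE !mem_set ?mulr1 ?invfM//= in_itv /= -ltr_norml.
  apply: (@le_trans _ _ (a * b)^-1); last by rewrite lerDr.
  (* What remains is that [a ^+ 3 * b] and [a * b ^+ 3] are at most [a ^+ 4 + b ^+ 4]. *)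
  rewrite ler_pdivrMr// mulrC ler_pdivlMr ?mulr_gt0// sE.
  have := sqr_ge0 (a ^+ 2 - b ^+ 2); have := sqr_ge0 (a * (a - b)); have := sqr_ge0 (b * (a - b)).
  by case: tE => ->; rewrite -?a2 -?b2; nra.
have pi2 (t : R) : 0 <= t -> t / (2 * pi * sqnorm z) <= t / sqnorm z.
  by move=> t0; rewrite ler_wpM2l// lef_pV2 ?posrE ?mulr_gt0 ?pi_gt0// ler_peMl// ltW.
have n2 : `|2| = 2 :> R by rewrite normr_nat.
case: i => /=; rewrite !normrM normfV !normrM (gtr0_norm s0) (gtr0_norm (pi_gt0 R)) n2 ?normrN.
  by apply: le_trans (pi2 _ _) _ => //; apply: main; right.
by apply: le_trans (pi2 _ _) _ => //; apply: main; left.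
Qed.

Lemma kerN i z z' : ker i (z - z') = - ker i (z' - z).
Proof.
rewrite -[z - z']opprB; move: (z' - z) => {z z'}z.
rewrite /ker /kernelK /sqnorm /= !sqrrN !opprK !invrN !mulNr !mulrN !opprK.
by case: i; rewrite ?mulNr// !opprK.
Qed.

Lemma ker_orth z : ker true z * z.1 + ker false z * z.2 = 0.
Proof. by rewrite /ker /kernelK /=; ring. Qed.

Lemma meas_kernelK i : meas (fun z : plane => if i then (kernelK z).1 else (kernelK z).2).
Proof.
case: i; apply: measurable_funM.
- by apply: measurableT_comp => //; exact: measurable_snd.
- apply: (measurableT_comp (@measurable_invr R)); apply: measurable_funM => //; exact: meas_sqnorm.
- exact: measurable_fst.
- apply: (measurableT_comp (@measurable_invr R)); apply: measurable_funM => //; exact: meas_sqnorm.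
Qed.

Lemma meas_ker i : meas (ker i).
Proof.
apply: measurable_funM; last first.
  apply: measurable_funM; first exact: measurable_snd.
  by apply: (measurableT_comp (@measurable_invr R)); exact: measurable_snd.
apply: measurable_funM; first exact: meas_kernelK.
apply: measurable_funM; first exact: measurable_fst.
by apply: (measurableT_comp (@measurable_invr R)); exact: measurable_fst.
Qed.

Lemma kap_pair (p : plane -> R) : intg mu (fun x => p x ^+ 2) ->
  intg mu4 (fun x => kap (x.1 - x.2) * p x.1 ^+ 2) /\
  intg mu4 (fun x => kap (x.1 - x.2) * p x.2 ^+ 2).
Proof.
move=> ip; have m4 := meas_diff meas_kap.
have k0 (x : P * P) : 0 <= kap (x.1 - x.2) by exact: kap_ge0.
have p0 (x : P) : 0 <= p x ^+ 2 by exact: sqr_ge0.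
split.
  exact: (intg_kernel_l (m1 := @leb_plane R) (m2 := @leb_plane R) m4 k0 (fun x => int_kap x) ip p0).
apply: (intg_kernel_r (m1 := @leb_plane R) (m2 := @leb_plane R) m4 k0 _ ip p0) => y /=.
by under eq_integral do rewrite kapN; exact: int_kap.
Qed.

(** The intersection of L^1 and L^2, matching the bound [1 + kap] of the kernel: the constant is
    paired in L^1 and [kap] in L^2. *)
Definition L12 (p : plane -> R) := [/\ meas p, intg mu p & intg mu (fun x => p x ^+ 2)].

Lemma gauss_slow_sqr k : slow k -> exists2 M : R, 0 <= M & forall x, G x * k x ^+ 2 <= M.
Proof.
move=> sk; have [_ [C hC]] := slow_sg sk.
have q0 : 0 <= (4 * pi)^-1 :> R by rewrite invr_ge0 mulr_ge0// pi_ge0.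
exists (C ^+ 2 * (4 * pi)^-1) => [|x]; first by rewrite mulr_ge0 ?sqr_ge0.
have g0 := ltW (gaussG_gt0 x); have ek := hC x; have n0 := normr_ge0 (k x).
apply: (@le_trans _ _ (G x * (C * expR (sqnorm x / 16)) ^+ 2)).
  by rewrite ler_wpM2l// -[k x ^+ 2]real_normK ?num_real// lerXn2r// nnegrE// (le_trans n0).
rewrite exprMn mulrCA gaussE ler_wpM2l ?sqr_ge0// ler_piMr// -[leRHS]expR0 ler_expR oppr_le0.
by rewrite divr_ge0// sqnorm_ge0.
Qed.

Lemma L12_slow w k : slow k -> L12 (fun x => w x * k x).
Proof.
move=> sk; have mw := X_meas w; split.
- by apply: measurable_funM => //; exact: sk.1.
- exact: intg_slow.
have [M M0 hM] := gauss_slow_sqr sk.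
apply: (intg_le _ (intgZ M (X_sqr_intg w))).
  by apply: measurable_funX; apply: measurable_funM => //; exact: sk.1.
move=> x; rewrite ger0_norm ?sqr_ge0// exprMn.
have g0 := gaussG_gt0 x.
rewrite (_ : w x ^+ 2 * k x ^+ 2 = G x * k x ^+ 2 * ((G x)^-1 * w x ^+ 2)); last first.
  by field; rewrite gt_eqF.
apply: ler_wpM2r; last exact: hM.
by apply: mulr_ge0; [rewrite invr_ge0 ltW|exact: sqr_ge0].
Qed.

(** For the constant part, [|p| |q|] is an integrable tensor product; for [kap],
    [|p| |q| <= p ^+ 2 + q ^+ 2] reduces to the two halves of Schur's test. *)
Lemma ker_pair i p q : L12 p -> L12 q ->
  intg mu4 (fun x => ker i (x.1 - x.2) * (p x.1 * q x.2)).
Proof.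
move=> [mp ip sp] [mq iq sq].
have [k1 _] := kap_pair sp; have [_ k2] := kap_pair sq.
have t := intg_tensor (m1 := @leb_plane R) (m2 := @leb_plane R) (intg_norm ip) (intg_norm iq).
apply: (intg_le _ (intgD t (intgD k1 k2))).
  apply: measurable_funM; first by apply: meas_diff; exact: meas_ker.
  apply: measurable_funM; first by apply: (measurableT_comp mp); exact: measurable_fst.
  by apply: (measurableT_comp mq); exact: measurable_snd.
move=> x; rewrite [leLHS]normrM [X in _ * X]normrM.
apply: (@le_trans _ _ ((1 + kap (x.1 - x.2)) * (`|p x.1| * `|q x.2|))).
  by rewrite ler_wpM2r ?mulr_ge0// ker_le.
rewrite mulrDl mul1r lerD2l -mulrDr ler_wpM2l ?kap_ge0//.
rewrite -[p x.1 ^+ 2]real_normK ?num_real// -[q x.2 ^+ 2]real_normK ?num_real//.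
have := normr_ge0 (p x.1); have := normr_ge0 (q x.2); move: `|p x.1| `|q x.2| => A B B0 A0.
have := sqr_ge0 (A - B); nra.
Qed.

Definition conv_ker i (w : plane -> R) (a : plane) : R := \int[mu]_b (ker i (a - b) * w b).

(** As functions of [b], the two kernels differ only on two lines through [a], which are
    negligible. *)
Lemma biot_savartE w a : biot_savart w a = (conv_ker true w a, conv_ker false w a).
Proof.
have null1 : {ae mu, forall b : P, a.1 - b.1 != 0}.
  exists ([set a.1] `*` setT); split.
  - by apply: measurableX.
  - have -> : mu ([set a.1] `*` setT) = (leb [set a.1] * leb setT)%E by exact: product_measure1E.
    by rewrite lebesgue_measure_set1 mul0e.
  - by move=> b /= /negP; rewrite negbK subr_eq0 => /eqP ->.
have null2 : {ae mu, forall b : P, a.2 - b.2 != 0}.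
  exists (setT `*` [set a.2]); split.
  - by apply: measurableX.
  - have -> : mu (setT `*` [set a.2]) = (leb setT * leb [set a.2])%E by exact: product_measure1E.
    by rewrite lebesgue_measure_set1 mule0.
  - by move=> b /= /negP; rewrite negbK subr_eq0 => /eqP ->.
have E i : \int[mu]_b ((if i then (kernelK (a - b)).1 else (kernelK (a - b)).2) * w b) = conv_ker i w a.
  apply: Rint_ae.
  - apply: measurable_funM; last exact: X_meas.
    exact: (meas_translate a (meas_kernelK i)).
  - by apply: measurable_funM; [exact: (meas_translate a (meas_ker i))|exact: X_meas].
  - apply: filterS2 null1 null2 => b h1 h2.
    by rewrite /ker /= !divff// !mulr1.
by rewrite /biot_savart (E true) (E false).
Qed.

Lemma meas_conv_ker i w : meas (conv_ker i w).
Proof.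
apply: (meas_section_int (@leb_plane R) (f := fun x : P * P => ker i (x.1 - x.2) * w x.2)).
apply: measurable_funM; first by apply: meas_diff; exact: meas_ker.
by apply: (measurableT_comp (X_meas w)); exact: measurable_snd.
Qed.

Lemma X_L12 w : L12 w.
Proof. by have := L12_slow w (slow_cst (1 : R)); under eq_fun do rewrite mulr1. Qed.

(** Pairing with the Gaussian [psi 1 1] makes the double integral converge; almost every section is
    then integrable, and the positive factor can be divided out. *)
Lemma ae_conv_ker i w : {ae mu, forall a : P, intg mu (fun b => ker i (a - b) * w b)}.
Proof.
have := ae_integrable1 (ker_pair i (X_L12 (psi 1 1)) (X_L12 w)).
apply: filterS => a /= h.
have p0 : psi 1 1 a != 0.
  by rewrite psiE !hornerC !mulr1 gt_eqF// gaussG_gt0.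
have := intgZ (psi 1 1 a)^-1 h.
rewrite (_ : (fun x => _) = (fun b => ker i (a - b) * w b))//.
apply/funext => b; rewrite mulrCA; congr (_ * _); rewrite mulrA mulVf ?mul1r//.
Qed.

Lemma conv_ker_lin i c u v :
  {ae mu, forall a : P, conv_ker i (c *: u + v : X R) a = c * conv_ker i u a + conv_ker i v a}.
Proof.
apply: filterS2 (ae_conv_ker i u) (ae_conv_ker i v) => a hu hv.
rewrite /conv_ker -(RintZ c hu) -(RintD (intgZ c hu) hv).
by apply: eq_Rintegral => b _; rewrite X_lin; ring.
Qed.

Lemma conv_ker_ae i u v a : {ae mu, forall b : P, u b = v b} -> conv_ker i u a = conv_ker i v a.
Proof.
move=> uv; apply: Rint_ae.
- by apply: measurable_funM; [exact: (meas_translate a (meas_ker i))|exact: X_meas].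
- by apply: measurable_funM; [exact: (meas_translate a (meas_ker i))|exact: X_meas].
- by apply: filterS uv => b ->.
Qed.

(** [B] is the convolution of [kap] with [w ^+ 2]. This is Cauchy-Schwarz for the measure
    [kap (a - b) db], of mass at most 16, obtained from [|w| <= t / 2 + w ^+ 2 / (2 * t)] with [t]
    depending on [a]. *)
Lemma conv_ker_sqr i w : exists B : plane -> R, exists W : R, [/\ intg mu B, forall a, 0 <= B a, 0 <= W &
  {ae mu, forall a : P, conv_ker i w a ^+ 2 <= W + 32 * B a}].
Proof.
have [mw iw sw] := X_L12 w.
have [_ k2] := kap_pair sw.
have iB := intg_section_int k2; have aeB := ae_integrable1 k2.
pose B (a : plane) := \int[mu]_b (kap (a - b) * w b ^+ 2).
pose W := \int[mu]_b `|w b|.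
have B0 a : 0 <= B a by apply: Rintegral_ge0 => b _; rewrite mulr_ge0 ?kap_ge0 ?sqr_ge0.
have W0 : 0 <= W by apply: Rintegral_ge0.
exists B, (2 * W ^+ 2 + 32); split=> //; first by rewrite addr_ge0// mulr_ge0 ?sqr_ge0.
apply: filterS2 (ae_conv_ker i w) aeB => a ik iBa.
have ikap : intg mu (fun b => kap (a - b)).
  apply: intg_lty; [exact: (meas_translate a meas_kap)|by move=> x; exact: kap_ge0|].
  by apply: le_lt_trans (int_kap a) _; exact: ltry.
have kap16 : \int[mu]_b kap (a - b) <= 16.
  by rewrite -lee_fin -intg_ltyE// int_kap.
(* This [t] minimizes [t / 2 * 16 + (B a + 1) / (2 * t)]; the added 1 keeps it positive when
   [B a = 0]. *)
pose t := Num.sqrt (B a + 1) / 4.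
have B1 : 0 < B a + 1 by rewrite ltr_wpDl.
have t0 : 0 < t by rewrite divr_gt0// sqrtr_gt0.
have b1 : `|conv_ker i w a| <= W + (t / 2 * \int[mu]_b kap (a - b) + (2 * t)^-1 * B a).
  apply: le_trans (le_normr_Rintegral _ _) _ => //.
  rewrite -(RintZ (t / 2) ikap) -(RintZ (2 * t)^-1 iBa) -RintD; [|exact: intgZ|exact: intgZ].
  rewrite -RintD; [|exact: intg_norm|by apply: intgD; exact: intgZ].
  apply: Rint_le; [exact: intg_norm|by apply: intgD; [exact: intg_norm|apply: intgD; exact: intgZ]|].
  move=> b; rewrite normrM; apply: (@le_trans _ _ ((1 + kap (a - b)) * `|w b|)).
    by rewrite ler_wpM2r// ker_le.
  rewrite mulrDl mul1r lerD2l /= [t / 2 * _]mulrC [(2 * t)^-1 * _]mulrCA -mulrDr ler_wpM2l ?kap_ge0//.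
  rewrite -[w b ^+ 2]real_normK ?num_real//; move: `|w b| => A.
  have -> : t / 2 + (2 * t)^-1 * A ^+ 2 = A + (2 * t)^-1 * (t - A) ^+ 2.
    by field; rewrite gt_eqF.
  by rewrite lerDl mulr_ge0 ?sqr_ge0// invr_ge0 mulr_ge0// ltW.
have b2 : `|conv_ker i w a| <= W + 4 * Num.sqrt (B a + 1).
  apply: le_trans b1 _; rewrite lerD2l.
  set r := Num.sqrt (B a + 1); have r0 : 0 < r by rewrite sqrtr_gt0.
  have r2 : r ^+ 2 = B a + 1 by rewrite sqr_sqrtr// ltW.
  have -> : 4 * r = t / 2 * 16 + (2 * t)^-1 * r ^+ 2.
    by rewrite /t -/r; field; rewrite gt_eqF.
  apply: lerD; first by rewrite ler_wpM2l// divr_ge0// ltW.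
  by rewrite ler_wpM2l ?r2 ?lerDl// invr_ge0 mulr_ge0// ltW.
rewrite -[_ ^+ 2]real_normK ?num_real//.
set r := Num.sqrt (B a + 1) in b2.
have r2 : r ^+ 2 = B a + 1 by rewrite sqr_sqrtr// ltW.
have r0 : 0 <= r := sqrtr_ge0 _.
have h := sqr_ge0 (W - 4 * r).
apply: (@le_trans _ _ ((W + 4 * r) ^+ 2)).
  by rewrite lerXn2r// nnegrE addr_ge0// mulr_ge0.
rewrite (_ : _ + 32 * B a = 2 * W ^+ 2 + 32 * r ^+ 2); last by rewrite r2; ring.
nra.
Qed.

(** [f] is compared with the minimum of both absolute values, which is bounded everywhere and equals
    [|f|] almost everywhere. *)
Lemma intg_le_ae (f g : P -> R) : meas f -> intg mu g -> {ae mu, forall x : P, `|f x| <= g x} -> intg mu f.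
Proof.
move=> mf ig fg; have mg := intg_meas ig.
have h : intg mu (fun x => Num.min `|f x| `|g x|).
  apply: (intg_le _ (intg_norm ig)) => [|x]; last by rewrite ger0_norm ?le_min ?normr_ge0// ge_min lexx orbT.
  by apply: measurable_minr; exact: measurableT_comp.
have nf : intg mu (fun x => `|f x|).
  apply: (intg_ae _ h); first exact: measurableT_comp.
  apply: filterS fg => x fx; rewrite min_l//; exact: le_trans (ler_norm _).
exact: intg_le mf nf (fun x => lexx _).
Qed.

Definition coord (i : bool) (x : plane) := if i then x.1 else x.2.

Lemma slow_coord i : slow (coord i).
Proof. by case: i; [exact: slow_fst|exact: slow_snd]. Qed.

Lemma gauss_D1 x : 'D_(e1 R) G x = - (x.1 / 2) * G x.
Proof.
have E : (psi 1 1 : plane -> R) = G.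
  by apply/funext => y; rewrite psiE !hornerC !mulr1.
have i := psi_D1 1 1 x; rewrite -[in LHS]E (@derive_val _ _ _ _ _ _ _ i) psiE.
by rewrite /gder derivC sub0r mulr1 hornerN hornerZ hornerX hornerC; ring.
Qed.

Lemma gauss_D2 x : 'D_(e2 R) G x = - (x.2 / 2) * G x.
Proof.
have E : (psi 1 1 : plane -> R) = G.
  by apply/funext => y; rewrite psiE !hornerC !mulr1.
have i := psi_D2 1 1 x; rewrite -[in LHS]E (@derive_val _ _ _ _ _ _ _ i) psiE.
by rewrite /gder derivC sub0r mulr1 hornerN hornerZ hornerX hornerC; ring.
Qed.

Definition nonlocal w (x : plane) : R :=
  (biot_savart w x).1 * 'D_(e1 R) G x + (biot_savart w x).2 * 'D_(e2 R) G x.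

Lemma nonlocalE w x : nonlocal w x =
  - (2^-1 * G x * (x.1 * conv_ker true w x + x.2 * conv_ker false w x)).
Proof. by rewrite /nonlocal biot_savartE gauss_D1 gauss_D2 /=; field. Qed.

(** The weighted square is [G x_i^2] times the squared convolution; [G x_i^2] is integrable against
    the constant [W] and bounded against the integrable [B]. *)
Lemma conv_ker_X i w : exists N : X R, forall x, N x = G x * (coord i x * conv_ker i w x).
Proof.
have [sm sl] := slow_coord i; have mc := meas_conv_ker i w.
have mg := @meas_gauss R.
apply: X_of; first by apply: measurable_funM => //; exact: measurable_funM.
have [B [W [iB B0 W0 h]]] := conv_ker_sqr i w.
have [M M0 hM] := gauss_slow_sqr (slow_coord i).
have sq : slow (fun x => coord i x * coord i x) by apply: slowM; exact: slow_coord.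
apply: (@intg_le_ae _ (fun x => W * (G x * (coord i x * coord i x)) + (32 * M) * B x)).
- apply: measurable_funM; first exact: meas_gaussV.
  by apply: measurable_funX; apply: measurable_funM => //; exact: measurable_funM.
- apply: intgD; last exact: intgZ.
  by apply: intgZ; apply: sg_gauss_intg; exact: slow_sg.
- apply: filterS h => x hx; have g0 := gaussG_gt0 x.
  rewrite (_ : (G x)^-1 * _ = G x * coord i x ^+ 2 * conv_ker i w x ^+ 2); last first.
    by field; rewrite gt_eqF.
  have p0 : 0 <= G x * coord i x ^+ 2 by rewrite mulr_ge0 ?sqr_ge0// ltW.
  rewrite ger0_norm; last by rewrite mulr_ge0// sqr_ge0.
  apply: le_trans (ler_wpM2l p0 hx) _.
  rewrite mulrDr mulrC -expr2 lerD2l mulrCA -mulrA ler_wpM2l// ler_wpM2r//.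
Qed.

Lemma nonlocal_X w : exists N : X R, forall x, N x = nonlocal w x.
Proof.
have [N1 h1] := conv_ker_X true w; have [N2 h2] := conv_ker_X false w.
exists (- 2^-1 *: N1 + (- 2^-1 *: N2 + 0) : X R) => x.
by rewrite !X_lin h1 h2 nonlocalE /coord -[(0 : X R) x]/0; ring.
Qed.

Lemma nonlocal_lin c u v :
  {ae mu, forall x : P, nonlocal (c *: u + v : X R) x = c * nonlocal u x + nonlocal v x}.
Proof.
apply: filterS2 (conv_ker_lin true c u v) (conv_ker_lin false c u v) => x h1 h2.
by rewrite !nonlocalE h1 h2; ring.
Qed.

Lemma nonlocal_ae u v x : {ae mu, forall y : P, u y = v y} -> nonlocal u x = nonlocal v x.
Proof. by move=> uv; rewrite !nonlocalE !(conv_ker_ae _ _ uv). Qed.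

Lemma conv_ker_pairing i w (p : plane -> R) : L12 p ->
  intg mu (fun a => p a * conv_ker i w a) /\
  \int[mu]_a (p a * conv_ker i w a) = \int[mu4]_x (ker i (x.1 - x.2) * (p x.1 * w x.2)).
Proof.
move=> Lp; have k := ker_pair i Lp (X_L12 w).
have E : {ae mu, forall a : P, \int[mu]_b (ker i (a - b) * (p a * w b)) = p a * conv_ker i w a}.
  apply: filterS (ae_conv_ker i w) => a h.
  by rewrite /conv_ker -RintZ//; apply: eq_Rintegral => b _; rewrite mulrCA.
have m : meas (fun a => p a * conv_ker i w a).
  by apply: measurable_funM; [case: Lp|exact: meas_conv_ker].
have i1 := intg_section_int k.
split; first exact: intg_ae m i1 E.
rewrite -(Rfubini1 k); apply/esym; apply: Rint_ae => //.
exact: intg_meas i1.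
Qed.

(** The same pairing with the two points exchanged: in the skewness proof [w1] and [w2] then sit at
    the same points in all double integrals. *)
Lemma conv_ker_pairing' i w (p : plane -> R) : L12 p ->
  \int[mu]_a (p a * conv_ker i w a) = \int[mu4]_x (ker i (x.2 - x.1) * (p x.2 * w x.1)).
Proof.
move=> Lp.
have k : intg mu4 (fun x => ker i (x.2 - x.1) * (p x.2 * w x.1)).
  have := intgN (ker_pair i (X_L12 w) Lp).
  rewrite (_ : (fun x => - _) = (fun x : P * P => ker i (x.2 - x.1) * (p x.2 * w x.1)))//.
  by apply/funext => x; rewrite [in RHS]kerN mulNr [p _ * _]mulrC.
rewrite -(Rfubini2 k); apply: Rint_ae.
- by apply: measurable_funM; [case: Lp|exact: meas_conv_ker].
- by apply: measurableT_comp (measurable_fubini_G k); exact: fine_measurable.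
- apply: filterS (ae_conv_ker i w) => a h.
  by rewrite /conv_ker -RintZ//; apply: eq_Rintegral => b _; rewrite mulrCA.
Qed.

Lemma nonlocal_skew w1 w2 (N1 N2 : X R) : (forall x, N1 x = nonlocal w1 x) ->
  (forall x, N2 x = nonlocal w2 x) -> dotX N1 w2 + dotX w1 N2 = 0.
Proof.
move=> h1 h2.
have L w i : L12 (fun x => w x * coord i x) by apply: L12_slow; exact: slow_coord.
have D w v (N : X R) : (forall x, N x = nonlocal w x) -> dotX N v =
    - 2^-1 * (\int[mu]_a (v a * coord true a * conv_ker true w a) +
              \int[mu]_a (v a * coord false a * conv_ker false w a)).
  move=> hN; have [i1 _] := conv_ker_pairing true w (L v true).
  have [i2 _] := conv_ker_pairing false w (L v false).
  rewrite -RintD// -RintZ; last exact: intgD.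
  apply: eq_Rintegral => a _; rewrite hN nonlocalE /coord.
  by have g0 := gaussG_gt0 a; field; rewrite gt_eqF.
rewrite (D w1 w2 N1 h1) [dotX w1 N2]dotXC (D w2 w1 N2 h2).
rewrite !(conv_ker_pairing _ w1 (L w2 _)).2 !conv_ker_pairing'//.
have k1 i := ker_pair i (L w2 i) (X_L12 w1).
have k2 i : intg mu4 (fun x => ker i (x.2 - x.1) * (w1 x.2 * coord i x.2 * w2 x.1)).
  have := intgN (ker_pair i (X_L12 w2) (L w1 i)).
  rewrite (_ : (fun x => - _) = (fun x : P * P => ker i (x.2 - x.1) * (w1 x.2 * coord i x.2 * w2 x.1)))//.
  by apply/funext => x; rewrite [in RHS]kerN mulNr [w2 _ * _]mulrC.
(* As the kernel is odd, the four integrands add up to [w1 x.2 * w2 x.1] times the scalar product of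
   the kernel with [x.1 - x.2]. *)
have S : \int[mu4]_x (ker true (x.1 - x.2) * (w2 x.1 * coord true x.1 * w1 x.2)) +
    \int[mu4]_x (ker false (x.1 - x.2) * (w2 x.1 * coord false x.1 * w1 x.2)) +
    (\int[mu4]_x (ker true (x.2 - x.1) * (w1 x.2 * coord true x.2 * w2 x.1)) +
    \int[mu4]_x (ker false (x.2 - x.1) * (w1 x.2 * coord false x.2 * w2 x.1))) = 0.
  rewrite -!RintD//; [|exact: intgD|exact: intgD].
  under eq_Rintegral => x _.
    rewrite [ker true (x.2 - _)]kerN [ker false (x.2 - _)]kerN.
    have -> : ker true (x.1 - x.2) * (w2 x.1 * coord true x.1 * w1 x.2) +
        ker false (x.1 - x.2) * (w2 x.1 * coord false x.1 * w1 x.2) +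
        (- ker true (x.1 - x.2) * (w1 x.2 * coord true x.2 * w2 x.1) +
         - ker false (x.1 - x.2) * (w1 x.2 * coord false x.2 * w2 x.1)) =
        w1 x.2 * w2 x.1 * (ker true (x.1 - x.2) * (x.1 - x.2).1 + ker false (x.1 - x.2) * (x.1 - x.2).2).
      by rewrite /coord /=; ring.
    rewrite ker_orth mulr0.
    over.
  by rewrite /Rintegral integral0.
have aux (a b c d e : R) : a + b + (c + d) = 0 -> e * (a + b) + e * (c + d) = 0.
  by move=> h; rewrite -mulrDr h mulr0.
exact: aux S.
Qed.

End biot_savart_kernel.


(** * The Gaussian vortex as an angular velocity *)

Section angular_velocity.
Context (R : realType).
Local Notation plane := (R * R)%type.
Local Notation mu := (leb2 R).
Local Notation mR := (measurableTypeR R).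
Local Notation P := (mR * mR)%type.
Local Notation meas f := (measurable_fun [set: P] (f : P -> mR)).
Local Notation G := (@gaussG R).
Local Notation e1 := (e1 R).
Local Notation e2 := (e2 R).
Implicit Types (u v w f g : X R) (x z : plane) (phi : plane -> R).

(** Division by 0 gives the value 0 at the origin, not the continuous extension, so identities
    involving derivatives of [Om] are stated off the origin. *)
Definition Om x : R := (1 - expR (- sqnorm x / 4)) / (2 * pi * sqnorm x).

(* The derivative of Om with respect to |x|^2, away from the origin. *)
Definition dOm x : R :=
  ((sqnorm x)^-1 * (expR (- sqnorm x / 4) / 4) - (sqnorm x) ^- 2 * (1 - expR (- sqnorm x / 4))) / (2 * pi).

Lemma vGE x : vG x = (- x.2 * Om x, x.1 * Om x).
Proof. by rewrite /vG /kernelK /Om /=; congr (_, _); ring. Qed.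

Lemma sqnorm_gt0 x : x != 0 -> 0 < sqnorm x.
Proof.
move=> x0; rewrite lt_neqAle sqnorm_ge0 andbT eq_sym; apply: contra x0.
rewrite /sqnorm paddr_eq0 ?sqr_ge0// !sqrf_eq0 => /andP[/eqP h1 /eqP h2].
by apply/eqP; rewrite [x]surjective_pairing h1 h2.
Qed.

Lemma Om_bound x : 0 <= Om x <= 1.
Proof.
have [x0|x0] := eqVneq (sqnorm x) 0; first by rewrite /Om x0 mulr0 invr0 mulr0 lexx ler01.
have s0 : 0 < sqnorm x by rewrite lt_neqAle eq_sym x0 sqnorm_ge0.
have pi1 : 1 <= 2 * pi :> R by have := pi_ge2 R; lra.
have d0 : 0 < 2 * pi * sqnorm x by rewrite mulr_gt0// mulr_gt0// pi_gt0.
rewrite /Om divr_ge0 ?(ltW d0)//=; last first.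
  by rewrite subr_ge0 -[leRHS]expR0 ler_expR mulNr oppr_le0 divr_ge0// ltW.
rewrite ler_pdivrMr// mul1r.
have := expR_ge1Dx (- sqnorm x / 4); have : sqnorm x <= 2 * pi * sqnorm x by rewrite ler_peMl// ltW.
lra.
Qed.

Lemma dOm_bound x : `|dOm x| <= 1.
Proof.
rewrite /dOm; have [->|x0] := eqVneq (sqnorm x) 0.
  by rewrite expr0n /= invr0 !mul0r subrr mul0r normr0 ler01.
have s0 : 0 < sqnorm x by rewrite lt_neqAle eq_sym x0 sqnorm_ge0.
have pi1 : 1 <= 2 * pi :> R by have := pi_ge2 R; lra.
have pi0 : 0 < 2 * pi :> R by lra.
rewrite normrM normfV (gtr0_norm pi0) ler_pdivrMr// mul1r; apply: le_trans pi1.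
(* The numerator lies between 0 and [s ^+ 2 / 16], by the convexity bounds
   [1 + s / 4 <= expR (s / 4)] and [1 - s / 4 <= expR (- s / 4)]. *)
set s := sqnorm x; have -> : s^-1 * (expR (- s / 4) / 4) - s ^- 2 * (1 - expR (- s / 4)) =
   - ((1 - expR (- s / 4) * (1 + s / 4)) / s ^+ 2) by rewrite /s; field.
rewrite normrN normrM normfV ger0_norm; last first.
  rewrite subr_ge0 -ler_pdivlMl ?expR_gt0// mulr1 -expRN mulNr opprK.
  exact: expR_ge1Dx.
rewrite ger0_norm ?sqr_ge0// ler_pdivrMr ?exprn_gt0// mul1r.
have e := expR_ge1Dx (- s / 4); have h : 0 <= 1 + s / 4 by rewrite addr_ge0// divr_ge0// ltW.
have := ler_wpM2r h e; nra.
Qed.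

Lemma meas_Om : meas Om.
Proof.
have ms := @meas_sqnorm R.
apply: measurable_funM.
  apply: measurable_funB => //; apply: measurableT_comp => //.
  by apply: measurable_funM => //; exact: measurableT_comp.
by apply: (measurableT_comp (@measurable_invr R)); exact: measurable_funM.
Qed.

Lemma meas_dOm : meas dOm.
Proof.
have ms := @meas_sqnorm R.
have me : meas (fun x => expR (- sqnorm x / 4)).
  apply: measurableT_comp => //; apply: measurable_funM => //; exact: measurableT_comp.
apply: measurable_funM => //; apply: measurable_funB.
  apply: measurable_funM; last exact: measurable_funM.
  by apply: (measurableT_comp (@measurable_invr R)).
apply: measurable_funM; last exact: measurable_funB.
by apply: (measurableT_comp (@measurable_invr R)); exact: measurable_funX.
Qed.

Lemma Om_radial (r : R) : r != 0 ->
  is_derive r (1 : R) (fun r => (1 - expR (- r / 4)) / (2 * pi * r))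
    ((r^-1 * (expR (- r / 4) / 4) - r ^- 2 * (1 - expR (- r / 4))) / (2 * pi)).
Proof.
move=> r0; have pi0 : pi != 0 :> R by rewrite gt_eqF// pi_gt0.
have E (s : R) : - s / 4 = - 4^-1 * s + 0 by rewrite addr0; field.
have i1 := is_derive_affine (- 4^-1) 0 r.
have i2 : is_derive r (1 : R) (fun s => expR (- s / 4)) (expR (- r / 4) * - 4^-1).
  have := @is_derive1_comp R expR (fun s : R => - 4^-1 * s + 0) r _ _ (is_derive_expR _) i1.
  by rewrite -E (_ : _ \o _ = (fun s => expR (- s / 4)))//; apply/funext => s; rewrite E.
have i3 := is_deriveB (is_derive_cst (1 : R) r (1 : R)) i2.
have i4 : is_derive r (1 : R) (fun s => 2 * pi * s) (2 * pi).
  by have := is_derive_affine (2 * pi) 0 r; under eq_fun do rewrite addr0.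
have i5 := is_deriveV _ i4; have i6 := is_deriveM i3 (i5 _).
have nz : 2 * pi * r != 0 by rewrite !mulf_neq0.
have := i6 nz; rewrite /= => i; apply: is_derive_eq; rewrite !scale_mul.
have aux (e p : R) : p != 0 -> (1 - e) * (- (2 * p * r) ^- 2 * (2 * p)) + (2 * p * r)^-1 * (0 - e * - 4^-1) =
    (r^-1 * (e / 4) - r ^- 2 * (1 - e)) / (2 * p) by move=> p0; field; rewrite p0 r0.
exact: aux.
Qed.

Lemma sq_derive (c t : R) : is_derive t (1 : R) (fun t : R => t ^+ 2 + c) (2 * t).
Proof.
have := is_deriveD (is_deriveX 2 (is_derive_id t (1 : R))) (is_derive_cst c t (1 : R)).
by rewrite addr0 scale_mul mulr1 /=.
Qed.

Lemma vG_D1 phi x : (forall x, derivable phi x e1) -> x != 0 ->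
  'D_e1 ((fst \o @vG R) \* phi) x = - x.2 * (dOm x * (2 * x.1)) * phi x + - x.2 * Om x * 'D_e1 phi x.
Proof.
move=> d /sqnorm_gt0 x0; rewrite derive_e1.
have i1 : is_derive x.1 (1 : R) (fun t : R => phi (t, x.2)) ('D_e1 phi x).
  by rewrite derive_e1; apply: DeriveDef => //; exact/derivable_e1.
have i2 := @is_derive1_comp R _ (fun t : R => t ^+ 2 + x.2 ^+ 2) x.1 _ _
  (Om_radial (lt0r_neq0 x0)) (sq_derive (x.2 ^+ 2) x.1).
have i3 := is_deriveM (is_deriveZ (- x.2) i2) i1.
have -> : (fun t : R => ((fst \o @vG R) \* phi) (t, x.2)) =
  ((- x.2) *: ((fun r => (1 - expR (- r / 4)) / (2 * pi * r)) \o (fun t => t ^+ 2 + x.2 ^+ 2)) *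
   (fun t : R => phi (t, x.2))).
  by apply/funext => t; transitivity ((vG (t, x.2)).1 * phi (t, x.2)) => //; rewrite vGE.
rewrite (@derive_val _ _ _ _ _ _ _ i3) !scale_mul.
have -> : phi (x.1, x.2) = phi x by rewrite -surjective_pairing.
rewrite -[X in X * _ + _ = _]/(- x.2 * Om x) -/(dOm x) addrC; congr (_ + _).
by rewrite [LHS]mulrC.
Qed.

Lemma vG_D2 phi x : (forall x, derivable phi x e2) -> x != 0 ->
  'D_e2 ((snd \o @vG R) \* phi) x = x.1 * (dOm x * (2 * x.2)) * phi x + x.1 * Om x * 'D_e2 phi x.
Proof.
move=> d /sqnorm_gt0 x0; rewrite derive_e2.
have sC : x.2 ^+ 2 + x.1 ^+ 2 = sqnorm x by rewrite /sqnorm addrC.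
have i1 : is_derive x.2 (1 : R) (fun t : R => phi (x.1, t)) ('D_e2 phi x).
  by rewrite derive_e2; apply: DeriveDef => //; exact/derivable_e2.
have x0' : x.2 ^+ 2 + x.1 ^+ 2 != 0 by rewrite sC lt0r_neq0.
have i2 := @is_derive1_comp R _ (fun t : R => t ^+ 2 + x.1 ^+ 2) x.2 _ _
  (Om_radial x0') (sq_derive (x.1 ^+ 2) x.2).
have i3 := is_deriveM (is_deriveZ x.1 i2) i1.
have -> : (fun t : R => ((snd \o @vG R) \* phi) (x.1, t)) =
  (x.1 *: ((fun r => (1 - expR (- r / 4)) / (2 * pi * r)) \o (fun t => t ^+ 2 + x.1 ^+ 2)) *
   (fun t : R => phi (x.1, t))).
  apply/funext => t; transitivity ((vG (x.1, t)).2 * phi (x.1, t)) => //.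
  by rewrite vGE /Om /sqnorm /= [x.1 ^+ 2 + _]addrC.
rewrite (@derive_val _ _ _ _ _ _ _ i3) !scale_mul.
have -> : phi (x.1, x.2) = phi x by rewrite -surjective_pairing.
rewrite [X in X * _ + _ = _](_ : _ = x.1 * Om x); last by rewrite /Om -sC.
rewrite sC -/(dOm x) addrC; congr (_ + _).
by rewrite [LHS]mulrC.
Qed.

Definition dtheta (phi : plane -> R) x : R := x.1 * 'D_e2 phi x - x.2 * 'D_e1 phi x.

(** The derivative of the product with [vG] is not computed at the origin; a change at one point
    preserves measurability. *)
Lemma meas_off0 (f g : plane -> R) : meas g -> (forall x, x != 0 -> f x = g x) -> meas f.
Proof.
move=> mg fg.
rewrite (_ : f = (fun x => g x + (f 0 - g 0) * \1_[set (0 : P)] x)).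
  apply: measurable_funD => //; apply: measurable_funM => //.
  apply: measurable_indic; rewrite (_ : [set (0 : P)] = [set (0 : mR)] `*` [set (0 : mR)]).
    exact: measurableX.
  apply/seteqP; split => [_ ->//|[a b] [/= -> ->]//].
apply/funext => x; rewrite indicE; have [->|x0] := eqVneq x 0.
  by rewrite mem_set// mulr1 addrC subrK.
by rewrite memNset ?mulr0 ?addr0 ?fg//= => /eqP; rewrite (negbTE x0).
Qed.

Lemma ae_off0 : {ae mu, forall x : P, x != 0}.
Proof.
pose A : set mR := [set (0 : R)].
exists (A `*` setT); split.
- by apply: measurableX => //; exact: measurable_set1.
- have -> : mu (A `*` setT) = (@lebesgue_measure R A * @lebesgue_measure R setT)%E.
    by apply: product_measure1E => //; exact: measurable_set1.
  by rewrite lebesgue_measure_set1 mul0e.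
- by move=> x /= /negP; rewrite negbK => /eqP ->.
Qed.

(** The field is divergence free: the terms with [dOm] from the two components cancel, leaving the
    angular derivative of [phi]. *)
Lemma transport_vGE w phi : test_function phi ->
  distr_transport (@vG R) (distr w) phi = - \int[mu]_x (w x * (Om x * dtheta phi x)).
Proof.
move=> t; have [d1 t1] := test_D1 t; have [d2 t2] := test_D2 t.
have sOm : slow Om by apply: (slow_bounded (B := 1)) meas_Om _ => x; have /andP[h1 h2] := Om_bound x; rewrite ger0_norm.
have sdOm : slow dOm by apply: (slow_bounded (B := 1)) meas_dOm _; exact: dOm_bound.
pose f1 x := - x.2 * (dOm x * (2 * x.1)) * phi x + - x.2 * Om x * 'D_e1 phi x.
pose f2 x := x.1 * (dOm x * (2 * x.2)) * phi x + x.1 * Om x * 'D_e2 phi x.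
have sx := slow_fst R; have sy := slow_snd R.
have syN : slow (fun x : plane => - x.2).
  by have := slowZ (-1) sy; under eq_fun do rewrite mulN1r.
have s1 : slow f1.
  apply: slowD; apply: slowM; try exact: test_slow.
    by apply: slowM => //; apply: slowM => //; exact: slowZ.
  exact: slowM.
have s2 : slow f2.
  apply: slowD; apply: slowM; try exact: test_slow.
    by apply: slowM => //; apply: slowM => //; exact: slowZ.
  exact: slowM.
have E1 : \int[mu]_x (w x * 'D_e1 ((fst \o @vG R) \* phi) x) = \int[mu]_x (w x * f1 x).
  have h x : x != 0 -> 'D_e1 ((fst \o @vG R) \* phi) x = f1 x by exact: vG_D1.
  apply: Rint_ae.
  - by apply: measurable_funM; [exact: X_meas|exact: meas_off0 s1.1 h].
  - by apply: measurable_funM; [exact: X_meas|exact: s1.1].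
  - by apply: filterS ae_off0 => x x0; rewrite h.
have E2 : \int[mu]_x (w x * 'D_e2 ((snd \o @vG R) \* phi) x) = \int[mu]_x (w x * f2 x).
  have h x : x != 0 -> 'D_e2 ((snd \o @vG R) \* phi) x = f2 x by exact: vG_D2.
  apply: Rint_ae.
  - by apply: measurable_funM; [exact: X_meas|exact: meas_off0 s2.1 h].
  - by apply: measurable_funM; [exact: X_meas|exact: s2.1].
  - by apply: filterS ae_off0 => x x0; rewrite h.
rewrite /distr_transport /= /distr_mul /distr_D /distr E1 E2 -opprD -RintD; [|exact: intg_slow|exact: intg_slow].
by congr (- _); apply: eq_Rintegral => x _; rewrite /f1 /f2 /dtheta; ring.
Qed.

End angular_velocity.


(** * Weak angular derivatives *)

Section weak_rotation.
Context (R : realType).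
Local Notation plane := (R * R)%type.
Local Notation mu := (leb2 R).
Local Notation mR := (measurableTypeR R).
Local Notation P := (mR * mR)%type.
Local Notation meas f := (measurable_fun [set: P] (f : P -> mR)).
Local Notation G := (@gaussG R).
Local Notation e1 := (e1 R).
Local Notation e2 := (e2 R).
Implicit Types (u v w f g : X R) (p q : {poly R}) (k : plane -> R) (x : plane).

Let dotC := @dotXC R.
Let dotL := @dotXL R.
Let dot0 := @dotX_ge0 R.

(** The angular derivative of the polynomial [p.[x.1] * q.[x.2]]. *)
Definition rot p q x : R := x.1 * (p.[x.1] * (q^`()).[x.2]) - x.2 * ((p^`()).[x.1] * q.[x.2]).

(* The weak form of [g k = (x.1 D_e2 - x.2 D_e1) (u k)] for a radial k, against
   polynomials. *)
Definition weak_rot u g k := forall p q,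
  \int[mu]_x (g x * (k x * (p.[x.1] * q.[x.2]))) = - \int[mu]_x (u x * (k x * rot p q x)).

Lemma slow_rot p q : slow (rot p q).
Proof.
have s1 : slow (fun x : plane => x.1 * (p.[x.1] * (q^`()).[x.2])).
  by apply: slowM; [exact: slow_fst|exact: slow_pq].
have s2 : slow (fun x : plane => x.2 * ((p^`()).[x.1] * q.[x.2])).
  by apply: slowM; [exact: slow_snd|exact: slow_pq].
have := slowD s1 (slowZ (-1) s2); rewrite (_ : (fun x => _) = rot p q)//.
by apply/funext => x; rewrite /rot mulN1r.
Qed.

Lemma transport_weak_rot w u g : represents g (distr_transport (@vG R) (distr w)) ->
  (forall x, u x = Om x * w x) -> weak_rot u g (fun=> 1).
Proof.
move=> rg uE p q.
have c0 := cvg_dlim (w := g) (cutoff_lim p) (cutoff_lim q).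
have c1 := cvg_Rint_dlim (w := u) (slow_fst R) (cutoff_lim p) (cutoff_D_lim q).
have c2 := cvg_Rint_dlim (w := u) (slow_snd R) (cutoff_D_lim p) (cutoff_lim q).
have c : (- (\int[mu]_x (u x * (x.1 * (cutoff p N x.1 * (cutoff q N)^`()%classic x.2))) -
    \int[mu]_x (u x * (x.2 * ((cutoff p N)^`()%classic x.1 * cutoff q N x.2))))) @[N --> \oo] -->
    - (\int[mu]_x (u x * (x.1 * (p.[x.1] * (q^`()).[x.2]))) -
       \int[mu]_x (u x * (x.2 * ((p^`()).[x.1] * q.[x.2])))).
  by apply: cvgN; exact: cvgB.
transitivity (dotX g (psi p q)).
  by rewrite dotX_psi; apply: eq_Rintegral => x _; rewrite mul1r.
rewrite -(cvg_lim (@Rhausdorff R) c0).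
transitivity (- (\int[mu]_x (u x * (x.1 * (p.[x.1] * (q^`()).[x.2]))) -
       \int[mu]_x (u x * (x.2 * ((p^`()).[x.1] * q.[x.2]))))); last first.
  congr (- _); rewrite -RintB.
  - by apply: eq_Rintegral => x _; rewrite /rot mul1r mulrBr.
  - by apply: intg_slow; apply: slowM; [exact: slow_fst|exact: slow_pq].
  - by apply: intg_slow; apply: slowM; [exact: slow_snd|exact: slow_pq].
rewrite -(cvg_lim (@Rhausdorff R) c); congr (limn _); apply/funext => N.
have t := cutoff2_test p q N.
apply: (eq_trans (rg _ t)); apply: (eq_trans (transport_vGE w t)); congr (- _).
have [_ t1] := test_D1 t; have [_ t2] := test_D2 t.
have s1 := slowM (slow_fst R) (test_slow t2).
have s2 := slowM (slow_snd R) (test_slow t1).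
have E : \int[mu]_x (w x * (Om x * dtheta (cutoff2 p q N) x)) =
    \int[mu]_x (u x * (x.1 * 'D_e2 (cutoff2 p q N) x)) - \int[mu]_x (u x * (x.2 * 'D_e1 (cutoff2 p q N) x)).
  rewrite -(RintB (intg_slow u s1) (intg_slow u s2)).
  have aux (a o b b' d d' : R) : a * (o * (b * b' - d * d')) = o * a * (b * b') - o * a * (d * d') by ring.
  by apply: eq_Rintegral => x _; rewrite uE; exact: aux.
apply: (eq_trans E); congr (_ - _); apply: eq_Rintegral => x _; congr (_ * (_ * _)).
- exact: (congr1 (fun F => F x) (cutoff2_D2 p q N)).
- exact: (congr1 (fun F => F x) (cutoff2_D1 p q N)).
Qed.

Lemma hermite_deriv' m : (hermite R m)^`() = - (m%:R / 2) *: hermite R m.-1.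
Proof. by case: m => [|m]; [rewrite derivC mul0r oppr0 scale0r|exact: hermite_deriv]. Qed.

(** In the angular derivative of a Hermite product the terms where both indices drop cancel, so the
    level is preserved. At index 0 the predecessor is harmless, its factor being 0. *)
Lemma weak_rot_hpsi u g m n : weak_rot u g (fun=> 1) ->
  dotX g (hpsi R m n) = - (n%:R * dotX u (hpsi R m.+1 n.-1) - m%:R * dotX u (hpsi R m.-1 n.+1)).
Proof.
move=> h; rewrite /hpsi.
transitivity (- (dotX u (psi ('X * hermite R m) (hermite R n)^`()) -
                 dotX u (psi (hermite R m)^`() ('X * hermite R n)))).
  rewrite dotX_psi; transitivity (\int[mu]_x (g x * (1 * ((hermite R m).[x.1] * (hermite R n).[x.2])))).
    by apply: eq_Rintegral => x _; rewrite mul1r.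
  rewrite h; congr (- _); rewrite !dotX_psi -RintB; [|exact: intg_slow (slow_pq _ _)|exact: intg_slow (slow_pq _ _)].
  by apply: eq_Rintegral => x _; rewrite /rot !hornerM !hornerX; ring.
congr (- _); rewrite !mulX_hermite !hermite_deriv'.
have BL a b r : dotX u (psi (a - b) r) = dotX u (psi a r) - dotX u (psi b r).
  rewrite -[a]scale1r -scaleN1r psiDl (sdotDr dotC dotL) psiZl !(sdotZr dotC dotL) mul1r mulN1r scale1r//.
have BR a b r : dotX u (psi r (a - b)) = dotX u (psi r a) - dotX u (psi r b).
  rewrite -[a]scale1r -scaleN1r psiDr (sdotDr dotC dotL) psiZr !(sdotZr dotC dotL) mul1r mulN1r scale1r//.
rewrite !psiZl !psiZr !(sdotZr dotC dotL) BL BR !psiZl !psiZr !(sdotZr dotC dotL).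
have aux (a b A B D : R) : 2 * (- (b / 2) * (- (a / 2) * A - B)) - - (a / 2) * (2 * (- (b / 2) * A - D)) =
  b * B - a * D by field.
exact: aux.
Qed.

Lemma sum_pairs (F : nat * nat -> R) M :
  \sum_(p <- pairs M) F p = \sum_(N < M) \sum_(i < N.+1) F (i : nat, N - i)%N.
Proof.
elim: M => [|M ih]; first by rewrite big_nil big_ord0.
rewrite big_ord_recr -[pairs _]/(pairs M ++ [seq (i, M - i)%N | i <- iota 0 M.+1]) big_cat /= ih.
congr (_ + _); rewrite -[(0, M - 0)%N :: _]/([seq (i, M - i)%N | i <- iota 0 M.+1]) big_map.
by rewrite -{1}[M.+1]subn0 -/(index_iota 0 M.+1) big_mkord.
Qed.

(** Reindexing by one: the extreme terms carry a factor 0, and the ratios of [hnorm2] turn both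
    coefficients into 2 over the norm one level below. *)
Lemma level_shift (a b : nat -> nat -> R) N :
  \sum_(i < N.+1) (i%:R * (a i.-1 (N - i).+1 * b i (N - i)%N) / hnorm2 R i (N - i)) =
  \sum_(i < N.+1) ((N - i)%:R * (b i.+1 (N - i).-1 * a i (N - i)%N) / hnorm2 R i (N - i)).
Proof.
rewrite big_ord_recl big_ord_recr /= mul0r mul0r add0r subnn mul0r mul0r addr0.
apply: eq_bigr => i _; rewrite /fintype.bump /= add1n add0n.
have [n nE] : exists n, (N - i = n.+1)%N by exists (N - i).-1; rewrite prednK// subn_gt0.
have -> : (N - i.+1 = n)%N by rewrite subnS nE.
rewrite nE hnorm2S hnorm2Sr /=.
have h := hnorm2_gt0 R i n.
have n0 : n.+1%:R != 0 :> R by [].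
have i0 : i.+1%:R != 0 :> R by [].
have aux (r s h' x y : R) : r != 0 -> s != 0 -> h' != 0 ->
    r * (x * y) / (r / 2 * h') = s * (y * x) / (s / 2 * h').
  by move=> r0 s0 h0; field; rewrite r0 s0 h0.
by apply: aux => //; rewrite gt_eqF.
Qed.

(** The Parseval sums cancel exactly on each level, hence for every partial sum over whole levels,
    and no convergence of separate pieces is involved. *)
Lemma rot_skew u1 g1 u2 g2 : weak_rot u1 g1 (fun=> 1) -> weak_rot u2 g2 (fun=> 1) ->
  dotX g1 u2 = - dotX u1 g2.
Proof.
move=> r1 r2.
have c1 := @parseval R (X R) (@dotX R) dotC dotL dot0 _ _ _ uniq_pairs mem_pairs (@X_complete R) _ (@basis_on R) (@basis_total R) g1 u2.
have c2 := @parseval R (X R) (@dotX R) dotC dotL dot0 _ _ _ uniq_pairs mem_pairs (@X_complete R) _ (@basis_on R) (@basis_total R) u1 g2.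
rewrite -(cvg_lim (@Rhausdorff R) c1) -(cvg_lim (@Rhausdorff R) (cvgN c2)).
congr (limn _); apply/funext => M; apply/eqP; rewrite -subr_eq0 opprK.
have E u v (p : nat * nat) : dotX u (basis R p) * dotX v (basis R p) = dotX u (hp R p) * dotX v (hp R p) / hn R p.
  rewrite !coef_basis mulrACA -expr2 exprVn sqr_sqrtr; last exact: ltW (hn_gt0 _ _).
  by rewrite mulrC.
rewrite (eq_bigr (fun p : nat * nat => dotX g1 (hp R p) * dotX u2 (hp R p) / hn R p)); last by move=> p _; exact: E.
rewrite [X in _ + X](eq_bigr (fun p : nat * nat => dotX u1 (hp R p) * dotX g2 (hp R p) / hn R p)); last by move=> p _; exact: E.
rewrite -big_split /= sum_pairs big1// => N _.
pose a m n := dotX u1 (hpsi R m n); pose b m n := dotX u2 (hpsi R m n).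
have s1 := level_shift a b N; have s2 := level_shift b a N.
rewrite (eq_bigr (fun i : 'I_N.+1 =>
   (i%:R * (a i.-1 (N - i).+1 * b i (N - i)%N) / hnorm2 R i (N - i) -
    (N - i)%:R * (b i.+1 (N - i).-1 * a i (N - i)%N) / hnorm2 R i (N - i)) +
   (i%:R * (b i.-1 (N - i).+1 * a i (N - i)%N) / hnorm2 R i (N - i) -
    (N - i)%:R * (a i.+1 (N - i).-1 * b i (N - i)%N) / hnorm2 R i (N - i)))).
  by rewrite big_split /= !sumrB s1 s2 !subrr addr0.
move=> i _; rewrite /hp /hn /= (weak_rot_hpsi _ _ r1) (weak_rot_hpsi _ _ r2) -/(a _ _) -/(b _ _).
rewrite -!/(a _ _) -!/(b _ _).
move: (a _ _) (a _ _) (a _ _) (b _ _) (b _ _) (b _ _) (hnorm2 _ _ _)^-1 => *; ring.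
Qed.

Lemma slow_sqnorm : slow (@sqnorm R).
Proof.
have s1 := slowM (slow_fst R) (slow_fst R); have s2 := slowM (slow_snd R) (slow_snd R).
exact: slowD s1 s2.
Qed.

(** [|x|^2] is absorbed into the polynomials as [x.1^2 p] and [x.2^2 q]; the extra terms cancel
    because its angular derivative is 0. *)
Lemma weak_rot_r2 u g k : slow k -> weak_rot u g k -> weak_rot u g (fun x => sqnorm x * k x).
Proof.
move=> sk h p q.
have i1 w p' q' : intg mu (fun x => w x * (k x * (p'.[x.1] * q'.[x.2]))).
  by apply: intg_slow; apply: slowM => //; exact: slow_pq.
have i2 w p' q' : intg mu (fun x => w x * (k x * rot p' q' x)).
  by apply: intg_slow; apply: slowM => //; exact: slow_rot.
transitivity (\int[mu]_x (g x * (k x * (('X * ('X * p)).[x.1] * q.[x.2]))) +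
              \int[mu]_x (g x * (k x * (p.[x.1] * ('X * ('X * q)).[x.2])))).
  rewrite -(RintD (i1 _ _ _) (i1 _ _ _)); apply: eq_Rintegral => x _.
  by rewrite !hornerM !hornerX /sqnorm; ring.
rewrite !h -opprD -(RintD (i2 _ _ _) (i2 _ _ _)); congr (- _); apply: eq_Rintegral => x _.
by rewrite /rot !derivM !derivX !hornerD !hornerM !hornerD !hornerM !hornerX !hornerC /sqnorm; ring.
Qed.

Lemma weak_rotD u g k1 k2 : slow k1 -> slow k2 -> weak_rot u g k1 -> weak_rot u g k2 ->
  weak_rot u g (fun x => k1 x + k2 x).
Proof.
move=> s1 s2 h1 h2 p q.
have i1 w k p' q' : slow k -> intg mu (fun x => w x * (k x * (p'.[x.1] * q'.[x.2]))).
  by move=> sk; apply: intg_slow; apply: slowM => //; exact: slow_pq.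
have i2 w k p' q' : slow k -> intg mu (fun x => w x * (k x * rot p' q' x)).
  by move=> sk; apply: intg_slow; apply: slowM => //; exact: slow_rot.
have aux (a b c d A B : R) : A = a + b -> a = - c -> b = - d -> B = c + d -> A = - B.
  by move=> -> -> -> ->; rewrite opprD.
apply: aux (h1 p q) (h2 p q) _.
  by rewrite -(RintD (i1 g _ p q s1) (i1 g _ p q s2)); apply: eq_Rintegral => x _; ring.
by rewrite -(RintD (i2 u _ p q s1) (i2 u _ p q s2)); apply: eq_Rintegral => x _; ring.
Qed.

Lemma weak_rotZ u g c k : slow k -> weak_rot u g k -> weak_rot u g (fun x => c * k x).
Proof.
move=> sk h p q.
have i1 : intg mu (fun x => g x * (k x * (p.[x.1] * q.[x.2]))).
  by apply: intg_slow; apply: slowM => //; exact: slow_pq.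
have i2 : intg mu (fun x => u x * (k x * rot p q x)).
  by apply: intg_slow; apply: slowM => //; exact: slow_rot.
transitivity (c * \int[mu]_x (g x * (k x * (p.[x.1] * q.[x.2])))).
  by rewrite -(RintZ c i1); apply: eq_Rintegral => x _; ring.
by rewrite h mulrN -(RintZ c i2); congr (- _); apply: eq_Rintegral => x _; ring.
Qed.

(** Partial sums of the exponential are polynomials in [|x|^2]; the bound on [c] is what allows
    dominated convergence in [exp_series_lim]. *)
Lemma weak_rot_exp u g k (c : R) : bounded_meas k -> 0 <= c <= 1 / 64 -> weak_rot u g k ->
  weak_rot u g (fun x => k x * expR (- (c * sqnorm x))).
Proof.
move=> bk /andP[c0 c1] h p q; have sk := bounded_slow bk.
have my : meas (fun x => c * sqnorm x) by apply: measurable_funM => //; exact: meas_sqnorm.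
have hy (x : plane) : 0 <= c * sqnorm x <= sqnorm x / 64.
  have s0 := sqnorm_ge0 x; rewrite mulr_ge0//= mulrC ler_wpM2l//; lra.
have l1 := exp_series_lim (w := g) bk (slow_pq p q) my hy.
have l2 := exp_series_lim (w := u) bk (slow_rot p q) my hy.
rewrite -(cvg_lim (@Rhausdorff R) l1) -(cvg_lim (@Rhausdorff R) (cvgN l2)).
congr (limn _); apply/funext => n.
suff [_] : slow (fun x => k x * series (exp_coeff (- (c * sqnorm x))) n) /\
  weak_rot u g (fun x => k x * series (exp_coeff (- (c * sqnorm x))) n) by apply.
have pw i : slow (fun x => sqnorm x ^+ i * k x) /\ weak_rot u g (fun x => sqnorm x ^+ i * k x).
  elim: i => [|i [si hi]].
    by rewrite (_ : (fun x => _) = k)//; apply/funext => x; rewrite expr0 mul1r.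
  rewrite (_ : (fun x => _) = (fun x => sqnorm x * (sqnorm x ^+ i * k x))).
    by split; [apply: slowM => //; exact: slow_sqnorm|exact: weak_rot_r2].
  by apply/funext => x; rewrite exprS mulrA.
elim: n => [|n [sn hn]].
  rewrite (_ : (fun x => _) = (fun x => 0 * k x)).
    by split; [exact: slowZ|exact: weak_rotZ].
  by apply/funext => x; rewrite /series /= big_geq// mulr0 mul0r.
have [s' h'] := pw n.
rewrite (_ : (fun x => _) = (fun x => k x * series (exp_coeff (- (c * sqnorm x))) n +
    ((- c) ^+ n / n`!%:R) * (sqnorm x ^+ n * k x))).
  by split; [apply: slowD => //; exact: slowZ|apply: weak_rotD => //; [exact: slowZ|exact: weak_rotZ]].
apply/funext => x; rewrite /series /= big_nat_recr//= mulrDr; congr (_ + _).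
have aux (a s k' f' : R) : k' * (a * s * f') = a * f' * (s * k') by ring.
by rewrite /exp_coeff /= -mulNr exprMn; exact: aux.
Qed.

End weak_rotation.


(** * Skew-symmetry of Lambda *)

Section skew_symmetry.
Context (R : realType).
Local Notation plane := (R * R)%type.
Local Notation mu := (leb2 R).
Local Notation mR := (measurableTypeR R).
Local Notation P := (mR * mR)%type.
Local Notation meas f := (measurable_fun [set: P] (f : P -> mR)).
Local Notation G := (@gaussG R).
Implicit Types (u v w f g : X R) (p q : {poly R}) (k : plane -> R) (x : plane).

Lemma X_mul w k : bounded_meas k -> exists u : X R, forall x, u x = k x * w x.
Proof.
move=> [mk [B hB]]; apply: X_of; first by apply: measurable_funM => //; exact: X_meas.
apply: (intg_le _ (intgZ (B ^+ 2) (X_sqr_intg w))).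
  apply: measurable_funM; first exact: meas_gaussV.
  by apply: measurable_funX; apply: measurable_funM => //; exact: X_meas.
move=> x; have g0 : 0 <= (G x)^-1 by rewrite invr_ge0 ltW// gaussG_gt0.
rewrite ger0_norm; last by rewrite mulr_ge0// sqr_ge0.
rewrite exprMn mulrCA; apply: ler_wpM2r; first by rewrite mulr_ge0// sqr_ge0.
rewrite -[k x ^+ 2]real_normK ?num_real// lerXn2r// nnegrE//.
exact: le_trans (normr_ge0 _) (hB x).
Qed.

Lemma bounded_Om : bounded_meas (@Om R).
Proof.
split; first exact: meas_Om.
by exists 1 => x; have /andP[h1 h2] := Om_bound x; rewrite ger0_norm.
Qed.

(** The rate is at most 1/64, as [weak_rot_exp] requires, and tends to 0, so that the factor
    disappears in the limit. *)
Definition decay n x : R := expR (- ((n + 64)%:R^-1 * sqnorm x)).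
Definition exp_quarter x : R := expR (- (4^-1 * sqnorm x)).

(* Om times inverse_Om n is cutoff_Om n, which increases to 1 off the origin. *)
Definition inverse_Om n x : R :=
  2 * pi * (sqnorm x * \sum_(j < n) (decay n x * exp_quarter x ^+ j)).
Definition cutoff_Om n x : R := decay n x * (1 - exp_quarter x ^+ n).

Lemma expN_bound (c : R) x : 0 <= c -> 0 < expR (- (c * sqnorm x)) <= 1.
Proof.
move=> c0; rewrite expR_gt0/= -[leRHS]expR0 ler_expR oppr_le0 mulr_ge0//.
exact: sqnorm_ge0.
Qed.

Lemma meas_expN (c : R) : meas (fun x => expR (- (c * sqnorm x))).
Proof.
apply: measurableT_comp => //; apply: measurableT_comp => //.
by apply: measurable_funM => //; exact: meas_sqnorm.
Qed.

Lemma bounded_expN (c : R) : 0 <= c -> bounded_meas (fun x => expR (- (c * sqnorm x))).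
Proof.
move=> c0; split; first exact: meas_expN.
by exists 1 => x; have /andP[h1 h2] := expN_bound x c0; rewrite gtr0_norm.
Qed.

(** The rate 1/4 is too large for a single power series; sixteen factors of rate 1/64 reach it,
    boundedness being kept at each step. *)
Lemma weak_rot_exp_quarter u g k : bounded_meas k -> weak_rot u g k ->
  bounded_meas (fun x => k x * exp_quarter x) /\ weak_rot u g (fun x => k x * exp_quarter x).
Proof.
move=> bk hk; have h i : bounded_meas (fun x => k x * expR (- (64^-1 * sqnorm x)) ^+ i) /\
    weak_rot u g (fun x => k x * expR (- (64^-1 * sqnorm x)) ^+ i).
  elim: i => [|i [bi hi]].
    by rewrite (_ : (fun x => _) = k)//; apply/funext => x; rewrite expr0 mulr1.
  rewrite (_ : (fun x => _) = (fun x => k x * expR (- (64^-1 * sqnorm x)) ^+ i * expR (- (64^-1 * sqnorm x)))).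
    split; first by apply: boundedM => //; exact: bounded_expN.
    by apply: weak_rot_exp => //; rewrite invr_ge0 ler0n mul1r lexx.
  by apply/funext => x; rewrite exprSr mulrA.
have := h 16%N; rewrite (_ : (fun x => _) = (fun x => k x * exp_quarter x))//.
by apply/funext => x; rewrite -expRM_natl /exp_quarter; congr (_ * expR _); field.
Qed.

Lemma weak_rot_inverse_Om u g n : weak_rot u g (fun=> 1) -> weak_rot u g (inverse_Om n).
Proof.
move=> h.
have c0 : (0 : R) <= (n + 64)%:R^-1 by rewrite invr_ge0.
have hj j : bounded_meas (fun x => decay n x * exp_quarter x ^+ j) /\ weak_rot u g (fun x => decay n x * exp_quarter x ^+ j).
  elim: j => [|j [bj hj]].
    rewrite (_ : (fun x => _) = (fun x => 1 * decay n x)); last first.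
      by apply/funext => x; rewrite expr0 mulrC.
    split; first by apply: boundedM; [exact: bounded_cst|exact: bounded_expN].
    apply: weak_rot_exp => //; first exact: bounded_cst.
    by rewrite c0/= mul1r lef_pV2 ?posrE ?ltr0n ?addn_gt0 ?orbT// ler_nat leq_addl.
  have [] := weak_rot_exp_quarter bj hj.
  by rewrite (_ : (fun x => _) = (fun x => decay n x * exp_quarter x ^+ j.+1))//; apply/funext => x; rewrite exprSr mulrA.
have hs m : slow (fun x => \sum_(j < m) (decay n x * exp_quarter x ^+ j)) /\
    weak_rot u g (fun x => \sum_(j < m) (decay n x * exp_quarter x ^+ j)).
  elim: m => [|m [sm hm]].
    rewrite (_ : (fun x => _) = (fun x => 0 * 1)); last by apply/funext => x; rewrite big_ord0 mul0r.
    by split; [exact: slow_cst|apply: weak_rotZ => //; exact: slow_cst].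
  rewrite (_ : (fun x => _) = (fun x => \sum_(j < m) (decay n x * exp_quarter x ^+ j) + decay n x * exp_quarter x ^+ m)).
    have [/bounded_slow sj wj] := hj m.
    by split; [exact: slowD|exact: weak_rotD].
  by apply/funext => x; rewrite big_ord_recr.
have [s w'] := hs n; apply: weak_rotZ; last exact: weak_rot_r2.
by apply: slowM => //; exact: slow_sqnorm.
Qed.

(** The numerator [1 - exp_quarter] of [Om] telescopes with the geometric sum; at the origin both
    sides are 0. *)
Lemma Om_inverse n x : Om x * inverse_Om n x = cutoff_Om n x.
Proof.
rewrite /Om /inverse_Om /cutoff_Om -mulr_sumr.
have -> : 1 - exp_quarter x ^+ n = (1 - exp_quarter x) * \sum_(j < n) exp_quarter x ^+ j.
  by rewrite -opprB subrX1 -mulNr opprB.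
have -> : expR (- sqnorm x / 4) = exp_quarter x by rewrite /exp_quarter; congr expR; field.
have [x0|x0] := eqVneq (sqnorm x) 0.
  by rewrite x0 /exp_quarter x0 !mulr0 oppr0 expR0 subrr !mul0r mulr0.
have aux (s r e d S : R) : s != 0 -> r != 0 ->
    (1 - e) / (2 * r * s) * (2 * r * (s * (d * S))) = d * ((1 - e) * S).
  by move=> s0 r0; field; rewrite s0 r0.
by apply: aux => //; rewrite gt_eqF// pi_gt0.
Qed.

Lemma cutoff_Om_bound n x : 0 <= cutoff_Om n x <= 1.
Proof.
have c0 : (0 : R) <= (n + 64)%:R^-1 by rewrite invr_ge0.
have /andP[d0 d1] := expN_bound x c0.
have /andP[e0 e1] : 0 < exp_quarter x <= 1 by apply: expN_bound; rewrite invr_ge0.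
have p0 : 0 <= exp_quarter x ^+ n by rewrite exprn_ge0// ltW.
have p1 : exp_quarter x ^+ n <= 1 by rewrite exprn_ile1// ltW.
rewrite /cutoff_Om -/(decay n x) in d0 d1 *.
by rewrite mulr_ge0 ?subr_ge0 ?(ltW d0)//= mulr_ile1 ?subr_ge0 ?(ltW d0)// lerBlDr lerDl.
Qed.

Lemma meas_cutoff_Om n : meas (cutoff_Om n).
Proof.
apply: measurable_funM; first exact: meas_expN.
by apply: measurable_funB => //; apply: measurable_funX; exact: meas_expN.
Qed.

(** [decay] bounds the factor [|x|^2] by [n + 64], and the geometric sum has [n] terms at most 1. *)
Lemma bounded_inverse_Om n : bounded_meas (inverse_Om n).
Proof.
have md := meas_expN ((n + 64)%:R^-1); have me := meas_expN 4^-1.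
split.
  apply: measurable_funM => //; apply: measurable_funM; first exact: meas_sqnorm.
  apply: measurable_sum => j; apply: measurable_funM => //; exact: measurable_funX.
exists (2 * pi * ((n + 64)%:R * n%:R)) => x.
have n64 : (0 : R) < (n + 64)%:R by rewrite ltr0n addn_gt0 orbT.
have c0 : (0 : R) < (n + 64)%:R^-1 by rewrite invr_gt0.
have s0 := sqnorm_ge0 x.
have /andP[d0 d1] := expN_bound x (ltW c0).
have /andP[e0 e1] : 0 < exp_quarter x <= 1 by apply: expN_bound; rewrite invr_ge0.
have pi0 : 0 <= 2 * pi :> R by rewrite mulr_ge0// pi_ge0.
rewrite /inverse_Om -mulr_sumr; set S := \sum_(j < n) _.
have S0 : 0 <= S by apply: sumr_ge0 => j _; rewrite exprn_ge0// ltW.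
have Sn : S <= n%:R.
  rewrite -[n in leRHS]card_ord -sum1_card natr_sum; apply: ler_sum => j _.
  by rewrite exprn_ile1// ltW.
rewrite ger0_norm; last by exact: mulr_ge0 pi0 (mulr_ge0 s0 (mulr_ge0 (ltW d0) S0)).
rewrite ler_wpM2l// mulrA ler_pM// ?mulr_ge0 ?(ltW d0)//.
rewrite /decay expRN ler_pdivrMr ?expR_gt0//.
rewrite -ler_pdivrMl//; apply: le_trans (expR_ge1Dx _); rewrite lerDr//.
Qed.

Lemma cutoff_Om_cvg x : x != 0 -> cutoff_Om n x @[n --> \oo] --> (1 : R).
Proof.
move=> /sqnorm_gt0 s0.
rewrite -[X in _ --> X](_ : 1 * (1 - 0) = 1); last by rewrite subr0 mulr1.
apply: cvgM.
  have h : - ((n + 64)%:R^-1 * sqnorm x) @[n --> \oo] --> (0 : R).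
    rewrite -[X in _ --> X]oppr0; apply: cvgN; rewrite -[X in _ --> X](mul0r (sqnorm x)).
    apply: cvgM; last exact: cvg_cst.
    have := @cvg_harmonic R; rewrite -(cvg_shiftn 63) /harmonic /=.
    by under eq_fun do rewrite -addnS.
  by rewrite /decay -[X in _ --> X]expR0; apply: continuous_cvg; [exact: continuous_expR|exact: h].
apply: cvgB; first exact: cvg_cst.
apply: cvg_expr; rewrite gtr0_norm ?expR_gt0// /exp_quarter expR_lt1 oppr_lt0 mulr_gt0//.
Qed.

(** Write c for [cutoff_Om n]. The functions [c w2] and [inverse_Om n * g2] lie in X, the second
    being the weak angular derivative of the first; [rot_skew] against [Om w1] and [g1] gives
    skewness with the factor c, which then tends to 1. *)
Lemma transport_skew w1 w2 g1 g2 :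
  represents g1 (distr_transport (@vG R) (distr w1)) ->
  represents g2 (distr_transport (@vG R) (distr w2)) ->
  dotX g1 w2 + dotX w1 g2 = 0.
Proof.
move=> r1 r2; have mV := @meas_gaussV R.
have [u1 u1E] := X_mul w1 bounded_Om; have [u2 u2E] := X_mul w2 bounded_Om.
have wr1 := transport_weak_rot r1 u1E; have wr2 := transport_weak_rot r2 u2E.
have bc n : bounded_meas (cutoff_Om n).
  split; first exact: meas_cutoff_Om.
  by exists 1 => x; have /andP[h1 h2] := cutoff_Om_bound n x; rewrite ger0_norm.
have E n : \int[mu]_x (cutoff_Om n x * ((G x)^-1 * g1 x * w2 x)) =
         - \int[mu]_x (cutoff_Om n x * ((G x)^-1 * w1 x * g2 x)).
  have [U UE] := X_mul w2 (bc n); have [H HE] := X_mul g2 (bounded_inverse_Om n).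
  have wrn : weak_rot U H (fun=> 1).
    move=> p q; have := weak_rot_inverse_Om n wr2 p q.
    have -> : \int[mu]_x (g2 x * (inverse_Om n x * (p.[x.1] * q.[x.2]))) =
        \int[mu]_x (H x * (1 * (p.[x.1] * q.[x.2]))).
      by apply: eq_Rintegral => x _; rewrite HE; ring.
    have -> : \int[mu]_x (u2 x * (inverse_Om n x * rot p q x)) = \int[mu]_x (U x * (1 * rot p q x)).
      by apply: eq_Rintegral => x _; rewrite UE u2E -Om_inverse; ring.
    by [].
  have -> : \int[mu]_x (cutoff_Om n x * ((G x)^-1 * g1 x * w2 x)) = dotX g1 U.
    by apply: eq_Rintegral => x _; rewrite UE; ring.
  have -> : \int[mu]_x (cutoff_Om n x * ((G x)^-1 * w1 x * g2 x)) = dotX u1 H.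
    by apply: eq_Rintegral => x _; rewrite HE u1E -Om_inverse; ring.
  exact: rot_skew wr1 wrn.
have lim (a b : X R) : \int[mu]_x (cutoff_Om n x * ((G x)^-1 * a x * b x)) @[n --> \oo] --> dotX a b.
  have i := dotX_intg a b; have mi := intg_meas i.
  pose F n (x : P) := cutoff_Om n x * ((G x)^-1 * a x * b x).
  have mF n : meas (F n) by apply: measurable_funM => //; exact: meas_cutoff_Om.
  have Fle n (x : P) : `|F n x| <= `|(G x)^-1 * a x * b x|.
    rewrite normrM; have /andP[h1 h2] := cutoff_Om_bound n x.
    by rewrite (ger0_norm h1) ler_piMl.
  have Fc : {ae mu, forall x : P, F n x @[n --> \oo] --> (G x)^-1 * a x * b x}.
    apply: filterS (@ae_off0 R) => x x0.
    rewrite -[X in _ --> X]mul1r; apply: cvgM; last exact: cvg_cst.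
    exact: cutoff_Om_cvg.
  exact: (Rdct mF mi (intg_norm i) Fle Fc).
apply/eqP; rewrite addr_eq0; apply/eqP.
rewrite -(cvg_lim (@Rhausdorff R) (lim g1 w2)) -(cvg_lim (@Rhausdorff R) (cvgN (lim w1 g2))).
by congr (limn _); apply/funext => n; exact: E.
Qed.

Lemma slow_Om_dtheta phi : test_function phi -> slow (fun x => Om x * dtheta phi x).
Proof.
move=> t; have [_ t1] := test_D1 t; have [_ t2] := test_D2 t.
apply: slowM; first exact: bounded_slow bounded_Om.
have s1 := slowM (slow_fst R) (test_slow t2).
have s2 := slowZ (-1) (slowM (slow_snd R) (test_slow t1)).
have := slowD s1 s2; rewrite (_ : (fun x => _ + _) = dtheta phi)//.
by apply/funext => x; rewrite mulN1r.
Qed.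

(** Cut-off polynomials are test functions, so both functions have the same pairings with all
    [psi p q], and these are total. *)
Lemma represents_uniq f g T : represents f T -> represents g T -> heq (@dotX R) f g.
Proof.
move=> rf rg; apply/(heqP (@dotXC R) (@dotX_ge0 R)); apply: psi_total => p q.
rewrite (sdotBl (@dotXL R)); apply/eqP; rewrite subr_eq0; apply/eqP.
have cf := cvg_dlim (w := f) (cutoff_lim p) (cutoff_lim q).
have cg := cvg_dlim (w := g) (cutoff_lim p) (cutoff_lim q).
rewrite -(cvg_lim (@Rhausdorff R) cf) -(cvg_lim (@Rhausdorff R) cg).
congr (limn _); apply/funext => N.
exact: (eq_trans (rf _ (cutoff2_test p q N)) (esym (rg _ (cutoff2_test p q N)))).
Qed.

(** The nonlocal term lies in X for every [w] in X, so both terms of Lambda can be handled as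
    vectors, up to equality almost everywhere. *)
Lemma graph_LambdaP w f : graph_Lambda w f <->
  exists g N : X R, [/\ represents g (distr_transport (@vG R) (distr w)),
    (forall x, N x = nonlocal w x) & heq (@dotX R) f (g + N)].
Proof.
have XD (g N : X R) x : (g + N : X R) x = g x + N x by rewrite -[g in LHS]scale1r X_lin mul1r.
split=> [[g rg fE]|[g [N [rg hN fE]]]].
  have [N hN] := nonlocal_X w.
  exists g, N; split=> //; apply/heqX.
  have {}fE : {ae mu, forall x : P, f x = g x + nonlocal w x} := fE.
  by apply: filterS fE => x ->; rewrite XD hN.
exists g => //; move/heqX : fE => fE.
have h : {ae mu, forall x : P, f x = g x + nonlocal w x}.
  by apply: filterS fE => x ->; rewrite XD hN.
exact: h.
Qed.

Lemma dom_graph_Lambda : dom (@graph_Lambda R) = @dom_Lambda R.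
Proof.
apply/seteqP; split=> w; first by move=> [f [g rg _]]; exists g.
move=> [g rg]; have [N hN] := nonlocal_X w.
exists (g + N); apply/graph_LambdaP; exists g, N; split=> //.
exact/heqX/aeW.
Qed.

Lemma transport_ext u v phi : test_function phi -> heq (@dotX R) u v ->
  distr_transport (@vG R) (distr u) phi = distr_transport (@vG R) (distr v) phi.
Proof.
move=> t /heqX uv; rewrite !transport_vGE//; congr (- _).
have s := slow_Om_dtheta t.
apply: Rint_ae.
- by apply: measurable_funM; [exact: X_meas|exact: s.1].
- by apply: measurable_funM; [exact: X_meas|exact: s.1].
- by apply: filterS uv => x ->.
Qed.

Lemma transport_lin a u v phi : test_function phi ->
  distr_transport (@vG R) (distr (a *: u + v : X R)) phi =
  a * distr_transport (@vG R) (distr u) phi + distr_transport (@vG R) (distr v) phi.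
Proof.
move=> t; rewrite !transport_vGE// mulrN -opprD; congr (- _).
exact: distr_slow_lin (slow_Om_dtheta t).
Qed.

(** The nonlocal term is linear only almost everywhere, where its integrals converge;
    single-valuedness comes from [represents_uniq]. *)
Lemma graph_Lambda_linear : linear_operator (@dotX R) (@graph_Lambda R).
Proof.
have XD (g N : X R) x : (g + N : X R) x = g x + N x by rewrite -[g in LHS]scale1r X_lin mul1r.
split.
- have [N hN] := nonlocal_X (0 : X R); apply: (graph_LambdaP (0 : X R) (0 : X R)).2; exists 0, N; split=> //.
    move=> phi t; rewrite distr0 transport_vGE//.
    by rewrite -[LHS]oppr0; congr (- _); exact/esym/distr0.
  apply/heqX/aeW => x; rewrite XD hN nonlocalE.
  have c0 i : conv_ker i (0 : X R) x = 0.
    by rewrite /conv_ker; under eq_Rintegral do rewrite mulr0; rewrite /Rintegral integral0.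
  by rewrite !c0 -[(0 : X R) x]/0 !mulr0 addr0 mulr0 oppr0 addr0.
- move=> a u v f f' /graph_LambdaP[g [N [rg hN /heqX fE]]] /graph_LambdaP[g' [N' [rg' hN' /heqX fE']]].
  apply/graph_LambdaP; have [M hM] := nonlocal_X (a *: u + v).
  exists (a *: g + g' : X R), M; split=> //.
    by move=> phi t; rewrite distr_lin// transport_lin// (rg _ t) (rg' _ t).
  apply/heqX; have nl := nonlocal_lin a u v.
  have h : {ae mu, forall x : P, a * f x + f' x = a * g x + g' x + (a * nonlocal u x + nonlocal v x)}.
    apply: filterS2 fE fE' => x -> ->; rewrite !XD hN hN'; ring.
  by apply: filterS2 h nl => x h1 h2; rewrite X_lin h1 XD X_lin hM h2.
- move=> u u' f f' uu' ff' /graph_LambdaP[g [N [rg hN fE]]].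
  apply/graph_LambdaP; exists g, N; split.
  + by move=> phi t; rewrite (rg _ t); exact: transport_ext.
  + by move=> x; rewrite hN; apply: nonlocal_ae; exact/heqX.
  + move/heqX : ff' => ff'; move/heqX : fE => fE; apply/heqX.
    by apply: filterS2 ff' fE => x <- ->.
- move=> u f f' /graph_LambdaP[g [N [rg hN /heqX fE]]] /graph_LambdaP[g' [N' [rg' hN' /heqX fE']]].
  have /heqX gg := represents_uniq rg rg'; apply/heqX.
  have h : {ae mu, forall x : P, f x = g' x + nonlocal u x}.
    by apply: filterS2 fE gg => x h1 h2; rewrite h1 XD h2 hN.
  by apply: filterS2 h fE' => x -> ->; rewrite XD hN'.
Qed.

Lemma graph_Lambda_skew w1 w2 f1 f2 : graph_Lambda w1 f1 -> graph_Lambda w2 f2 ->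
  dotX f1 w2 + dotX w1 f2 = 0.
Proof.
move=> /graph_LambdaP[g1 [N1 [r1 n1 h1]]] /graph_LambdaP[g2 [N2 [r2 n2 h2]]].
rewrite (heq_dot (@dotXC R) (@dotXL R) (@dotX_ge0 R) w2 h1).
rewrite [dotX w1 f2]dotXC (heq_dot (@dotXC R) (@dotXL R) (@dotX_ge0 R) w1 h2).
rewrite !(sdotDl (@dotXL R)) [dotX g2 w1]dotXC [dotX N2 w1]dotXC addrACA.
by rewrite (transport_skew r1 r2) (nonlocal_skew n1 n2) addr0.
Qed.

End skew_symmetry.

Theorem lemma4p1 (R : realType) :
  [/\ dom (@graph_L R) = @dom_L R,
      selfadjoint (@dotX R) (@graph_L R),
      compact_resolvent (@dotX R) (@graph_L R),
      purely_discrete_spectrum (@dotX R) (@graph_L R) &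
      spectrum (@dotX R) (@graph_L R) =
        [set z : R[i] | exists n : nat, z = (- (n%:R / 2))%:C%C]]
  /\
  [/\ dom (@graph_Lambda R) = @dom_Lambda R,
      linear_operator (@dotX R) (@graph_Lambda R) &
      forall w1 w2 f1 f2 : X R,
        graph_Lambda w1 f1 -> graph_Lambda w2 f2 ->
        dotX f1 w2 + dotX w1 f2 = 0].
Proof.
have [sa cr pd sp] := graph_L_spectral_properties R.
split; split=> //.
- exact: dom_graph_L.
- exact: dom_graph_Lambda.
- exact: graph_Lambda_linear.
- exact: graph_Lambda_skew.
Qed.
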